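(* Let $c\geq 1$ be a surreal number and let $Q\in Sk$. The set of real numbers $r\in\mathbb R^{>0}$ such that there exists $h\in Sk$ with $(h/Q)^c\sim r$ is well ordered and has no accumulation points in $\mathbb R$ (hence it has order type $\leq\omega$).
   Context: $Sk$ is the smallest set of functions $\mathbb R^{>0}\to\mathbb R^{>0}$ containing the constant function $1$ and the identity function $\mathbf{x}$, and such that whenever $f,g\in Sk$ also $f+g$, $fg$ and $f^g$ belong to $Sk$. Skolem functions are identified with surreal numbers via the unique map $Sk\to\mathbf{No}$ (Conway's field of surreal numbers with Gonshor's exponential $\exp$ and its inverse $\log$) sending $\mathbf{x}$ to $\omega$ and preserving $1$, $+$, $\cdot$ and $(a,b)\mapsto a^b=\exp(b\log a)$; this map is order preserving, where $f<g$ in $Sk$ means $f(x)<g(x)$ for all sufficiently large $x$. For $c\in\mathbf{No}^{>0}$ and positive surreal $z$, $z^c=\exp(c\log z)$. For surreals $f,g$: $f\preceq g$ means $|f|\leq n|g|$ for some $n\in\mathbb N$; $f\asymp g$ means $f\preceq g$ and $g\preceq f$; $f\prec g$ means $f\preceq g$ and not $f\asymp g$; $f\sim g$ means $f-g\prec f$. *)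

(* Defs.v *)
From HB Require Import structures.
From mathcomp Require Import all_boot all_order all_algebra.
From mathcomp Require Import all_classical all_reals all_analysis.

Set Implicit Arguments.
Unset Strict Implicit.
Unset Printing Implicit Defensive.

Import Order.TTheory GRing.Theory Num.Theory.
Import numFieldNormedType.Exports.

Local Open Scope classical_set_scope.
Local Open Scope ring_scope.

(* Conway's construction of No: [Game l r] is { l i | r j }, a surreal number *)
(* is a game satisfying [surreal] below, and [geqv] is equality of surreal     *)
(* numbers. Operations act on representatives.                                *)
Inductive game : Type := Game (L R : Type) (l : L -> game) (r : R -> game).

HB.instance Definition _ := gen_eqMixin game.
HB.instance Definition _ := gen_choiceMixin game.

Definition lindex (x : game) : Type := let: @Game L _ _ _ := x in L.
Definition rindex (x : game) : Type := let: @Game _ R _ _ := x in R.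
Definition lopt (x : game) : lindex x -> game := let: @Game _ _ l _ := x in l.
Definition ropt (x : game) : rindex x -> game := let: @Game _ _ _ r := x in r.

(* The pair (x <= y, y <= x). Conway's clause for x <= y refers to y <= x^L   *)
(* and y^R <= x, so both directions are computed together; see [gleE].        *)
Fixpoint gcmp (x : game) : game -> Prop * Prop :=
  fix gcmpx (y : game) : Prop * Prop :=
    match x, y with
    | @Game xL xR xl xr, @Game yL yR yl yr =>
      ((forall i : xL, ~ (gcmp (xl i) y).2) /\
         (forall j : yR, ~ (gcmpx (yr j)).2),
       (forall i : yL, ~ (gcmpx (yl i)).1) /\
         (forall j : xR, ~ (gcmp (xr j) y).1))
    end.

Definition gle (x y : game) : Prop := (gcmp x y).1.
Definition glt (x y : game) : Prop := gle x y /\ ~ gle y x.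
Definition geqv (x y : game) : Prop := gle x y /\ gle y x.

Lemma gcmp_unfold (x y : game) : gcmp x y =
  ((forall i, ~ (gcmp (@lopt x i) y).2) /\ (forall j, ~ (gcmp x (@ropt y j)).2),
   (forall i, ~ (gcmp x (@lopt y i)).1) /\ (forall j, ~ (gcmp (@ropt x j) y).1)).
Proof. by case: x y => [? ? ? ?] [? ? ? ?]. Qed.

Lemma gcmpC (x y : game) :
  (gcmp x y).2 = (gcmp y x).1 /\ (gcmp x y).1 = (gcmp y x).2.
Proof.
elim: x y => xL xR xl IHl xr IHr; elim=> yL yR yl IHyl yr IHyr.
rewrite !gcmp_unfold !propeqE.
split; split=> -[h1 h2]; split=> k.
- by rewrite -(IHyl k).2; exact: h1.
- by rewrite -(IHr k _).2; exact: h2.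
- by rewrite (IHyl k).2; exact: h1.
- by rewrite (IHr k _).2; exact: h2.
- by rewrite -(IHl k _).1; exact: h1.
- by rewrite -(IHyr k).1; exact: h2.
- by rewrite (IHl k _).1; exact: h1.
- by rewrite (IHyr k).1; exact: h2.
Qed.

Lemma gleE (x y : game) : gle x y <->
  (forall i, ~ gle y (@lopt x i)) /\ (forall j, ~ gle (@ropt y j) x).
Proof.
rewrite /gle gcmp_unfold; split=> -[h1 h2]; split=> k.
- by rewrite -(gcmpC _ _).1; exact: h1.
- by rewrite -(gcmpC _ _).1; exact: h2.
- by rewrite (gcmpC _ _).1; exact: h1.
- by rewrite (gcmpC _ _).1; exact: h2.
Qed.

Fixpoint surreal (x : game) : Prop :=
  let: @Game L R l r := x in
  [/\ forall i j, ~ gle (r j) (l i), forall i, surreal (l i)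
    & forall j, surreal (r j)].

Definition gzero : game := Game (@of_void game) (@of_void game).
Definition gone : game := Game (fun _ : unit => gzero) (@of_void game).

Fixpoint gneg (x : game) : game :=
  let: @Game L R l r := x in
  Game (fun j : R => gneg (r j)) (fun i : L => gneg (l i)).

Fixpoint gadd (x : game) : game -> game :=
  fix addx (y : game) : game :=
    match x, y with
    | @Game xL xR xl xr, @Game yL yR yl yr =>
      Game
        (fun k : xL + yL => match k with
                            | inl i => gadd (xl i) y
                            | inr i => addx (yl i)
                            end)
        (fun k : xR + yR => match k with
                            | inl j => gadd (xr j) y
                            | inr j => addx (yr j)
                            end)
    end.

Definition gsub (x y : game) : game := gadd x (gneg y).

Fixpoint gmul (x : game) : game -> game :=
  fix mulx (y : game) : game :=
    match x, y with
    | @Game xL xR xl xr, @Game yL yR yl yr =>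
      Game
        (fun k : (xL * yL) + (xR * yR) =>
           match k with
           | inl (i, j) =>
               gsub (gadd (gmul (xl i) y) (mulx (yl j))) (gmul (xl i) (yl j))
           | inr (i, j) =>
               gsub (gadd (gmul (xr i) y) (mulx (yr j))) (gmul (xr i) (yr j))
           end)
        (fun k : (xL * yR) + (xR * yL) =>
           match k with
           | inl (i, j) =>
               gsub (gadd (gmul (xl i) y) (mulx (yr j))) (gmul (xl i) (yr j))
           | inr (i, j) =>
               gsub (gadd (gmul (xr i) y) (mulx (yl j))) (gmul (xr i) (yl j))
           end)
    end.

(* A representative of 1/x; unspecified (zero) if x is not invertible.        *)
Definition ginv (x : game) : game :=
  xget gzero [set y | surreal y /\ geqv (gmul x y) gone].
Definition gdiv (x y : game) : game := gmul x (ginv y).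

Definition gabs (x : game) : game := if `[< gle gzero x >] then x else gneg x.

Definition gnat (n : nat) : game := iter n (fun x => gadd x gone) gzero.

Definition gint (m : int) : game :=
  match m with Posz n => gnat n | Negz n => gneg (gnat n.+1) end.

Definition grat (q : rat) : game := gdiv (gint (numq q)) (gint (denq q)).

(* { q in Q, q < r | q in Q, r < q }                                          *)
Definition greal (R : realType) (r : R) : game :=
  Game (fun q : {q : rat | ratr q < r} => grat (sval q))
       (fun q : {q : rat | r < ratr q} => grat (sval q)).

Definition gomega : game := Game gnat (@of_void game).

Definition gexpn (x : game) (n : nat) : game := iter n (gmul x) gone.

(* [x]_n = \sum_(k <= n) x^k / k!                                             *)
Definition gtaylor (x : game) (n : nat) : game :=
  \big[gadd/gzero]_(k < n.+1) gdiv (gexpn x k) (gnat k`!).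

(* Gonshor's exponential: with x' (resp. x'') ranging over the left (resp.    *)
(* right) options of x and n over nat, exp x is                               *)
(*   { 0, exp x' * [x - x']_n, exp x'' * [x - x'']_(2n+1)                     *)
(*     | exp x' / [x' - x]_(2n+1), exp x'' / [x'' - x]_n }                    *)
(* where, as in Gonshor's convention, the terms [y]_(2n+1) (here y < 0) are   *)
(* used only when positive. The recursion is uniform, i.e. its value does not *)
(* depend on the representative of x.                                         *)
Fixpoint gexp (x : game) : game :=
  let: @Game L R l r := x in
  Game
    (fun k : unit + L * nat +
             {jn : R * nat | glt gzero (gtaylor (gsub x (r jn.1)) jn.2.*2.+1)} =>
       match k with
       | inl (inl _) => gzero
       | inl (inr (i, n)) => gmul (gexp (l i)) (gtaylor (gsub x (l i)) n)
       | inr (exist (j, n) _) =>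
           gmul (gexp (r j)) (gtaylor (gsub x (r j)) n.*2.+1)
       end)
    (fun k : {im : L * nat | glt gzero (gtaylor (gsub (l im.1) x) im.2.*2.+1)} +
             R * nat =>
       match k with
       | inl (exist (i, n) _) =>
           gdiv (gexp (l i)) (gtaylor (gsub (l i) x) n.*2.+1)
       | inr (j, n) => gdiv (gexp (r j)) (gtaylor (gsub (r j) x) n)
       end).

(* The inverse of [gexp]; unspecified (zero) outside its range.               *)
Definition glog (x : game) : game :=
  xget gzero [set y | surreal y /\ geqv (gexp y) x].

Definition gpow (a b : game) : game := gexp (gmul b (glog a)).

Definition gpreceq (f g : game) : Prop :=
  exists n : nat, gle (gabs f) (gmul (gnat n) (gabs g)).
Definition gasymp (f g : game) : Prop := gpreceq f g /\ gpreceq g f.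
Definition gprec (f g : game) : Prop := gpreceq f g /\ ~ gasymp f g.
Definition gsim (f g : game) : Prop := gprec (gsub f g) f.

Section Skolem.
Variable R : realType.
Implicit Types f g : {posnum R} -> {posnum R}.

Definition pf_one : {posnum R} -> {posnum R} := fun=> 1%:pos.
Definition pf_add f g : {posnum R} -> {posnum R} :=
  fun x => ((f x)%:num + (g x)%:num)%:pos.
Definition pf_mul f g : {posnum R} -> {posnum R} :=
  fun x => ((f x)%:num * (g x)%:num)%:pos.
Definition pf_pow f g : {posnum R} -> {posnum R} :=
  fun x => ((f x)%:num `^ (g x)%:num)%:pos.

Inductive Sk : ({posnum R} -> {posnum R}) -> Prop :=
| Sk_one : Sk pf_one
| Sk_id : Sk id
| Sk_add f g : Sk f -> Sk g -> Sk (pf_add f g)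
| Sk_mul f g : Sk f -> Sk g -> Sk (pf_mul f g)
| Sk_pow f g : Sk f -> Sk g -> Sk (pf_pow f g).

(* The graph of the map Sk -> No sending x to omega and preserving 1, +, *    *)
(* and exponentiation.                                                        *)
Inductive Sk_graph : ({posnum R} -> {posnum R}) -> game -> Prop :=
| Sk_graph_one : Sk_graph pf_one gone
| Sk_graph_id : Sk_graph id gomega
| Sk_graph_add f g a b :
    Sk_graph f a -> Sk_graph g b -> Sk_graph (pf_add f g) (gadd a b)
| Sk_graph_mul f g a b :
    Sk_graph f a -> Sk_graph g b -> Sk_graph (pf_mul f g) (gmul a b)
| Sk_graph_pow f g a b :
    Sk_graph f a -> Sk_graph g b -> Sk_graph (pf_pow f g) (gpow a b).

(* For a given f, the games a with [Sk_graph f a] represent one and the same  *)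
(* surreal number, the image of f.                                            *)
Definition Sk_surreal f : game := xget gzero (Sk_graph f).

Lemma Sk_surrealP f : Sk f -> Sk_graph f (Sk_surreal f).
Proof.
move=> Sf; suff [a fa] : exists a, Sk_graph f a by exact: xgetI fa.
elim: Sf => [||{}f g _ [a fa] _ [b gb]|{}f g _ [a fa] _ [b gb]
  |{}f g _ [a fa] _ [b gb]].
- by exists gone; constructor.
- by exists gomega; constructor.
- by exists (gadd a b); constructor.
- by exists (gmul a b); constructor.
- by exists (gpow a b); constructor.
Qed.

Definition well_ordered_set (A : set R) : Prop :=
  forall B : set R, B `<=` A -> B !=set0 ->
    exists2 m, B m & forall x, B x -> m <= x.

(* For a well-ordered A, this says that the order type of A is at most omega. *)
Definition embeds_in_omega (A : set R) : Prop :=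
  exists k : R -> nat, forall x y, A x -> A y -> x < y -> (k x < k y)%N.

End Skolem.

(* Main.v *)
Require Import Defs.
From HB Require Import structures.
From mathcomp Require Import all_boot all_order all_algebra.
From mathcomp Require Import all_classical all_reals all_analysis.
From mathcomp Require Import ring lra zify.
Import Order.TTheory GRing.Theory Num.Theory.
Import numFieldNormedType.Exports.
Set Implicit Arguments.
Unset Strict Implicit.
Unset Printing Implicit Defensive.
Local Open Scope classical_set_scope.
Local Open Scope quotient_scope.
Local Open Scope ring_scope.

(* S is finite below every bound. The surreals are built as a quotient of     *)
(* games; Gonshor's exponential is a homomorphism because the two cuts at     *)
(* exp (x + y) and exp x * exp y are cofinal, by Taylor estimates, and it has *)
(* logarithms at omega and at every 1 + eps, hence at every Skolem surreal.   *)
(*   Skolem surreals are well ordered: in a descending sequence of terms of   *)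
(* successively minimal size, the immediate subterms are accessible, and the  *)
(* operations are monotone and inflationary. So it suffices to exclude        *)
(* increasing sequences. For a nondecreasing sequence (h_n) of Skolem         *)
(* surreals and a weight w > 0 such that w (h_n - h_0) is bounded, the        *)
(* differences w (h_j - h_i) are eventually infinitesimal: by induction on    *)
(* the archimedean class, split the h_n along a subsequence as a product of   *)
(* infinite factors, a power with infinite exponent, or a sum; boundedness    *)
(* passes to the components with adjusted weights, and these lie in lower     *)
(* classes, except for sums of comparable terms, which are handled by         *)
(* induction on the ratio to the least element of the class. The theorem is   *)
(* the case w = c / h_0.                                                      *)

(** A set of reals that is finite below every bound is well ordered, has no limit point and embeds
    in omega ([locally_finite_set]). Suppose that infinitely many admissible reals lay below one
    bound: distinct r_n with y_n = (h_n/Q)^c ~ r_n. Skolem surreals are well ordered ([SkN_Acc]), so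
    the h_n may be taken nondecreasing ([SkN_subseq]). Then y_j / y_i = exp (c log (h_j/h_i)), and c
    log (h_j/h_i) <= (c/h_i) (h_j - h_i). As the y_n are bounded and y_0 is not infinitesimal, w
    (h_n - h_0) is bounded for the weight w = c/h_0; here c >= 1 keeps log (h_n/h_0) itself bounded.
    If w (h_j - h_i) is eventually infinitesimal, two consecutive r_n coincide ([sim_real_eq]), a
    contradiction ([no_bounded_sequence]).

    That boundedness forces this stability is [core_stable], proved for all positive surreal weights
    at once, because the weight changes in the induction: a bound on F G with weight w is a bound on
    G with weight w F_0 and on F with weight w G_0 ([prod_stable]); for f^G, with W = w f_0^G_0, the
    weights are W log f_0 for G and W G_0/f_0 for f ([pow_stable]). Every Skolem surreal is a finite
    sum of terms 1, omega, products of infinite factors, and powers with base at least 2 and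
    infinite exponent ([SkN_Hsum]). Factors, bases and exponents lie in strictly lower archimedean
    classes than the term, which drives the main induction. A sum of two comparable terms stays in
    its class, but both terms are at least the least Skolem surreal of that class, so an induction
    on an integer ratio finishes ([SkN_dec], [core_stable]).

    The surreal side consists of the ordered field [No], Gonshor's exponential ([surreal_exp],
    [ExpD]) and enough logarithms. For exp (x + y) = exp x exp y the induction only knows the
    quotient w of the two sides through shifted cuts; these make w so close to 1 that no option of
    the product is on the wrong side ([hom_sign]). Logarithms are cut out near 1 ([log_near1]), then
    for finite numbers ([has_log_fin]), for omega ([has_log_omega]) and for sums ([has_logD]). *)

Definition Op (s : bool) (x a : game) : Prop :=
  if s then exists i, a = @lopt x i else exists j, a = @ropt x j.

(** * Preorder and addition on games *)

Lemma game_opt_ind (P : game -> Prop) :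
  (forall x, (forall s a, Op s x a -> P a) -> P x) -> forall x, P x.
Proof.
move=> H; elim=> L R l IHl r IHr; apply: H => -[] a [k ->]; [exact: IHl|exact: IHr].
Qed.

Lemma gleP x y : gle x y <->
  (forall a, Op true x a -> ~ gle y a) /\ (forall b, Op false y b -> ~ gle b x).
Proof.
split=> [/gleE[h1 h2]|[h1 h2]]; first by split=> a [i ->]; [exact: h1|exact: h2].
by apply/gleE; split=> k; [apply: h1|apply: h2]; exists k.
Qed.

Lemma gle_refl x : gle x x.
Proof.
elim/game_opt_ind: x => x IH; apply/gleP; split=> a xa /gleP[h1 h2].
  exact: h1 _ xa (IH _ _ xa).
exact: h2 _ xa (IH _ _ xa).
Qed.

(** Refuting the conclusion by an option leads to a smaller triple in cyclically rotated order, so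
    the three rotations are proved together. *)
Lemma gle_trans y x z : gle x y -> gle y z -> gle x z.
Proof.
pose T x y z := gle x y -> gle y z -> gle x z.
have core u v w : (forall a, Op true u a -> T v w a) ->
    (forall b, Op false w b -> T b u v) -> T u v w.
  move=> h1 h2 uv vw; apply/gleP; split=> a oa H.
    by case/gleP: uv => /(_ _ oa) + _; apply; exact: h1.
  by case/gleP: vw => _ /(_ _ oa); apply; exact: h2.
suff: T x y z /\ T y z x /\ T z x y by case.
elim/game_opt_ind: x y z => x IHx y; elim/game_opt_ind: y => y IHy z.
elim/game_opt_ind: z => z IHz.
split; [|split]; apply: core => a oa.
- by have [_ []] := IHx _ _ oa y z.
- by have [_ []] := IHz _ _ oa.
- by have [_ []] := IHy _ _ oa z.
- by have [] := IHx _ _ oa y z.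
- by have [] := IHz _ _ oa.
- by have [_ []] := IHy _ _ oa z.
Qed.

Lemma opt_ngle s x a : Op s x a -> if s then ~ gle x a else ~ gle a x.
Proof. by case: s => xa; have /gleP[h1 h2] := gle_refl x; [apply: h1|apply: h2]. Qed.

Lemma ngleP x y : ~ gle x y ->
  (exists2 a, Op true x a & gle y a) \/ (exists2 b, Op false y b & gle b x).
Proof.
move=> nxy; apply: contrapT => /not_orP[h1 h2]; apply: nxy; apply/gleP.
by split=> a oa H; [apply: h1|apply: h2]; exists a.
Qed.

Lemma surrealP x : surreal x <->
  (forall a b, Op true x a -> Op false x b -> ~ gle b a) /\
  (forall s a, Op s x a -> surreal a).
Proof.
case: x => L R l r; split=> [[h1 h2 h3]|[h1 h2]].
  by split=> [a b [i ->] [j ->]|[] a [i ->]]; [exact: h1|exact: h2|exact: h3].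
split=> [i j|i|j]; first by apply: h1; [exists i|exists j].
  by apply: (h2 true); exists i.
by apply: (h2 false); exists j.
Qed.

Lemma surreal_opt s x a : surreal x -> Op s x a -> surreal a.
Proof. by case/surrealP => _ H /H. Qed.

Lemma surreal_opt_le s x a : surreal x -> Op s x a ->
  if s then gle a x else gle x a.
Proof.
elim/game_opt_ind: x s a => x IH s a sx; have [H1 H2] := (surrealP x).1 sx.
case: s => xa; apply/gleP; split=> b ob.
- move=> xb; apply: (opt_ngle xa).
  exact: gle_trans xb (IH _ _ xa true _ (H2 _ _ xa) ob).
- exact: H1.
- exact: H1.
- move=> bx; apply: (opt_ngle xa).
  exact: gle_trans (IH _ _ xa false _ (H2 _ _ xa) ob) bx.
Qed.

Lemma surreal_total x y : surreal x -> surreal y -> ~ gle x y -> gle y x.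
Proof.
move=> sx sy /ngleP[[a xa ya]|[b yb bx]].
  exact: gle_trans ya (surreal_opt_le sx xa).
exact: gle_trans (surreal_opt_le sy yb) bx.
Qed.

Lemma gadd_opt s x y c : Op s (gadd x y) c <->
  (exists2 a, Op s x a & c = gadd a y) \/ (exists2 b, Op s y b & c = gadd x b).
Proof.
case: x y s => xL xR xl xr [yL yR yl yr] [].
  split=> [[[i|i] ->]|[[a [i ->] ->]|[b [i ->] ->]]].
  - by left; exists (xl i) => //; exists i.
  - by right; exists (yl i) => //; exists i.
  - by exists (inl i).
  - by exists (inr i).
split=> [[[i|i] ->]|[[a [i ->] ->]|[b [i ->] ->]]].
- by left; exists (xr i) => //; exists i.
- by right; exists (yr i) => //; exists i.
- by exists (inl i).
- by exists (inr i).
Qed.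

Lemma gneg_opt s x c : Op s (gneg x) c <-> exists2 a, Op (~~ s) x a & c = gneg a.
Proof.
by case: x s => L R l r []; split=> [[i ->]|[a [i ->] ->]];
  rewrite /=; do ?[by exists i | by eexists; [exists i|]].
Qed.

Definition gmul_term (x y a b : game) : game :=
  gsub (gadd (gmul a y) (gmul x b)) (gmul a b).

Lemma gmul_opt s x y c : Op s (gmul x y) c <->
  exists t a b, [/\ Op t x a, Op (s == t) y b & c = gmul_term x y a b].
Proof.
case: x y s => xL xR xl xr [yL yR yl yr] [].
  split=> [[[[i j]|[i j]] ->]|[[] [a [b [[i ->] [j ->] ->]]]]].
  - by exists true, (xl i), (yl j); split=> //; [exists i|exists j].
  - by exists false, (xr i), (yr j); split=> //; [exists i|exists j].
  - by exists (inl (i, j)).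
  - by exists (inr (i, j)).
split=> [[[[i j]|[i j]] ->]|[[] [a [b [[i ->] [j ->] ->]]]]].
- by exists true, (xl i), (yr j); split=> //; [exists i|exists j].
- by exists false, (xr i), (yl j); split=> //; [exists i|exists j].
- by exists (inl (i, j)).
- by exists (inr (i, j)).
Qed.

Lemma gzero_opt s a : ~ Op s gzero a. Proof. by case: s => -[]. Qed.

Lemma gone_opt s a : Op s gone a <-> s /\ a = gzero.
Proof.
by case: s; split=> [[[]]|[]] // _ ->; exists tt.
Qed.

Lemma gle_opts x y : (forall a, Op true x a -> exists2 b, Op true y b & gle a b) ->
  (forall b, Op false y b -> exists2 a, Op false x a & gle a b) -> gle x y.
Proof.
move=> h1 h2; apply/gleP; split=> a /[dup] oa.
  by move/h1 => [b yb ab] ya; apply: (opt_ngle yb); exact: gle_trans ab.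
by move/h2 => [b xb ba] ax; apply: (opt_ngle xb); exact: gle_trans ax.
Qed.

Lemma geqv_opts x y :
  (forall s a, Op s x a -> exists2 b, Op s y b & geqv a b) ->
  (forall s b, Op s y b -> exists2 a, Op s x a & geqv a b) -> geqv x y.
Proof.
move=> h1 h2; split; apply: gle_opts => a.
- by move=> /h1[b ? []]; exists b.
- by move=> /h2[b ? []]; exists b.
- by move=> /h2[b ? []]; exists b.
- by move=> /h1[b ? []]; exists b.
Qed.

Lemma geqv_refl x : geqv x x. Proof. by split; apply: gle_refl. Qed.
Lemma geqv_sym x y : geqv x y -> geqv y x. Proof. by case. Qed.
Lemma geqv_trans y x z : geqv x y -> geqv y z -> geqv x z.
Proof. by move=> [h1 h2] [h3 h4]; split; [apply: gle_trans h3|apply: gle_trans h2]. Qed.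

Lemma gaddC x y : geqv (gadd x y) (gadd y x).
Proof.
elim/game_opt_ind: x y => x IHx y; elim/game_opt_ind: y => y IHy.
apply: geqv_opts => s c /gadd_opt[[a oa ->]|[b ob ->]].
- by exists (gadd y a); [apply/gadd_opt; right; exists a|apply: IHx oa _].
- by exists (gadd b x); [apply/gadd_opt; left; exists b|apply: IHy ob].
- by exists (gadd x a); [apply/gadd_opt; right; exists a|apply: IHy oa].
- by exists (gadd b y); [apply/gadd_opt; left; exists b|apply: IHx ob _].
Qed.

Lemma gaddA x y z : geqv (gadd x (gadd y z)) (gadd (gadd x y) z).
Proof.
elim/game_opt_ind: x y z => x IHx y; elim/game_opt_ind: y => y IHy z.
elim/game_opt_ind: z => z IHz.
apply: geqv_opts => s c.
  case/gadd_opt=> [[a oa ->]|[b /gadd_opt[[a oa ->]|[a oa ->]] ->]].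
  - exists (gadd (gadd a y) z); last exact: IHx oa _ _.
    by apply/gadd_opt; left; exists (gadd a y) => //; apply/gadd_opt; left; exists a.
  - exists (gadd (gadd x a) z); last exact: IHy oa _.
    by apply/gadd_opt; left; exists (gadd x a) => //; apply/gadd_opt; right; exists a.
  - exists (gadd (gadd x y) a); last exact: IHz oa.
    by apply/gadd_opt; right; exists a.
case/gadd_opt=> [[b /gadd_opt[[a oa ->]|[a oa ->]] ->]|[a oa ->]].
- exists (gadd a (gadd y z)); last exact: IHx oa _ _.
  by apply/gadd_opt; left; exists a.
- exists (gadd x (gadd a z)); last exact: IHy oa _.
  by apply/gadd_opt; right; exists (gadd a z) => //; apply/gadd_opt; left; exists a.
- exists (gadd x (gadd y a)); last exact: IHz oa.
  by apply/gadd_opt; right; exists (gadd y a) => //; apply/gadd_opt; right; exists a.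
Qed.

Lemma gadd0 x : geqv (gadd gzero x) x.
Proof.
elim/game_opt_ind: x => x IH; apply: geqv_opts => s c.
  by case/gadd_opt=> [[a /gzero_opt//]|[a oa ->]]; exists a => //; apply: IH oa.
move=> oc; exists (gadd gzero c); last exact: IH oc.
by apply/gadd_opt; right; exists c.
Qed.

(** Monotonicity and cancellation feed each other, and passing to an option exchanges the two sides;
    hence an equivalence, proved for both orders at once. *)
Lemma gle_add2r x y z : gle (gadd x z) (gadd y z) <-> gle x y.
Proof.
suff: (gle (gadd x z) (gadd y z) <-> gle x y) /\
      (gle (gadd y z) (gadd x z) <-> gle y x) by case.
elim/game_opt_ind: x y z => x IHx y; elim/game_opt_ind: y => y IHy z.
elim/game_opt_ind: z => z IHz.
have core u v : (forall s a, Op s u a -> (gle (gadd v z) (gadd a z) <-> gle v a)) ->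
    (forall s a, Op s v a -> (gle (gadd a z) (gadd u z) <-> gle a u)) ->
    (forall s c, Op s z c -> (gle (gadd u c) (gadd v c) <-> gle u v)) ->
    gle (gadd u z) (gadd v z) <-> gle u v.
  move=> Hu Hv Hz; split=> [uv|uv].
    apply: contrapT => /ngleP[[a ua va]|[b vb bu]].
      have := (Hu _ _ ua).2 va => /(gle_trans uv) H.
      suff /opt_ngle : Op true (gadd u z) (gadd a z) by apply.
      by apply/gadd_opt; left; exists a.
    have := (Hv _ _ vb).2 bu => H.
    suff /opt_ngle : Op false (gadd v z) (gadd b z).
      by apply; exact: gle_trans uv.
    by apply/gadd_opt; left; exists b.
  apply/gleP; split=> c /gadd_opt[[a oa ->]|[a oa ->]].
  - by move/(Hu _ _ oa); case/gleP: uv => H _; exact: H.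
  - move/gle_trans => /(_ _ ((Hz _ _ oa).2 uv)) H.
    suff /opt_ngle : Op true (gadd v z) (gadd v a) by apply.
    by apply/gadd_opt; right; exists a.
  - by move/(Hv _ _ oa); case/gleP: uv => _ H; exact: H.
  - move=> /(gle_trans ((Hz _ _ oa).2 uv)) H.
    suff /opt_ngle : Op false (gadd u z) (gadd u a) by apply.
    by apply/gadd_opt; right; exists a.
split; apply: core => s a oa.
- by have [] := IHx _ _ oa y z.
- by have [] := IHy _ _ oa z.
- by have [] := IHz _ _ oa.
- by have [] := IHy _ _ oa z.
- by have [] := IHx _ _ oa y z.
- by have [] := IHz _ _ oa.
Qed.

(** A move in one summand is answered by the mirror move in the other. *)
Lemma gaddN x : geqv (gadd (gneg x) x) gzero.
Proof.
elim/game_opt_ind: x => x IH; split; apply/gleP; split=> c.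
- case/gadd_opt=> [[a /gneg_opt[b ob ->] ->]|[b ob ->]].
    move=> H; have [H1 _] := IH _ _ ob.
    suff /opt_ngle : Op false (gadd (gneg b) x) (gadd (gneg b) b).
      by apply; exact: gle_trans H1 H.
    by apply/gadd_opt; right; exists b.
  move=> H; have [H1 _] := IH _ _ ob.
  suff /opt_ngle : Op false (gadd (gneg x) b) (gadd (gneg b) b).
    by apply; exact: gle_trans H1 H.
  apply/gadd_opt; left; exists (gneg b) => //.
  by apply/gneg_opt; exists b.
- by move/gzero_opt.
- by move/gzero_opt.
- case/gadd_opt=> [[a /gneg_opt[b ob ->] ->]|[b ob ->]].
    move=> H; have [_ H1] := IH _ _ ob.
    suff /opt_ngle : Op true (gadd (gneg b) x) (gadd (gneg b) b).
      by apply; exact: gle_trans H H1.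
    by apply/gadd_opt; right; exists b.
  move=> H; have [_ H1] := IH _ _ ob.
  suff /opt_ngle : Op true (gadd (gneg x) b) (gadd (gneg b) b).
    by apply; exact: gle_trans H H1.
  apply/gadd_opt; left; exists (gneg b) => //.
  by apply/gneg_opt; exists b.
Qed.

(** * The ordered abelian group of all games *)

Definition geqvb x y := `[< geqv x y >].
Lemma geqvb_refl : reflexive geqvb. Proof. by move=> x; apply/asboolP/geqv_refl. Qed.
Lemma geqvb_sym : symmetric geqvb.
Proof. by move=> x y; apply/asboolP/asboolP => /geqv_sym. Qed.
Lemma geqvb_trans : transitive geqvb.
Proof. by move=> y x z /asboolP h /asboolP; move/(geqv_trans h)/asboolP. Qed.
Canonical geqv_equiv := EquivRel geqvb geqvb_refl geqvb_sym geqvb_trans.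

(** The quotient is taken over all games, not only surreal ones: addition respects [geqv] on
    arbitrary games, so the group laws carry no surreality hypotheses. *)
Definition gameG : Type := {eq_quot geqv_equiv}.
HB.instance Definition _ := Choice.on gameG.
Definition gq (x : game) : gameG := \pi_({eq_quot geqv_equiv}) x.
Definition grep (g : gameG) : game := repr (g : {eq_quot geqv_equiv}).

Lemma grepK g : gq (grep g) = g. Proof. exact: reprK. Qed.

Lemma gqP x y : gq x = gq y <-> geqv x y.
Proof. by split=> [/eqmodP/asboolP|/asboolP h] //; apply/eqmodP. Qed.

Lemma grep_gq x : geqv (grep (gq x)) x. Proof. by apply/gqP; rewrite grepK. Qed.

Definition gG0 := gq gzero.
Definition gGadd a b := gq (gadd (grep a) (grep b)).
Definition gGopp a := gq (gneg (grep a)).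

Lemma gadd_geqv x x' y y' : geqv x x' -> geqv y y' -> geqv (gadd x y) (gadd x' y').
Proof.
move=> [h1 h2] [h3 h4]; apply: (@geqv_trans (gadd x' y)).
  by split; apply/gle_add2r.
apply: geqv_trans (gaddC _ _) _; apply: geqv_trans (gaddC _ _).
by split; apply/gle_add2r.
Qed.

Lemma gGaddE x y : gq (gadd x y) = gGadd (gq x) (gq y).
Proof. by apply/gqP; apply: gadd_geqv; apply: geqv_sym; exact: grep_gq. Qed.

Lemma gGaddA : associative gGadd.
Proof.
move=> a b c; rewrite -[a]grepK -[b]grepK -[c]grepK -!gGaddE; apply/gqP/gaddA.
Qed.
Lemma gGaddC : commutative gGadd.
Proof. by move=> a b; rewrite -[a]grepK -[b]grepK -!gGaddE; apply/gqP/gaddC. Qed.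
Lemma gGadd0 : left_id gG0 gGadd.
Proof. by move=> a; rewrite -[a]grepK -!gGaddE; apply/gqP/gadd0. Qed.
Lemma gGaddN : left_inverse gG0 gGopp gGadd.
Proof. by move=> a; rewrite -{2}[a]grepK -!gGaddE; apply/gqP/gaddN. Qed.
HB.instance Definition _ :=
  GRing.isZmodule.Build gameG gGaddA gGaddC gGadd0 gGaddN.

Lemma gqD x y : gq (gadd x y) = gq x + gq y. Proof. exact: gGaddE. Qed.
Lemma gq0 : gq gzero = 0. Proof. by []. Qed.
Lemma gqN x : gq (gneg x) = - gq x.
Proof. by apply/eqP; rewrite -addr_eq0 -gqD; apply/eqP/gqP/gaddN. Qed.
Lemma gqB x y : gq (gsub x y) = gq x - gq y. Proof. by rewrite gqD gqN. Qed.

(** The order on [gameG] is only partial; it is handled through its cone of nonnegative elements. *)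
Definition gnn (g : gameG) : Prop := gle gzero (grep g).
Definition gpos (g : gameG) : Prop := gnn g /\ g <> 0.

Lemma gnnB x y : gnn (gq y - gq x) <-> gle x y.
Proof.
rewrite -(gle_add2r _ _ (gneg x)) /gnn -gqB.
have [h1 h2] := grep_gq (gsub y x).
have [h3 h4] := gaddN x; have [h5 h6] := gaddC x (gneg x).
split=> h.
  by apply: gle_trans h1; apply: gle_trans h; apply: gle_trans h3.
by apply: gle_trans h2; apply: gle_trans h; apply: gle_trans h6.
Qed.

Lemma gnnD a b : gnn a -> gnn b -> gnn (a + b).
Proof.
have E z : gnn z -> gle gzero (grep z).
  by move=> h; apply/gnnB; rewrite gq0 subr0 grepK.
move=> /E ha /E hb; rewrite -[a]grepK -[b]grepK -gqD -[gq _]subr0 -gq0; apply/gnnB.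
have [h1 h2] := gadd0 (grep b).
by apply: gle_trans hb _; apply: gle_trans h2 _; apply/gle_add2r.
Qed.

Lemma gnn_anti a : gnn a -> gnn (- a) -> a = 0.
Proof.
rewrite -[a]grepK => h1 h2.
have /gnnB h3 : gnn (gq (grep a) - gq gzero) by rewrite gq0 subr0.
have /gnnB h4 : gnn (gq gzero - gq (grep a)) by rewrite gq0 sub0r.
exact/gqP.
Qed.

Lemma gnn0 : gnn 0.
Proof. by have := gnnB gzero gzero; rewrite subrr => ->; apply: gle_refl. Qed.

Lemma gposW a : gpos a -> gnn a. Proof. by case. Qed.

Lemma gnnE a : gnn a -> a = 0 \/ gpos a.
Proof. by move=> h; have [->|/eqP ?] := eqVneq a 0; [left|right]. Qed.

Lemma gposD a b : gpos a -> gnn b -> gpos (a + b).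
Proof.
move=> [h1 h2] h3; split; first exact: gnnD.
move=> H; apply: h2; apply: gnn_anti => //.
by have -> : - a = b by apply/eqP; rewrite eq_sym -addr_eq0 addrC H.
Qed.

Lemma gposB x y : gpos (gq y - gq x) <-> glt x y.
Proof.
rewrite /gpos gnnB; split=> [[h1 h2]|[h1 h2]]; split=> //.
  by move=> h3; apply: h2; apply/eqP; rewrite subr_eq0; apply/eqP/gqP.
by move/eqP; rewrite subr_eq0 => /eqP/gqP[].
Qed.

Lemma gpos_nle x y : gpos (gq y - gq x) -> ~ gle y x.
Proof. by move/gposB => -[]. Qed.

Lemma gpos_opt s x a : surreal x -> Op s x a ->
  gpos (if s then gq x - gq a else - (gq x - gq a)).
Proof.
move=> sx xa; have := surreal_opt_le sx xa; have := opt_ngle xa.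
by case: s xa => xa h1 h2; rewrite ?opprB; apply/gposB.
Qed.

(** * Reflexive procedure for identities in abelian groups *)

Inductive zexpr := ZVar of nat | ZZero | ZAdd of zexpr & zexpr | ZOpp of zexpr.

Fixpoint zeval (V : zmodType) (env : seq V) (e : zexpr) : V :=
  match e with
  | ZVar i => nth 0 env i
  | ZZero => 0
  | ZAdd a b => zeval env a + zeval env b
  | ZOpp a => - zeval env a
  end.

Fixpoint zcoef (e : zexpr) (i : nat) : int :=
  match e with
  | ZVar j => if i == j then 1 else 0
  | ZZero => 0
  | ZAdd a b => zcoef a i + zcoef b i
  | ZOpp a => - zcoef a i
  end.

Lemma zevalE (V : zmodType) (env : seq V) e :
  zeval env e = \sum_(i < size env) nth 0 env i *~ zcoef e i.
Proof.
elim: e => [j||a IHa b IHb|a IHa] /=.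
- have [jlt|jge] := ltnP j (size env); last first.
    rewrite nth_default // big1 // => i _; case: eqP => // E.
    by move: (ltn_ord i); rewrite E ltnNge jge.
  rewrite (bigD1 (Ordinal jlt)) //= eqxx mulr1z big1 ?addr0 // => i /negbTE.
  by rewrite -val_eqE /= => ->.
- by rewrite big1.
- by rewrite IHa IHb -big_split; apply: eq_bigr => i _; rewrite /= mulrzDr.
- by rewrite IHa raddf_sum; apply: eq_bigr => i _; rewrite /= mulrNz.
Qed.

Lemma zeval_eq (V : zmodType) (env : seq V) e1 e2 :
  all (fun i => zcoef e1 i == zcoef e2 i) (iota 0 (size env)) ->
  zeval env e1 = zeval env e2.
Proof.
move=> /allP H; rewrite !zevalE; apply: eq_bigr => i _.
by rewrite (eqP (H i _)) // mem_iota /= add0n.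
Qed.

Ltac zindex x env :=
  lazymatch env with
  | x :: _ => constr:(0%N)
  | _ :: ?env' => let i := zindex x env' in constr:(S i)
  end.
Ltac zin x env :=
  lazymatch env with
  | x :: _ => constr:(true)
  | _ :: ?env' => zin x env'
  | _ => constr:(false)
  end.
Ltac zenv e env :=
  lazymatch e with
  | ?a + ?b => let env := zenv a env in zenv b env
  | - ?a => zenv a env
  | 0 => env
  | ?x => lazymatch zin x env with true => env | false => constr:(x :: env) end
  end.
Ltac zreify e env :=
  lazymatch e with
  | ?a + ?b => let a := zreify a env in let b := zreify b env in constr:(ZAdd a b)
  | - ?a => let a := zreify a env in constr:(ZOpp a)
  | 0 => constr:(ZZero)
  | ?x => let i := zindex x env in constr:(ZVar i)
  end.
(** Both sides are reified over a common list of atoms, and the integer coefficients of each atom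
    are compared by computation. *)
Ltac abel :=
  lazymatch goal with
  | |- @eq ?T ?x ?y =>
    let env := zenv x (@nil T) in let env := zenv y env in
    let ex := zreify x env in let ey := zreify y env in
    apply: (@zeval_eq _ env ex ey); vm_compute; reflexivity
  end.

(** * Multiplication of games *)

Lemma gq_opts x y :
  (forall s a, Op s x a -> exists2 b, Op s y b & gq a = gq b) ->
  (forall s b, Op s y b -> exists2 a, Op s x a & gq a = gq b) -> gq x = gq y.
Proof.
move=> h1 h2; apply/gqP; apply: geqv_opts => s a.
  by move/h1 => [b ? ?]; exists b => //; apply/gqP.
by move/h2 => [b ? ?]; exists b => //; apply/gqP.
Qed.

(** Multiplication does not descend to [gameG], since outside the surreals it need not respect
    equality. Hence the arguments stay games and only the value is taken in the group; the ring
    identities still hold for all games. *)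
Definition gm x y := gq (gmul x y).

Lemma gm_term x y a b : gq (gmul_term x y a b) = gm a y + gm x b - gm a b.
Proof. by rewrite gqB gqD. Qed.

Lemma gmC x y : gm x y = gm y x.
Proof.
elim/game_opt_ind: x y => x IHx y; elim/game_opt_ind: y => y IHy.
apply: gq_opts => s c /gmul_opt[t [a [b [oa ob ->]]]].
  exists (gmul_term y x b a).
    apply/gmul_opt; exists (s == t), b, a; split=> //.
    by move: oa; case: s t {ob} => -[].
  by rewrite !gm_term (IHx _ _ oa) (IHx _ _ oa) (IHy _ _ ob); abel.
exists (gmul_term x y b a).
  apply/gmul_opt; exists (s == t), b, a; split=> //.
  by move: oa; case: s t {ob} => -[].
by rewrite !gm_term (IHx _ _ ob) (IHx _ _ ob) (IHy _ _ oa); abel.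
Qed.

Lemma gm0 x : gm x gzero = 0.
Proof.
rewrite /gm -gq0; apply: gq_opts => s c; last by move/gzero_opt.
by move/gmul_opt => [t [a [b [_ /gzero_opt]]]].
Qed.

Lemma gm1 x : gm x gone = gq x.
Proof.
elim/game_opt_ind: x => x IH; apply: gq_opts => s c.
  move/gmul_opt => [t [a [b [oa /gone_opt[/eqP st ->] ->]]]].
  by exists a; rewrite ?st // gm_term (IH _ _ oa) !gm0; abel.
move=> oc; exists (gmul_term x gone c gzero).
  by apply/gmul_opt; exists s, c, gzero; split=> //; apply/gone_opt; rewrite eqxx.
by rewrite gm_term (IH _ _ oc) !gm0; abel.
Qed.

Lemma gmN x y : gm (gneg x) y = - gm x y.
Proof.
elim/game_opt_ind: x y => x IHx y; elim/game_opt_ind: y => y IHy; rewrite -gqN.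
have E a b t u : Op t x a -> Op u y b ->
    gq (gmul_term (gneg x) y (gneg a) b) = - gq (gmul_term x y a b).
  move=> oa ob; rewrite !gm_term (IHx _ _ oa) (IHx _ _ oa) (IHy _ _ ob).
  by abel.
apply: gq_opts => s c.
  case/gmul_opt=> [t [a' [b [/gneg_opt[a oa ->] ob ->]]]].
  exists (gneg (gmul_term x y a b)); last by rewrite gqN; exact: E oa ob.
  apply/gneg_opt; exists (gmul_term x y a b) => //.
  apply/gmul_opt; exists (~~ t), a, b; split=> //.
  by move: ob; case: (s) (t) => -[].
case/gneg_opt=> [d /gmul_opt[t [a [b [oa ob ->]]]] ->].
exists (gmul_term (gneg x) y (gneg a) b); last by rewrite gqN; exact: E oa ob.
apply/gmul_opt; exists (~~ t), (gneg a), b; split=> //.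
  by apply/gneg_opt; exists a; rewrite ?negbK.
by move: ob; case: (s) (t) => -[].
Qed.

Lemma gmD x y z : gm (gadd x y) z = gm x z + gm y z.
Proof.
elim/game_opt_ind: x y z => x IHx y; elim/game_opt_ind: y => y IHy z.
elim/game_opt_ind: z => z IHz; rewrite -gqD.
have E1 a c t u : Op t x a -> Op u z c ->
    gq (gmul_term (gadd x y) z (gadd a y) c) =
    gq (gadd (gmul_term x z a c) (gmul y z)).
  move=> oa oc; rewrite gqD !gm_term (IHx _ _ oa) (IHx _ _ oa) (IHz _ _ oc).
  by rewrite /gm; abel.
have E2 a c t u : Op t y a -> Op u z c ->
    gq (gmul_term (gadd x y) z (gadd x a) c) =
    gq (gadd (gmul x z) (gmul_term y z a c)).
  move=> oa oc; rewrite gqD !gm_term (IHy _ _ oa) (IHy _ _ oa) (IHz _ _ oc).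
  by rewrite /gm; abel.
apply: gq_opts => s d.
  case/gmul_opt=> [t [ab [c [/gadd_opt[[a oa ->]|[a oa ->]] oc ->]]]].
    exists (gadd (gmul_term x z a c) (gmul y z)); last exact: E1 oa oc.
    apply/gadd_opt; left; exists (gmul_term x z a c) => //.
    by apply/gmul_opt; exists t, a, c.
  exists (gadd (gmul x z) (gmul_term y z a c)); last exact: E2 oa oc.
  apply/gadd_opt; right; exists (gmul_term y z a c) => //.
  by apply/gmul_opt; exists t, a, c.
case/gadd_opt=> [[e /gmul_opt[t [a [c [oa oc ->]]]] ->]|
                 [e /gmul_opt[t [a [c [oa oc ->]]]] ->]].
  exists (gmul_term (gadd x y) z (gadd a y) c); last exact: E1 oa oc.
  apply/gmul_opt; exists t, (gadd a y), c; split=> //.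
  by apply/gadd_opt; left; exists a.
exists (gmul_term (gadd x y) z (gadd x a) c); last exact: E2 oa oc.
apply/gmul_opt; exists t, (gadd x a), c; split=> //.
by apply/gadd_opt; right; exists a.
Qed.

Lemma gmB x y z : gm (gsub x y) z = gm x z - gm y z.
Proof. by rewrite gmD gmN. Qed.

Lemma gm_terml x y a b z :
  gm (gmul_term x y a b) z = gm (gmul a y) z + gm (gmul x b) z - gm (gmul a b) z.
Proof. by rewrite gmB gmD. Qed.

Lemma gm_termr x y a b z :
  gm z (gmul_term x y a b) = gm z (gmul a y) + gm z (gmul x b) - gm z (gmul a b).
Proof. by rewrite gmC gm_terml !(gmC z). Qed.

Lemma gmA x y z : gm (gmul x y) z = gm x (gmul y z).
Proof.
elim/game_opt_ind: x y z => x IHx y; elim/game_opt_ind: y => y IHy z.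
elim/game_opt_ind: z => z IHz.
have E a b c t u v : Op t x a -> Op u y b -> Op v z c ->
    gq (gmul_term (gmul x y) z (gmul_term x y a b) c) =
    gq (gmul_term x (gmul y z) a (gmul_term y z b c)).
  move=> oa ob oc; rewrite !gm_term !gm_terml !gm_termr.
  rewrite !(IHx _ _ oa) !(IHy _ _ ob) !(IHz _ _ oc).
  by abel.
apply: gq_opts => s d.
  case/gmul_opt=> [t [w [c [/gmul_opt[u [a [b [oa ob ->]]]] oc ->]]]].
  exists (gmul_term x (gmul y z) a (gmul_term y z b c)); last exact: E oa ob oc.
  apply/gmul_opt; exists u, a, (gmul_term y z b c); split=> //.
  apply/gmul_opt; exists (t == u), b, c; split=> //.
  by move: oc; case: (s) (t) (u) => -[] [].
case/gmul_opt=> [u [a [w [oa /gmul_opt[v [b [c [ob oc ->]]]] ->]]]].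
exists (gmul_term (gmul x y) z (gmul_term x y a b) c); last exact: E oa ob oc.
apply/gmul_opt; exists (u == v), (gmul_term x y a b), c; split=> //.
  apply/gmul_opt; exists u, a, b; split=> //.
  by move: ob; case: (u) (v) => -[].
by move: oc; case: (s) (u) (v) => -[] [].
Qed.

(** * Surreal numbers are closed under the operations *)

Lemma surrealI x : (forall s a, Op s x a -> surreal a) ->
  (forall a b, Op true x a -> Op false x b -> gpos (gq b - gq a)) -> surreal x.
Proof.
move=> h1 h2; apply/surrealP; split=> // a b oa ob; exact/gpos_nle/h2.
Qed.

Lemma surreal_neg x : surreal x -> surreal (gneg x).
Proof.
elim/game_opt_ind: x => x IH sx; apply: surrealI => [s c /gneg_opt[a oa ->]|].
  exact: IH oa (surreal_opt sx oa).
move=> c d /gneg_opt[a oa ->] /gneg_opt[b ob ->]; rewrite !gqN.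
have /= ha := gpos_opt sx oa; have /= hb := gpos_opt sx ob.
have -> : - gq b - - gq a = (gq x - gq b) + - (gq x - gq a) by abel.
by apply: gposD => //; apply: gposW.
Qed.

Lemma surreal_add x y : surreal x -> surreal y -> surreal (gadd x y).
Proof.
elim/game_opt_ind: x y => x IHx y; elim/game_opt_ind: y => y IHy sx sy.
apply: surrealI => [s c /gadd_opt[[a oa ->]|[a oa ->]]|].
- exact: IHx oa _ (surreal_opt sx oa) sy.
- exact: IHy oa sx (surreal_opt sy oa).
move=> c d /gadd_opt[[a oa ->]|[a oa ->]] /gadd_opt[[b ob ->]|[b ob ->]];
  rewrite !gqD; have /= ha := gpos_opt _ oa; have /= hb := gpos_opt _ ob.
- have -> : gq b + gq y - (gq a + gq y) = - (gq x - gq b) + (gq x - gq a) by abel.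
  by apply: gposD; [apply: hb|apply/gposW/ha].
- have -> : gq x + gq b - (gq a + gq y) = - (gq y - gq b) + (gq x - gq a) by abel.
  by apply: gposD; [apply: hb|apply/gposW/ha].
- have -> : gq b + gq y - (gq x + gq a) = - (gq x - gq b) + (gq y - gq a) by abel.
  by apply: gposD; [apply: hb|apply/gposW/ha].
- have -> : gq x + gq b - (gq x + gq a) = - (gq y - gq b) + (gq y - gq a) by abel.
  by apply: gposD; [apply: hb|apply/gposW/ha].
Qed.

Lemma surreal_sub x y : surreal x -> surreal y -> surreal (gsub x y).
Proof. by move=> ? ?; apply: surreal_add => //; apply: surreal_neg. Qed.

Lemma gpos_total x y : surreal x -> surreal y ->
  [\/ gpos (gq y - gq x), gq x = gq y | gpos (gq x - gq y)].
Proof.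
move=> sx sy; have [xy|nxy] := pselect (gle x y).
  have [yx|nyx] := pselect (gle y x); first by apply: Or32; apply/gqP.
  by apply: Or31; apply/gposB.
by apply: Or33; apply/gposB; split=> //; apply: surreal_total nxy.
Qed.

(* [gD x1 x2 y1 y2] stands for (x2 - x1) (y2 - y1). *)
Definition gD x1 x2 y1 y2 := gm x2 y2 - gm x2 y1 - gm x1 y2 + gm x1 y1.

Definition gsg (s : bool) (g : gameG) := if s then g else - g.

(** Since [gD a x b y] is x y minus the option of x y built from a and b, this says that each option
    of x y lies on its proper side. *)
Definition mul_opt_pos x y := forall s t a b, Op s x a -> Op t y b ->
  gpos (gsg (s == t) (gD a x b y)).

Lemma gDC x1 x2 y1 y2 : gD x1 x2 y1 y2 = gD y1 y2 x1 x2.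
Proof. by rewrite /gD !(gmC x1) !(gmC x2); abel. Qed.

Lemma mul_opt_posC x y : mul_opt_pos x y -> mul_opt_pos y x.
Proof. by move=> H s t a b oa ob; rewrite gDC eq_sym; apply: H. Qed.

Lemma surreal_mul_opt x y : surreal (gmul x y) -> mul_opt_pos x y.
Proof.
move=> sxy s t a b oa ob.
have o : Op (s == t) (gmul x y) (gmul_term x y a b).
  apply/gmul_opt; exists s, a, b; split=> //.
  by move: ob; case: (s) (t) => -[].
have := gpos_opt sxy o; rewrite gm_term /gsg.
have -> // : gq (gmul x y) - (gm a y + gm x b - gm a b) = gD a x b y.
by rewrite /gD /gm; abel.
Qed.

Section MulMonotone.
Variables V W : game -> Prop.
Hypothesis Vo : forall s x a, V x -> Op s x a -> V a.
Hypothesis Wo : forall s x a, W x -> Op s x a -> W a.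
Hypothesis Vs : forall x, V x -> surreal x.
Hypothesis VW : forall x y, V x -> W y -> mul_opt_pos x y.

Definition mul_mono x1 x2 y := (gq x1 = gq x2 -> gm x1 y = gm x2 y) /\
  (gpos (gq x2 - gq x1) -> forall t b, Op t y b -> gpos (gsg t (gD x1 x2 b y))).

(** If x1 < x2, some option lies between: a left option of x2 above x1, or a right option of x1
    below x2. Splitting (x2 - x1) (y - b) there gives one part controlled by [VW] and one by
    induction. The classes [V] and [W] are abstract so that this can be used inside the proof of
    [surreal_mul], where only smaller products are known to be surreal. *)
Lemma mul_monoP x1 x2 y : V x1 -> V x2 -> W y -> mul_mono x1 x2 y.
Proof.
move=> V1 V2 Wy; suff: mul_mono x1 x2 y /\ mul_mono x2 x1 y by case.
elim/game_opt_ind: x1 x2 y V1 V2 Wy => x1 IH1 x2.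
elim/game_opt_ind: x2 => x2 IH2 y; elim/game_opt_ind: y => y IHy V1 V2 Wy.
have core u v : V u -> V v ->
    (forall s a, Op s u a -> mul_mono v a y /\ mul_mono a v y) ->
    (forall s a, Op s v a -> mul_mono u a y /\ mul_mono a u y) ->
    (forall s a t b, Op s u a -> Op t y b -> mul_mono a v b) ->
    (forall s a t b, Op s v a -> Op t y b -> mul_mono u a b) ->
    (forall t b, Op t y b -> mul_mono u v b) -> mul_mono u v y.
  move=> Vu Vv Hu Hv Hub Hvb Hb; split.
    have le p q : V p -> V q -> gq p = gq q ->
        (forall s a, Op s p a -> mul_mono q a y /\ mul_mono a q y) ->
        (forall s a, Op s q a -> mul_mono p a y /\ mul_mono a p y) ->
        (forall t b, Op t y b -> gm p b = gm q b) -> gle (gmul p y) (gmul q y).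
      move=> Vp Vq pq Hp Hq Hpq; apply/gleP; split.
        move=> c /gmul_opt[t [a [b [oa ob ->]]]]; apply: gpos_nle.
        have := gpos_opt (Vs Vp) oa; rewrite pq => ha.
        rewrite gm_term (Hpq _ _ ob).
        have -> : gq (gmul q y) - (gm a y + gm q b - gm a b) = gD a q b y.
          by rewrite /gD /gm; abel.
        case: t oa ob ha => oa ob ha.
          by have [_ [_ H]] := Hp _ _ oa; apply: (H ha _ _ ob).
        have [[_ H] _] := Hp _ _ oa; move: ha; rewrite opprB => ha.
        have := H ha _ _ ob; rewrite /gsg /=.
        by have -> : - gD q a b y = gD a q b y by rewrite /gD; abel.
      move=> c /gmul_opt[t [a [b [oa ob ->]]]]; apply: gpos_nle.
      have := gpos_opt (Vs Vq) oa; rewrite -pq => ha.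
      rewrite gm_term -(Hpq _ _ ob).
      have -> : (gm a y + gm p b - gm a b) - gq (gmul p y) = - gD a p b y.
        by rewrite /gD /gm; abel.
      case: t oa ob ha => oa ob ha.
        by have [_ [_ H]] := Hq _ _ oa; apply: (H ha _ _ ob).
      have [[_ H] _] := Hq _ _ oa; move: ha; rewrite opprB => ha.
      have := H ha _ _ ob; rewrite /gsg /=.
      by have -> : gD p a b y = - gD a p b y by rewrite /gD; abel.
    move=> uv; apply/gqP; split; apply: le => //.
      by move=> t b ob; have [h _] := Hb _ _ ob; apply: h.
    by move=> t b ob; have [h _] := Hb _ _ ob; rewrite h.
  move=> /gpos_nle/ngleP uv t b ob.
  have D0 p q : mul_mono p q y -> mul_mono p q b -> gq p = gq q -> gD p q b y = 0.
    by move=> [h1 _] [h2 _] E; rewrite /gD (h1 E) (h2 E); abel.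
  have sgD g h : gpos (gsg t g) -> gnn (gsg t h) -> gpos (gsg t (g + h)).
    by case: (t) => /= h1 h2; rewrite ?opprD; apply: gposD.
  have nn p q : mul_mono p q y -> mul_mono p q b -> gle p q -> gnn (gsg t (gD p q b y)).
    move=> h1 h2 /gnnB/gnnE[/eqP|pq].
      rewrite subr_eq0 => /eqP/esym pq; rewrite D0 //.
      by case: (t); rewrite /= ?oppr0; exact: gnn0.
    by case: h1 => _ /(_ pq _ _ ob)/gposW.
  case: uv => [[a oa ua]|[a oa av]].
    have -> : gD u v b y = gD a v b y + gD u a b y by rewrite /gD; abel.
    apply: sgD; last first.
      by apply: nn => //; [have [] := Hv _ _ oa|apply: Hvb oa ob].
    by have := VW Vv Wy oa ob; case: (t).
  have -> : gD u v b y = - gD a u b y + gD a v b y by rewrite /gD; abel.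
  apply: sgD; last first.
    by apply: nn => //; [have [] := Hu _ _ oa|apply: Hub oa ob].
  by have := VW Vu Wy oa ob; case: (t); rewrite /gsg //= opprK.
split; apply: core => //.
- by move=> s a oa; have [] := IH1 _ _ oa x2 y (Vo V1 oa) V2 Wy.
- by move=> s a oa; have [] := IH2 _ _ oa y V1 (Vo V2 oa) Wy.
- by move=> s a t b oa ob; have [] := IH1 _ _ oa x2 b (Vo V1 oa) V2 (Wo Wy ob).
- by move=> s a t b oa ob; have [] := IH2 _ _ oa b V1 (Vo V2 oa) (Wo Wy ob).
- by move=> t b ob; have [] := IHy _ _ ob V1 V2 (Wo Wy ob).
- by move=> s a oa; have [] := IH2 _ _ oa y V1 (Vo V2 oa) Wy.
- by move=> s a oa; have [] := IH1 _ _ oa x2 y (Vo V1 oa) V2 Wy.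
- by move=> s a t b oa ob; have [] := IH2 _ _ oa b V1 (Vo V2 oa) (Wo Wy ob).
- by move=> s a t b oa ob; have [] := IH1 _ _ oa x2 b (Vo V1 oa) V2 (Wo Wy ob).
- by move=> t b ob; have [] := IHy _ _ ob V1 V2 (Wo Wy ob).
Qed.

End MulMonotone.

(** Proper positions, reached in one or more moves. This class is closed under options, as
    [mul_monoP] and [ex_okP] require. *)
Inductive gsub_pos (x : game) : game -> Prop :=
| gsub_opt s a : Op s x a -> gsub_pos x a
| gsub_trans s a b : gsub_pos x a -> Op s a b -> gsub_pos x b.

Lemma gsub_ind (P : game -> Prop) :
  (forall x, (forall a, gsub_pos x a -> P a) -> P x) -> forall x, P x.
Proof.
move=> H x; suff [] : P x /\ (forall a, gsub_pos x a -> P a) by [].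
elim/game_opt_ind: x => x IH.
suff K : forall a, gsub_pos x a -> P a /\ (forall b, gsub_pos a b -> P b).
  by split=> [|a /K[]//]; apply: H => a /K[].
move=> a; elim=> [s {}a /IH//|s {}a b _ [_ h2] ob].
split; first exact: h2 (gsub_opt ob).
by move=> c bc; apply: h2; elim: bc => [t d od|t d e _ ad od];
  [apply: gsub_trans (gsub_opt ob) od|apply: gsub_trans ad od].
Qed.

Lemma surreal_sub_pos x a : surreal x -> gsub_pos x a -> surreal a.
Proof. by move=> sx; elim=> [s b ob|s b c _ sb ob]; apply: surreal_opt ob. Qed.

(** Compare a left option from (a, b) with a right option from (a', b'). Either a and a' lie on the
    same side of x and b, b' on opposite sides of y, or conversely; commutativity reduces the second
    case to the first. *)
Lemma surreal_mul x y : surreal x -> surreal y -> surreal (gmul x y).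
Proof.
elim/gsub_ind: x y => x IHx y; elim/gsub_ind: y => y IHy sx sy.
have Hx a1 a2 z : gsub_pos x a1 -> gsub_pos x a2 -> surreal z -> mul_mono a1 a2 z.
  apply: (@mul_monoP (gsub_pos x) surreal) => //.
  - by move=> s u v; apply: gsub_trans.
  - by move=> s u v su; apply: surreal_opt su.
  - by move=> u; apply: surreal_sub_pos.
  - by move=> u v xu sv; apply/surreal_mul_opt/IHx => //; apply: surreal_sub_pos xu.
have Hy b1 b2 : gsub_pos y b1 -> gsub_pos y b2 -> mul_mono b1 b2 x.
  move=> yb1 yb2.
  apply: (@mul_monoP (gsub_pos y) (fun z => z = x \/ gsub_pos x z)) => //.
  - by move=> s u v; apply: gsub_trans.
  - move=> s u v [->|xu] ov; right; first exact: gsub_opt ov.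
    exact: gsub_trans ov.
  - by move=> u; apply: surreal_sub_pos.
  - move=> u v yu xv; apply/mul_opt_posC/surreal_mul_opt.
    have su := surreal_sub_pos sy yu.
    case: xv => [->|xv]; first exact: IHy.
    by apply: IHx => //; apply: surreal_sub_pos xv.
  - by left.
apply: surrealI.
  move=> s c /gmul_opt[t [a [b [oa ob ->]]]].
  have sa := surreal_opt sx oa; have sb := surreal_opt sy ob.
  apply: surreal_sub; first apply: surreal_add.
  - exact: IHx (gsub_opt oa) _ sa sy.
  - exact: IHy (gsub_opt ob) sx sb.
  - exact: IHx (gsub_opt oa) _ sa sb.
(* Two options of x * y whose first components lie on the same side of x. *)
have core u v t a a' b b' : surreal u -> surreal v -> mul_mono a a' v ->
    mul_mono a' a v -> mul_mono b b' u ->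
    mul_mono b' b u -> (gq a = gq a' -> gD a a' b v = 0) ->
    Op t u a -> Op t u a' -> Op t v b -> Op (~~ t) v b' ->
    gpos (gD a u b v - gD a' u b' v).
  move=> su sv M1 M2 M3 M4 M0 oa oa' ob ob'.
  have sa := surreal_opt su oa; have sa' := surreal_opt su oa'.
  have pb : gpos (gsg t (gq b' - gq b)).
    have := gpos_opt sv ob; have := gpos_opt sv ob'.
    case: t {oa oa'} ob ob' => ob ob' /= p1 p2.
      have -> : gq b' - gq b = - (gq v - gq b') + (gq v - gq b) by abel.
      by apply: gposD => //; apply: gposW.
    have -> : - (gq b' - gq b) = (gq v - gq b') + - (gq v - gq b) by abel.
    by apply: gposD => //; apply: gposW.
  have Pb c : Op t u c -> gpos (gD c u b b').
    move=> oc; case: t {oa oa' ob ob'} pb oc => pb oc.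
      by have [_ H] := M3; have := H pb true _ oc; rewrite gDC.
    have [_ H] := M4; rewrite /gsg opprB in pb.
    have := H pb false _ oc; rewrite gDC /gsg.
    by have -> : - gD c u b' b = gD c u b b' by rewrite /gD; abel.
  have E1 : gD a u b v - gD a' u b' v = gD a' u b b' + gD a a' b v.
    by rewrite /gD; abel.
  have E2 : gD a u b v - gD a' u b' v = gD a u b b' - gD a' a b' v.
    by rewrite /gD; abel.
  have [p|p|p] := gpos_total sa sa'.
  - case: t oa oa' ob ob' pb Pb => oa oa' ob ob' pb Pb.
      rewrite E1; apply: gposD; first exact: Pb.
      by apply: gposW; have [_ H] := M1; apply: (H p _ _ ob).
    rewrite E2; apply: gposD; first exact: Pb.
    have [_ H] := M1; have /gposW := H p _ _ ob'; rewrite /gsg /=.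
    by have -> // : gD a a' b' v = - gD a' a b' v by rewrite /gD; abel.
  - rewrite E1 M0 //; apply: gposD; [exact: Pb|exact: gnn0].
  - case: t oa oa' ob ob' pb Pb => oa oa' ob ob' pb Pb.
      rewrite E2; apply: gposD; first exact: Pb.
      by apply: gposW; have [_ H] := M2; apply: (H p _ _ ob').
    rewrite E1; apply: gposD; first exact: Pb.
    have [_ H] := M2; have /gposW := H p _ _ ob; rewrite /gsg /=.
    by have -> // : - gD a' a b v = gD a a' b v by rewrite /gD; abel.
move=> c d /gmul_opt[t [a [b [oa ob ->]]]] /gmul_opt[t' [a' [b' [oa' ob' ->]]]].
have -> : gq (gmul_term x y a' b') - gq (gmul_term x y a b) =
    gD a x b y - gD a' x b' y by rewrite !gm_term /gD; abel.
have xa := gsub_opt oa; have xa' := gsub_opt oa'.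
have yb := gsub_opt ob; have yb' := gsub_opt ob'.
have sb := surreal_opt sy ob; have sb' := surreal_opt sy ob'.
have [tt|tt] := eqVneq t' t.
  rewrite {}tt in oa' ob'.
  apply: (core _ _ t) => //; do ?[exact: Hx|exact: Hy].
  - move=> E; have [h1 _] := Hx _ _ _ xa xa' sy; have [h2 _] := Hx _ _ _ xa xa' sb.
    by rewrite /gD (h1 E) (h2 E); abel.
have {}tt : t' = ~~ t by case: (t) (t') tt => -[].
rewrite {}tt in oa' ob'; rewrite gDC [gD a' _ _ _]gDC.
apply: (core _ _ t) => //; do ?[exact: Hx|exact: Hy].
- move=> E; have [h1 _] := Hy _ _ yb yb'.
  have [h2 _] : mul_mono b b' a.
    apply: (@mul_monoP (gsub_pos y) (gsub_pos x)) => //.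
    - by move=> s u v; apply: gsub_trans.
    - by move=> s u v; apply: gsub_trans.
    - by move=> u; apply: surreal_sub_pos.
    - move=> u v yu xv; apply/mul_opt_posC/surreal_mul_opt.
      by apply: IHx => //; [exact: surreal_sub_pos xv|exact: surreal_sub_pos yu].
  by rewrite /gD (h1 E) (h2 E); abel.
- by case: (t) ob'.
Qed.

Lemma surreal_mul_mono x1 x2 y : surreal x1 -> surreal x2 -> surreal y ->
  mul_mono x1 x2 y.
Proof.
apply: (@mul_monoP surreal surreal) => //.
- by move=> s u v su; apply: surreal_opt su.
- by move=> s u v su; apply: surreal_opt su.
- by move=> u v su sv; apply/surreal_mul_opt/surreal_mul.
Qed.

Lemma gm_pos x y : surreal x -> surreal y -> gpos (gq x) -> gpos (gq y) ->
  gpos (gm x y).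
Proof.
move=> sx; elim/game_opt_ind: y => y IH sy px py.
have sz : surreal gzero by apply/surrealP; split=> ? ? /gzero_opt.
have /gpos_nle/ngleP[[b ob /gnnB nb]|[b /gzero_opt//]] : gpos (gq y - gq gzero).
  by rewrite gq0 subr0.
have sb := surreal_opt sy ob.
have -> : gm x y = gD gzero x b y + gm x b.
  by rewrite /gD !(gmC gzero) !gm0; abel.
apply: gposD.
  have [_ H] := surreal_mul_mono sz sx sy.
  by apply: (H _ _ _ ob); rewrite gq0 subr0.
rewrite gq0 subr0 in nb; case/gnnE: nb => [b0|pb]; last exact/gposW/(IH _ _ ob).
have [H _] := surreal_mul_mono sb sz sx.
by rewrite gmC H // gmC gm0; exact: gnn0.
Qed.

(** * The field of surreal numbers *)

Lemma surreal_zero : surreal gzero.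
Proof. by apply/surrealP; split=> ? ? /gzero_opt. Qed.

Lemma surreal_one : surreal gone.
Proof.
apply/surrealP; split=> [a b _ /gone_opt[]//|s a /gone_opt[_ ->]].
exact: surreal_zero.
Qed.

Definition is_surreal (g : gameG) : bool := `[< exists2 x, surreal x & gq x = g >].

Lemma is_surreal_zmod : zmod_closed is_surreal.
Proof.
split; first by apply/asboolP; exists gzero => //; exact: surreal_zero.
move=> _ _ /asboolP[x sx <-] /asboolP[y sy <-]; apply/asboolP.
by exists (gsub x y); [apply: surreal_sub|rewrite gqB].
Qed.

HB.instance Definition _ := GRing.isZmodClosed.Build gameG is_surreal is_surreal_zmod.

Record No := MkNo { No_val : gameG; No_valP : is_surreal No_val }.
HB.instance Definition _ := [isSub for No_val].
HB.instance Definition _ := [Choice of No by <:].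
HB.instance Definition _ := [SubChoice_isSubZmodule of No by <:].

Lemma No_inj a b : No_val a = No_val b -> a = b. Proof. exact: val_inj. Qed.
Lemma No_valD a b : No_val (a + b) = No_val a + No_val b. Proof. by []. Qed.
Lemma No_valN a : No_val (- a) = - No_val a. Proof. by []. Qed.

(** Non-surreal games receive the junk value 0, so the laws of [cl] assume surreality. *)
Definition cl (x : game) : No := insubd 0 (gq x).

Lemma val_cl x : surreal x -> No_val (cl x) = gq x.
Proof. by move=> sx; rewrite insubdK //; apply/asboolP; exists x. Qed.

Lemma clP a : exists2 x, surreal x & cl x = a.
Proof.
have /asboolP[x sx E] := No_valP a; exists x => //.
by apply: No_inj; rewrite [LHS]val_cl.
Qed.

Definition No_rep a : game := sval (cid2 (clP a)).
Lemma surreal_rep a : surreal (No_rep a).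
Proof. by rewrite /No_rep; case: cid2. Qed.
Lemma cl_rep a : cl (No_rep a) = a.
Proof. by rewrite /No_rep; case: cid2. Qed.
Lemma gq_rep a : gq (No_rep a) = No_val a.
Proof. by rewrite -(val_cl (surreal_rep a)) cl_rep. Qed.

Lemma cl0 : cl gzero = 0.
Proof. by apply: No_inj; rewrite val_cl //; exact: surreal_zero. Qed.
Lemma clD x y : surreal x -> surreal y -> cl (gadd x y) = cl x + cl y.
Proof.
move=> sx sy; apply: No_inj.
by rewrite No_valD !val_cl ?gqD //; exact: surreal_add.
Qed.
Lemma clN x : surreal x -> cl (gneg x) = - cl x.
Proof.
move=> sx; apply: No_inj.
by rewrite No_valN !val_cl ?gqN //; exact: surreal_neg.
Qed.
Lemma clB x y : surreal x -> surreal y -> cl (gsub x y) = cl x - cl y.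
Proof. by move=> sx sy; rewrite clD ?clN //; exact: surreal_neg. Qed.

Lemma cl_eq x y : surreal x -> surreal y -> cl x = cl y <-> geqv x y.
Proof.
move=> sx sy; rewrite -gqP; split=> [E|E]; first by rewrite -!val_cl // E.
by apply: No_inj; rewrite !val_cl.
Qed.

Lemma cl_eqI x y : surreal x -> surreal y -> gq x = gq y -> cl x = cl y.
Proof. by move=> sx sy /gqP; exact: (cl_eq sx sy).2. Qed.

Definition No_mul a b := cl (gmul (No_rep a) (No_rep b)).

Lemma gm_congr x x' y y' : surreal x -> surreal x' -> surreal y -> surreal y' ->
  gq x = gq x' -> gq y = gq y' -> gm x y = gm x' y'.
Proof.
move=> sx sx' sy sy' E1 E2; have [-> //] := surreal_mul_mono sx sx' sy.
by rewrite gmC (gmC x'); have [-> //] := surreal_mul_mono sy sy' sx'.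
Qed.

Lemma No_mulE x y : surreal x -> surreal y -> cl (gmul x y) = No_mul (cl x) (cl y).
Proof.
move=> sx sy; apply: No_inj; rewrite !val_cl //.
- by apply: gm_congr => //; rewrite ?gq_rep ?val_cl //; exact: surreal_rep.
- by apply: surreal_mul; exact: surreal_rep.
- exact: surreal_mul.
Qed.

Lemma No_mulA : associative No_mul.
Proof.
move=> a b c; rewrite -[a]cl_rep -[b]cl_rep -[c]cl_rep.
have sa := surreal_rep a; have sb := surreal_rep b; have sc := surreal_rep c.
have sab := surreal_mul sa sb; have sbc := surreal_mul sb sc.
rewrite -!No_mulE //; apply: cl_eqI; do ?exact: surreal_mul.
by rewrite [RHS]gmA.
Qed.

Lemma No_mulC : commutative No_mul.
Proof.
move=> a b; rewrite -[a]cl_rep -[b]cl_rep.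
have sa := surreal_rep a; have sb := surreal_rep b.
rewrite -!No_mulE //; apply: cl_eqI; do ?exact: surreal_mul.
exact: gmC.
Qed.

Lemma No_mul1 : left_id (cl gone) No_mul.
Proof.
move=> a; rewrite No_mulC -[a]cl_rep.
have sa := surreal_rep a; have s1 := surreal_one.
rewrite -No_mulE //; apply: cl_eqI => //; first exact: surreal_mul.
exact: gm1.
Qed.

Lemma No_mulD : left_distributive No_mul +%R.
Proof.
move=> a b c; rewrite -[a]cl_rep -[b]cl_rep -[c]cl_rep.
have sa := surreal_rep a; have sb := surreal_rep b; have sc := surreal_rep c.
have sac := surreal_mul sa sc; have sbc := surreal_mul sb sc.
have sab := surreal_add sa sb.
rewrite -clD // -!No_mulE // -clD //; apply: cl_eqI.
- exact: surreal_mul.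
- exact: surreal_add.
- by rewrite gqD; exact: gmD.
Qed.

Lemma No_one_neq0 : cl gone != 0.
Proof.
apply/eqP; rewrite -cl0 => /cl_eq[||h _]; [exact: surreal_one|exact: surreal_zero|].
by have /opt_ngle : Op true gone gzero by apply/gone_opt.
Qed.

HB.instance Definition _ := GRing.Zmodule_isComNzRing.Build No
  No_mulA No_mulC No_mul1 No_mulD No_one_neq0.

Lemma cl1 : cl gone = 1. Proof. by []. Qed.
Lemma clM x y : surreal x -> surreal y -> cl (gmul x y) = cl x * cl y.
Proof. exact: No_mulE. Qed.

Lemma cl_mul_term x y a b : surreal x -> surreal y -> surreal a -> surreal b ->
  cl (gmul_term x y a b) = cl a * cl y + cl x * cl b - cl a * cl b.
Proof.
move=> sx sy sa sb; have s1 := surreal_mul sa sy; have s2 := surreal_mul sx sb.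
have s3 := surreal_mul sa sb; have s4 := surreal_add s1 s2.
by rewrite clB // clD // !clM.
Qed.

Definition No_le (a b : No) : bool := `[< gnn (No_val (b - a)) >].
Definition No_lt (a b : No) : bool := (b != a) && No_le a b.

Lemma No_le_cl x y : surreal x -> surreal y -> No_le (cl x) (cl y) <-> gle x y.
Proof. by move=> sx sy; rewrite asboolE /= !val_cl // gnnB. Qed.

Lemma No_lt_cl x y : surreal x -> surreal y -> No_lt (cl x) (cl y) <-> ~ gle y x.
Proof.
move=> sx sy; split.
  by case/andP=> /eqP ne /No_le_cl => /(_ sx sy) xy yx; apply: ne; apply/cl_eq.
move=> nyx; apply/andP; split; last by apply/No_le_cl => //; exact: surreal_total nyx.
by apply/eqP => /cl_eq[] // yx; exfalso; exact: nyx.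
Qed.

Lemma No_le0D a b : No_le 0 a -> No_le 0 b -> No_le 0 (a + b).
Proof. by move=> /asboolP/= h1 /asboolP/= h2; apply/asboolP; move: h1 h2; rewrite !subr0 /=; exact: gnnD. Qed.

Lemma No_le_refl a : No_le a a.
Proof. by apply/asboolP; rewrite subrr; exact: gnn0. Qed.

Lemma No_le0_anti a : No_le 0 a -> No_le a 0 -> a = 0.
Proof.
move=> /asboolP h1 /asboolP h2; apply: No_inj; apply: gnn_anti.
  by move: h1; rewrite subr0.
by move: h2; rewrite sub0r.
Qed.

Lemma No_sub_ge0 a b : No_le 0 (b - a) = No_le a b.
Proof. by rewrite /No_le subr0. Qed.

Lemma No_le_total a b : No_le a b || No_le b a.
Proof.
rewrite -[a]cl_rep -[b]cl_rep; apply/orP.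
have sa := surreal_rep a; have sb := surreal_rep b.
have [h|h] := pselect (gle (No_rep a) (No_rep b)); [left|right]; apply/No_le_cl => //.
exact: surreal_total h.
Qed.

Lemma No_lt0M a b : No_lt 0 a -> No_lt 0 b -> No_lt 0 (a * b).
Proof.
have P x : surreal x -> No_lt 0 (cl x) <-> gpos (gq x).
  move=> sx; rewrite -cl0 (No_lt_cl surreal_zero sx).
  rewrite -[gq x]subr0 -gq0 gposB; split=> [h|[]//]; split=> //.
  exact: surreal_total sx surreal_zero h.
rewrite -[a]cl_rep -[b]cl_rep -clM; do ?exact: surreal_rep.
move/P=> h1 /P h2; apply/P; first by apply: surreal_mul; exact: surreal_rep.
by apply: gm_pos; do ?exact: surreal_rep; [apply: h1|apply: h2]; exact: surreal_rep.
Qed.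

Lemma No_le_eqVlt a b : No_le a b -> a = b \/ No_lt a b.
Proof. by move=> h; have [->|ne] := eqVneq a b; [left|right; rewrite /No_lt eq_sym ne]. Qed.

Lemma No_le0M a b : No_le 0 a -> No_le 0 b -> No_le 0 (a * b).
Proof.
move=> /No_le_eqVlt[<-|h1]; first by rewrite mul0r No_le_refl.
move=> /No_le_eqVlt[<-|h2]; first by rewrite mulr0 No_le_refl.
by case/andP: (No_lt0M h1 h2).
Qed.

(** * Simplicity, cuts over small families, and inverses *)

Lemma No_simplest x y : surreal x -> surreal y ->
  (forall b, Op true x b -> No_lt (cl b) (cl y)) ->
  (forall b, Op false x b -> No_lt (cl y) (cl b)) ->
  (forall b, Op true y b -> No_lt (cl b) (cl x)) ->
  (forall b, Op false y b -> No_lt (cl x) (cl b)) -> cl x = cl y.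
Proof.
move=> sx sy h1 h2 h3 h4; apply/cl_eq => //.
have L u v : surreal u -> surreal v -> No_lt (cl u) (cl v) -> ~ gle v u.
  by move=> su sv /No_lt_cl; apply.
split; apply/gleP; split=> b ob.
- by apply: L (h1 _ ob) => //; apply: surreal_opt ob.
- by apply: L (h4 _ ob) => //; apply: surreal_opt ob.
- by apply: L (h3 _ ob) => //; apply: surreal_opt ob.
- by apply: L (h2 _ ob) => //; apply: surreal_opt ob.
Qed.

(* Expressions over generators [X], with an extra unary operation. They index *)
(* small sets of surreals that are closed under the operations.               *)
Inductive rterm (X : Type) :=
| TVar of X | TOne | TAdd of rterm X & rterm X | TOpp of rterm X
| TMul of rterm X & rterm X | TFun of rterm X.
Arguments TOne {X}.

Fixpoint reval (X : Type) (f : game -> game) (v : X -> game) (t : rterm X) : game :=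
  match t with
  | TVar x => v x
  | TOne => gone
  | TAdd a b => gadd (reval f v a) (reval f v b)
  | TOpp a => gneg (reval f v a)
  | TMul a b => gmul (reval f v a) (reval f v b)
  | TFun a => f (reval f v a)
  end.

Lemma surreal_reval X (f : game -> game) (v : X -> game) t :
  (forall x, surreal x -> surreal (f x)) -> (forall x, surreal (v x)) ->
  surreal (reval f v t).
Proof.
move=> hf hv; elim: t => [x||a ha b hb|a ha|a ha b hb|a ha].
- exact: hv.
- exact: surreal_one.
- exact: surreal_add.
- exact: surreal_neg.
- exact: surreal_mul.
- exact: hf.
Qed.

(** Options must be indexed by a small type, so a cut cannot range over all of [No]; it selects from
    a family [v] indexed by [X]. *)
Definition gcut (X : Type) (v : X -> game) (P Q : X -> Prop) : game :=
  Game (fun t : {t : X | P t} => v (sval t)) (fun t : {t : X | Q t} => v (sval t)).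

Lemma gcut_opt s X (v : X -> game) (P Q : X -> Prop) a : Op s (gcut v P Q) a <->
  exists2 t, (if s then P else Q) t & a = v t.
Proof.
case: s; split=> [[[t ht] ->]|[t ht ->]]; do ?by exists t.
  by exists (exist _ t ht).
by exists (exist _ t ht).
Qed.

Lemma surreal_gcut X (v : X -> game) (P Q : X -> Prop) :
  (forall t, P t \/ Q t -> surreal (v t)) ->
  (forall s t, P s -> Q t -> No_lt (cl (v s)) (cl (v t))) -> surreal (gcut v P Q).
Proof.
move=> hv hPQ; apply/surrealP; split=> [a b|[] a] /gcut_opt[t ht ->].
- by move=> /gcut_opt[u hu ->]; apply/No_lt_cl; [apply: hv; left|apply: hv; right|exact: hPQ].
- by apply: hv; left.
- by apply: hv; right.
Qed.

Lemma No_opt s x a : surreal x -> Op s x a ->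
  if s then No_lt (cl a) (cl x) else No_lt (cl x) (cl a).
Proof.
move=> sx oa; have sa := surreal_opt sx oa.
by have := opt_ngle oa; case: s oa => oa h; apply/No_lt_cl.
Qed.

Lemma No_sub_gt0 a b : No_lt 0 (b - a) = No_lt a b.
Proof. by rewrite /No_lt No_sub_ge0 subr_eq0. Qed.

Lemma No_lt_total a b : [\/ No_lt a b, a = b | No_lt b a].
Proof.
have [->|ne] := eqVneq a b; first exact: Or32.
have /orP[h|h] := No_le_total a b; [apply: Or31|apply: Or33];
  by rewrite /No_lt h andbT // eq_sym.
Qed.

Lemma No_lt_asym a b : No_lt a b -> No_lt b a -> False.
Proof.
rewrite -No_sub_gt0 -[No_lt b a]No_sub_gt0 => /andP[_ h2] /andP[/eqP h1 h3].
by apply: h1; apply: No_le0_anti => //; rewrite -No_sub_ge0 sub0r opprB.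
Qed.

(* Inverses: cut the ring generated by [x] and the inverses of its positive   *)
(* options at 1/x. If s is in this ring and x' is an option of x, then so is  *)
(* s + (1 - x s)/x', which lies beyond 1/x on the side prescribed by the      *)
(* option of x * y given by x' and s.                                         *)
Lemma No_inv_exists (a : No) : No_lt 0 a -> exists b, a * b = 1.
Proof.
have [x sx <-] := clP a; elim/game_opt_ind: x sx => x IH sx x0.
(* [None] stands for x itself, so that x belongs to the generated ring. *)
pose X := (option (lindex x + rindex x))%type.
pose o (k : X) : game :=
  match k with Some (inl i) => @lopt x i | Some (inr j) => @ropt x j | None => x end.
have so k : surreal (o k).
  case: k => [[i|j]|] //=; [apply: (@surreal_opt true _ _ sx)|
    apply: (@surreal_opt false _ _ sx)]; by [exists i|exists j].
(* Only positive options receive an inverse; elsewhere [gzero] is a placeholder. *)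
have inv k : exists2 z, surreal z &
    (k <> None -> No_lt 0 (cl (o k)) -> cl (o k) * cl z = 1).
  case: k => [k|]; last by exists gzero => //; exact: surreal_zero.
  have [p|n] := pselect (No_lt 0 (cl (o (Some k)))); last first.
    by exists gzero => //; exact: surreal_zero.
  have [b hb] : exists b, cl (o (Some k)) * b = 1.
    case: k p => [i|j] p; [apply: (IH true)|apply: (IH false)] => //=;
      do ?[by exists i|by exists j|exact: (so (Some (inl i)))|exact: (so (Some (inr j)))].
  by exists (No_rep b); [exact: surreal_rep|rewrite cl_rep].
pose w k := if k is Some _ then s2val (cid2 (inv k)) else x.
have sw k : surreal (w k) by case: k => [k|] //=; case: cid2.
have wP k : No_lt 0 (cl (o (Some k))) -> cl (o (Some k)) * cl (w (Some k)) = 1.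
  by rewrite /w; case: cid2 => z /= _ h p; exact: h.
pose v := reval id w.
have sv t : surreal (v t) by apply: surreal_reval.
pose y := gcut v (fun t => No_lt (cl x * cl (v t)) 1) (fun t => No_lt 1 (cl x * cl (v t))).
have posM c d : No_lt c d <-> No_lt (cl x * c) (cl x * d).
  split=> [h|].
    by rewrite -No_sub_gt0 -mulrBr; apply: No_lt0M => //; rewrite No_sub_gt0.
  have [//|->|h1 h2] := No_lt_total c d; first by rewrite /No_lt eqxx.
  exfalso; apply: No_lt_asym h2 _.
  by rewrite -No_sub_gt0 -mulrBr; apply: No_lt0M => //; rewrite No_sub_gt0.
have ltT c d e : No_lt c d -> No_lt d e -> No_lt c e.
  rewrite -No_sub_gt0 -[No_lt d e]No_sub_gt0 -[No_lt c e]No_sub_gt0 => h1 h2.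
  have -> : e - c = (d - c) + (e - d) by ring.
  case/andP: h1 => n1 h1; case/andP: h2 => n2 h2; rewrite /No_lt No_le0D // andbT.
  apply: contra n1 => /eqP E; apply/eqP/No_le0_anti => //.
  by rewrite -No_sub_ge0 sub0r; have -> : - (d - c) = e - d by apply: (addrI (d - c)); rewrite E subrr.
have sy : surreal y.
  apply: surreal_gcut => // s t h1 h2; apply/posM; exact: ltT h1 h2.
exists (cl y); rewrite -clM //.
have y0 : No_lt 0 (cl y).
  have v0 : cl (v (TAdd TOne (TOpp TOne))) = 0.
    by rewrite [LHS](clB surreal_one surreal_one) subrr.
  rewrite -v0; apply: (@No_opt true) => //; apply/gcut_opt.
  exists (TAdd TOne (TOpp TOne)) => //; rewrite v0 mulr0.
  rewrite -cl0; apply/No_lt_cl; [exact: surreal_zero|exact: surreal_one|].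
  by apply: (@opt_ngle true); apply/gone_opt.
pose psg (u : bool) g := No_lt 0 (if u then g else - g).
have psgB u c d : (if u then No_lt c d else No_lt d c) <-> psg u (d - c).
  by rewrite /psg; case: u; rewrite ?opprB No_sub_gt0.
have psgM u1 u2 c d : psg u1 c -> psg u2 d -> psg (u1 == u2) (c * d).
  rewrite /psg => h1 h2; have := No_lt0M h1 h2.
  by case: (u1) (u2) => -[]; rewrite ?mulrN ?mulNr ?opprK.
have psgD u c d : psg u c -> psg u d -> psg u (c + d).
  move=> h1 h2; apply: (ltT _ (if u then c else - c)) => //.
  rewrite -No_sub_gt0; have -> // : (if u then c + d else - (c + d)) -
    (if u then c else - c) = if u then d else - d by case: (u); ring.
have key s t x' b : Op s x x' -> Op t y b ->
    if s == t then No_lt (cl (gmul_term x y x' b)) 1 else No_lt 1 (cl (gmul_term x y x' b)).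
  move=> ox ob; have [T hT Eb] := (gcut_opt t v _ _ b).1 ob.
  have sx' := surreal_opt sx ox; have sb := surreal_opt sy ob.
  have /psgB lx := No_opt sx ox; have /psgB lb := No_opt sy ob.
  have {hT} ld : psg t (1 - cl x * cl b) by rewrite Eb; apply/psgB; case: (t) hT.
  rewrite cl_mul_term //; apply/psgB.
  set d := 1 - _ in ld; set g := cl y - cl b in lb.
  have -> : 1 - (cl x' * cl y + cl x * cl b - cl x' * cl b) = d - cl x' * g.
    by rewrite /d /g; ring.
  (* As x > 0, a right option is positive, so a nonpositive option is a left one. *)
  have sT : No_le (cl x') 0 -> s = true.
    move=> h; case: (s) lx => //; rewrite /psg => h1; exfalso.
    have {}h : No_le 0 (- cl x') by rewrite -sub0r No_sub_ge0.
    case/andP: (x0) => /eqP n0 p0; case/andP: h1 => _ h1.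
    apply: n0; apply: No_le0_anti => //; rewrite -No_sub_ge0 sub0r.
    have -> : - cl x = - (cl x - cl x') + (- cl x') by ring.
    exact: No_le0D.
  have [p|E|p] := No_lt_total 0 (cl x').
  - have [k Ek] : exists k, x' = o (Some k).
      by case: (s) ox => -[i ->]; [exists (inl i)|exists (inr i)].
    pose T' := TAdd T (TMul (TAdd TOne (TOpp (TMul (TVar None) T))) (TVar (Some k))).
    set i := cl (w (Some k)); have xi : cl x' * i = 1 by rewrite Ek wP -?Ek.
    have ET : cl (v T') = cl b + d * i.
      have s1 := surreal_one; have sxT : surreal (gmul x (v T)) by exact: surreal_mul.
      have s1x : surreal (gsub gone (gmul x (v T))) by exact: surreal_sub.
      have sk := sw (Some k); have sm := surreal_mul s1x sk.
      rewrite [LHS](clD (sv T) sm) (clM s1x sk) (clB s1 sxT) (clM sx (sv T)).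
      by rewrite /d -Eb.
    have i0 : psg true i.
      rewrite /psg; have [//|E|n] := No_lt_total 0 i.
        by move: xi; rewrite -E mulr0 => /esym/eqP; rewrite oner_eq0.
      exfalso; have n' : psg true (- i) by rewrite /psg -sub0r No_sub_gt0.
      have := No_lt0M p n'; rewrite mulrN xi => h.
      have l01 : No_lt 0 1.
        rewrite -cl0; apply/No_lt_cl; [exact: surreal_zero|exact: surreal_one|].
        by apply: (@opt_ngle true); apply/gone_opt.
      by apply: No_lt_asym l01 _; rewrite -No_sub_gt0 sub0r.
    have lT : psg (s == t) (cl x * cl (v T') - 1).
      have -> : cl x * cl (v T') - 1 = (d * i) * (cl x - cl x') + d * (cl x' * i - 1).
        by rewrite ET /d; ring.
      rewrite xi subrr mulr0 addr0.
      have := psgM _ _ _ _ (psgM _ _ _ _ ld i0) lx.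
      by case: (s) (t) => -[].
    have lY : psg (s == t) (cl (v T') - cl y).
      apply/psgB; case: (s == t) lT => /psgB lT.
        by apply: (@No_opt false) => //; apply/gcut_opt; exists T'.
      by apply: (@No_opt true) => //; apply/gcut_opt; exists T'.
    have -> : d - cl x' * g = (cl (v T') - cl y) * cl x' - d * (cl x' * i - 1).
      by rewrite ET /g; ring.
    rewrite xi subrr mulr0 subr0.
    have := psgM _ true _ _ lY (_ : psg true (cl x')); rewrite /psg => /(_ p).
    by case: (s == t).
  - by rewrite -E mul0r subr0 sT ?E; [case: (t) ld|exact: No_le_refl].
  - rewrite sT; last by case/andP: p.
    have -> : (true == t) = t by case: (t).
    apply: psgD => //; rewrite -mulNr.
    have p' : psg true (- cl x') by rewrite /psg -sub0r No_sub_gt0.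
    by have := psgM _ _ _ _ p' lb; case: (t).
apply: (@No_simplest (gmul x y) gone).
- exact: surreal_mul.
- exact: surreal_one.
- move=> c /gmul_opt[t [x' [b [ox ob ->]]]].
  by have := key _ _ _ _ ox ob; case: (t).
- move=> c /gmul_opt[t [x' [b [ox ob ->]]]].
  by have := key _ _ _ _ ox ob; case: (t).
- by move=> b /gone_opt[_ ->]; rewrite cl0 clM //; exact: No_lt0M.
- by move=> b /gone_opt[].
Qed.

Lemma No_inverse (a : No) : exists b, (a != 0 -> b * a = 1) /\ (a = 0 -> b = 0).
Proof.
have [h|<-|h] := No_lt_total 0 a.
- have [b hb] := No_inv_exists h; exists b; rewrite mulrC; split=> // a0.
  by move: h; rewrite a0 /No_lt eqxx.
- by exists 0; rewrite eqxx.
- have [|b hb] := @No_inv_exists (- a); first by rewrite -sub0r No_sub_gt0.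
  exists (- b); rewrite mulNr mulrC -mulNr; split=> // a0.
  by move: h; rewrite a0 /No_lt eqxx.
Qed.

Definition No_inv a := sval (cid (No_inverse a)).
Lemma No_mulV a : a != 0 -> No_inv a * a = 1.
Proof. by rewrite /No_inv; case: cid => b []. Qed.
Lemma No_inv0 : No_inv 0 = 0.
Proof. by rewrite /No_inv; case: cid => b [] _ /= ->. Qed.

HB.instance Definition _ := GRing.ComNzRing_isField.Build No No_mulV No_inv0.

Definition No_norm a : No := if No_le 0 a then a else - a.
Lemma No_normN a : No_norm (- a) = No_norm a.
Proof.
rewrite /No_norm -(sub0r a) No_sub_ge0 sub0r opprK.
case: ifP => h1; case: ifP => h2 //; first by rewrite (No_le0_anti h2 h1) oppr0.
by have := No_le_total 0 a; rewrite h1 h2.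
Qed.
Lemma No_ge0_norm a : No_le 0 a -> No_norm a = a.
Proof. by rewrite /No_norm => ->. Qed.
Lemma No_lt_def a b : No_lt a b = (b != a) && No_le a b. Proof. by []. Qed.

HB.instance Definition _ := Num.IntegralDomain_isLeReal.Build No
  No_le0D No_le0M No_le0_anti No_sub_ge0 (No_le_total 0) No_normN No_ge0_norm No_lt_def.

Lemma cl_le x y : surreal x -> surreal y -> (cl x <= cl y) <-> gle x y.
Proof. exact: No_le_cl. Qed.
Lemma cl_lt x y : surreal x -> surreal y -> (cl x < cl y) <-> ~ gle y x.
Proof. exact: No_lt_cl. Qed.
Lemma cl_opt s x a : surreal x -> Op s x a ->
  if s then cl a < cl x else cl x < cl a.
Proof. exact: No_opt. Qed.
(** Conway's simplicity principle. It is the way equalities of cuts are proved below: inverses, exp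
    0 = 1, exp (x + y), square roots and logarithms. *)
Lemma cl_simplest x y : surreal x -> surreal y ->
  (forall b, Op true x b -> cl b < cl y) -> (forall b, Op false x b -> cl y < cl b) ->
  (forall b, Op true y b -> cl b < cl x) -> (forall b, Op false y b -> cl x < cl b) ->
  cl x = cl y.
Proof. exact: No_simplest. Qed.

(** * Taylor polynomials of the exponential *)

Lemma eq_ler (K : numDomainType) (x y : K) : x = y -> x <= y.
Proof. by move=> ->. Qed.

Section Taylor.
Variable K : realFieldType.
Implicit Types (p q a b t : K) (n m k r s : nat).

Definition tay p n : K := \sum_(i < n.+1) p ^+ i / (i`!)%:R.

Lemma fact_gt0R n : 0 < (n`!)%:R :> K. Proof. by rewrite ltr0n fact_gt0. Qed.

Lemma tayS p n : tay p n.+1 = tay p n + p ^+ n.+1 / (n.+1`!)%:R.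
Proof. by rewrite /tay big_ord_recr. Qed.

Lemma tay_0n p : tay p 0 = 1.
Proof. by rewrite /tay big_ord1 expr0 fact0 divr1. Qed.

Lemma tay_1n p : tay p 1 = 1 + p.
Proof. by rewrite tayS tay_0n expr1 divr1. Qed.

Lemma tay0 n : tay 0 n = 1.
Proof. by elim: n => [|n IH]; rewrite ?tay_0n // tayS IH expr0n mul0r addr0. Qed.

Lemma tay_term_ge0 p n : 0 <= p -> 0 <= p ^+ n / (n`!)%:R.
Proof. by move=> p0; rewrite divr_ge0 ?exprn_ge0 // ltW // fact_gt0R. Qed.

Lemma tay_mono_n p n m : 0 <= p -> (n <= m)%N -> tay p n <= tay p m.
Proof.
move=> p0 /subnKC <-; elim: (m - n)%N => [|d IH]; first by rewrite addn0.
by rewrite addnS tayS; apply: le_trans IH _; rewrite lerDl tay_term_ge0.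
Qed.

Lemma tay_ge1 p n : 0 <= p -> 1 <= tay p n.
Proof. by move=> p0; rewrite -(tay_0n p); exact: tay_mono_n. Qed.

Lemma tay_mono_p p q n : 0 <= p -> p <= q -> tay p n <= tay q n.
Proof.
move=> p0 pq; apply: ler_sum => i _; rewrite ler_pM2r ?invr_gt0 ?fact_gt0R //.
by apply: lerXn2r => //; rewrite nnegrE // (le_trans p0).
Qed.

Lemma tay_strict p n m : 0 < p -> (n < m)%N -> tay p n < tay p m.
Proof.
move=> p0 nm; apply: lt_le_trans (tay_mono_n (ltW p0) nm).
by rewrite tayS ltrDl divr_gt0 ?fact_gt0R ?exprn_gt0.
Qed.

Let F p q i j : K := p ^+ i / (i`!)%:R * (q ^+ j / (j`!)%:R).

(** The binomial theorem. With [tay_mulE] it writes the truncation at p + q and the product of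
    truncations as sums of the same terms, over a triangle and over a rectangle of exponent pairs,
    so that they compare termwise. *)
Lemma tay_addE p q n N : (n < N)%N ->
  tay (p + q) n = \sum_(ij : 'I_N * 'I_N | (ij.1 + ij.2 <= n)%N) F p q ij.1 ij.2.
Proof.
move=> nN; pose f (ij : 'I_N * 'I_N) := F p q ij.1 ij.2.
rewrite (eq_bigr (fun ij : 'I_N * 'I_N =>
   \sum_(l < n.+1 | l == (ij.1 + ij.2)%N :> nat) f ij)); last first.
  move=> [i j] /= ij; have ij' : (i + j < n.+1)%N by rewrite ltnS.
  by rewrite (big_pred1 (Ordinal ij')) // => l; rewrite -val_eqE.
rewrite big_mkcond /=.
rewrite (eq_bigr (fun ij : 'I_N * 'I_N =>
   \sum_(l < n.+1 | l == (ij.1 + ij.2)%N :> nat) f ij)); last first.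
  move=> [i j] _ /=; case: ifPn => // ij; rewrite big_pred0 // => l.
  by apply: contraNF ij => /eqP <-; rewrite -ltnS.
rewrite (exchange_big_dep predT) //=; apply: eq_bigr => l _.
rewrite addrC exprDn mulr_suml.
rewrite -(pair_big_dep predT (fun i j : 'I_N => l == (i + j)%N :> nat)
  (fun i j : 'I_N => F p q i j)) /=.
have lN : (l < N)%N by apply: leq_trans nN; exact: ltn_ord.
rewrite (big_ord_widen N (fun i => (q ^+ (l - i) * p ^+ i) *+ 'C(l, i) / (l`!)%:R)) //.
rewrite big_mkcond /=; apply: eq_bigr => i _; rewrite ltnS.
case: ifPn => il; last first.
  rewrite big_pred0 // => j; apply: contraNF il => /eqP ->; exact: leq_addr.
have jN : (l - i < N)%N by apply: leq_ltn_trans (leq_subr _ _) lN.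
rewrite (big_pred1 (Ordinal jN)) /=; last first.
  move=> j; apply/eqP/eqP => [h|-> /=]; last by rewrite subnKC.
  by apply: val_inj; rewrite /= h addKn.
rewrite /F -mulr_natr; have := bin_fact il; move/(congr1 (fun n => n%:R : K)).
rewrite !natrM => E; rewrite -E.
have h1 := lt0r_neq0 (fact_gt0R i); have h2 := lt0r_neq0 (fact_gt0R (l - i)).
have h3 : 'C(l, i)%:R != 0 :> K by rewrite pnatr_eq0 -lt0n bin_gt0.
by field; rewrite h1 h2 h3.
Qed.

Lemma tay_mulE p q n m N : (n < N)%N -> (m < N)%N -> tay p n * tay q m =
  \sum_(ij : 'I_N * 'I_N | (ij.1 <= n)%N && (ij.2 <= m)%N) F p q ij.1 ij.2.
Proof.
move=> nN mN.
rewrite -(pair_big (fun i : 'I_N => i <= n)%N (fun j : 'I_N => j <= m)%N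
  (fun i j => F p q i j)) /=.
rewrite /tay mulr_suml (big_ord_widen N (fun i => p ^+ i / (i`!)%:R * _)) //.
apply: eq_bigr => i _; rewrite mulr_sumr.
by rewrite (big_ord_widen N (fun j => p ^+ i / (i`!)%:R * (q ^+ j / (j`!)%:R))).
Qed.

Lemma F_ge0 p q i j : 0 <= p -> 0 <= q -> 0 <= F p q i j.
Proof. by move=> p0 q0; rewrite mulr_ge0 ?tay_term_ge0. Qed.

Lemma sum_subpred (I : finType) (P Q : pred I) (f : I -> K) :
  (forall i, 0 <= f i) -> subpred P Q -> \sum_(i | P i) f i <= \sum_(i | Q i) f i.
Proof.
move=> f0 PQ; rewrite big_mkcond [leRHS]big_mkcond; apply: ler_sum => i _.
by case: ifPn => [/PQ -> //|_]; case: ifP.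
Qed.

Lemma tayD_le a b n : 0 <= a -> 0 <= b -> tay (a + b) n <= tay a n * tay b n.
Proof.
move=> a0 b0; rewrite (tay_addE _ _ (ltnSn n)) (tay_mulE _ _ (ltnSn n) (ltnSn n)).
apply: sum_subpred => [ij|[i j] /= h]; first exact: F_ge0.
by rewrite (leq_trans (leq_addr _ _) h) (leq_trans (leq_addl _ _) h).
Qed.

Lemma tayM_le a b n m : 0 <= a -> 0 <= b ->
  tay a n * tay b m <= tay (a + b) (n + m).
Proof.
move=> a0 b0; rewrite (tay_addE _ _ (ltnSn (n + m))).
rewrite (@tay_mulE a b n m (n + m).+1) ?ltnS ?leq_addr ?leq_addl //.
apply: sum_subpred => [ij|[i j] /= /andP[h1 h2]]; [exact: F_ge0|exact: leq_add].
Qed.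

Definition tail t n := tay t n.*2 - tay t n.

(** The two sides differ by the pairs with i, j <= n < i + j, whose total degree is at most 2n. *)
Lemma tayM_approx p q n :
  `|tay p n * tay q n - tay (p + q) n| <= tail (`|p| + `|q|) n.
Proof.
have n1 : (n < n.*2.+1)%N by rewrite ltnS -addnn leq_addr.
rewrite /tail (tay_addE p q n1) (tay_mulE p q n1 n1).
rewrite (tay_addE _ _ (ltnSn n.*2)) (tay_addE _ _ n1).
rewrite big_mkcond [X in _ - X]big_mkcond -sumrB.
rewrite [X in _ <= X - _]big_mkcond [X in _ <= _ - X]big_mkcond -sumrB.
apply: le_trans (ler_norm_sum _ _ _) _; apply: ler_sum => -[i j] _ /=.
have F0 : 0 <= F `|p| `|q| i j by exact: F_ge0.
have EF : `|F p q i j| = F `|p| `|q| i j.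
  by rewrite /F !normrM !normfV !normrX !normr_nat.
have [h1|h1] := leqP (i + j) n.
  rewrite (leq_trans (leq_addr _ _) h1) (leq_trans (leq_addl _ _) h1) /=.
  have -> : (i + j <= n.*2)%N by rewrite (leq_trans h1) // -[X in (_ <= X)%N]addnn leq_addr.
  by rewrite !subrr normr0.
rewrite !subr0; case: ifPn => [/andP[h2 h3]|_].
  have -> : (i + j <= n.*2)%N by rewrite -[X in (_ <= X)%N]addnn leq_add.
  by rewrite EF.
by rewrite normr0; case: ifP.
Qed.

Definition tod p r := tay p r.*2.+1.

Lemma todS p r : tod p r.+1 =
  tod p r + p ^+ r.+1.*2 / (r.+1.*2`!)%:R * (1 + p / r.+1.*2.+1%:R).
Proof.
rewrite /tod doubleS 2!tayS -addrA; congr (_ + _).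
rewrite [(r.*2.+3)`!]factS natrM [p ^+ r.*2.+3]exprS.
have h1 := lt0r_neq0 (fact_gt0R r.*2.+2).
have h2 : r.*2.+3%:R != 0 :> K by rewrite pnatr_eq0.
set P := p ^+ _.+2; set A := (_.+2)`!%:R in h1 *; set B := _.+3%:R in h2 *.
move: P A B h1 h2 => P A B h1 h2; by field; rewrite h1 h2.
Qed.

Lemma even_expr_ge0 p r : 0 <= p ^+ r.*2.
Proof. by rewrite -muln2 exprM sqr_ge0. Qed.

(** For p <= -(2r+1), the terms of degrees 2i and 2i+1 with i <= r have nonpositive sum. Positivity
    of an odd truncation thus keeps a negative argument finite. *)
Lemma tod_gt0_bound p r : 0 < tod p r -> - (r.*2.+1)%:R < p.
Proof.
rewrite !ltNge; apply: contra; elim: r => [|r IH] hp.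
  have {}hp : p <= -1 := hp.
  by rewrite [tod p 0]tay_1n; lra.
have h : p <= - (r.*2.+1)%:R.
  by apply: le_trans hp _; rewrite lerN2 ler_nat; lia.
rewrite todS; have {}IH := IH h.
have h1 : 1 + p / r.+1.*2.+1%:R <= 0.
  suff h0 : p / r.+1.*2.+1%:R <= -1 by set X := _ / _ in h0 *; lra.
  by rewrite ler_pdivrMr ?ltr0n // mulN1r.
have h2 : 0 <= p ^+ r.+1.*2 / (r.+1.*2`!)%:R.
  by rewrite divr_ge0 ?even_expr_ge0 // ltW // fact_gt0R.
by rewrite -[leRHS]addr0; apply: lerD => //; exact: mulr_ge0_le0.
Qed.

Lemma tod_gapS p r : - (r.*2.+1)%:R <= p ->
  tod p r + 2 / (r.+1.*2.+1`!)%:R * p ^+ r.+1.*2 <= tod p r.+1.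
Proof.
move=> hp; rewrite todS lerD2l [(_.+1)`!]factS natrM.
have h1 := fact_gt0R r.+1.*2.
have h3 : 0 < r.+1.*2.+1%:R :> K by rewrite ltr0n.
have -> : 2 / (r.+1.*2.+1%:R * (r.+1.*2)`!%:R) * p ^+ r.+1.*2 =
   p ^+ r.+1.*2 / (r.+1.*2`!)%:R * (2 / r.+1.*2.+1%:R).
  by field; rewrite !gt_eqF.
apply: ler_wpM2l; first by rewrite divr_ge0 ?even_expr_ge0 // ltW.
rewrite ler_pdivrMr // mulrDl mul1r divfK ?gt_eqF //; move: hp.
by rewrite doubleS -!natr1; lra.
Qed.

Lemma tod_mono p r s : - (r.*2.+1)%:R <= p -> (r <= s)%N -> tod p r <= tod p s.
Proof.
move=> hp /subnKC <-; elim: (s - r)%N => [|d IH]; first by rewrite addn0.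
apply: le_trans IH _; rewrite addnS.
have h : - ((r + d).*2.+1)%:R <= p.
  by apply: le_trans hp; rewrite lerN2 ler_nat; lia.
apply: le_trans (tod_gapS h); rewrite lerDl mulr_ge0 ?even_expr_ge0 //.
Qed.

Lemma tod_gap p r s : - (r.*2.+1)%:R <= p -> (r < s)%N ->
  tod p r + 2 / (r.+1.*2.+1`!)%:R * p ^+ r.+1.*2 <= tod p s.
Proof.
move=> hp rs; apply: le_trans (tod_gapS hp) (tod_mono _ rs).
by apply: le_trans hp; rewrite lerN2 ler_nat; lia.
Qed.

Lemma tod_gt0_mono p r s : 0 < tod p r -> (r <= s)%N -> tod p r <= tod p s.
Proof. by move=> /tod_gt0_bound/ltW h; exact: tod_mono. Qed.

Lemma tod_strict p r s : p != 0 -> 0 < tod p r -> (r < s)%N -> tod p r < tod p s.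
Proof.
move=> p0 /tod_gt0_bound/ltW h rs; apply: lt_le_trans (tod_gap h rs).
rewrite ltrDl mulr_gt0 ?divr_gt0 ?fact_gt0R // -muln2 exprM exprn_even_gt0 //.
by rewrite expf_eq0 /= (negbTE p0).
Qed.

Lemma pow_le_fact B l : ((B.*2 ^ l) <= (B.*2 ^ B.*2) * l`!)%N.
Proof.
elim: l => [|l IH]; first by rewrite expn0 fact0 muln1 expn_gt0; case: (B).
have [h|h] := leqP B.*2 l.+1.
  by rewrite expnS factS mulnCA; apply: leq_mul.
apply: (@leq_trans (B.*2 ^ B.*2)); last by rewrite leq_pmulr ?fact_gt0.
by rewrite leq_pexp2l ?(leq_trans _ h) // ltnW.
Qed.

(** Since B^l / l! <= (2B)^(2B) 2^-l, the terms decay geometrically. The factor t^k is kept because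
    [K] may be non-archimedean: for infinitesimal t, a bound by 2^-n alone would be far too
    large. *)
Lemma tail_geom B k n m t : (0 < B)%N -> (k <= n)%N -> (n <= m)%N ->
  0 <= t -> t <= B%:R ->
  tay t m - tay t n <= t ^+ k * (B.*2 ^ B.*2)%:R * (2 ^- n - 2 ^- m).
Proof.
move=> B0 kn /subnKC <- t0 tB; elim: (m - n)%N => [|d IH].
  by rewrite addn0 !subrr mulr0.
rewrite addnS tayS; set l := (n + d)%N in IH *.
set C := (B.*2 ^ B.*2)%N in IH *.
suff h : t ^+ l.+1 / (l.+1`!)%:R <= t ^+ k * C%:R * 2 ^- l.+1.
  have -> : t ^+ k * C%:R * (2 ^- n - 2 ^- l.+1) =
    t ^+ k * C%:R * (2 ^- n - 2 ^- l) + t ^+ k * C%:R * 2 ^- l.+1.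
    by rewrite exprS invfM; field; rewrite !expf_neq0 ?pnatr_eq0.
  by move: IH h; lra.
have kl : (k <= l.+1)%N by rewrite (leq_trans kn) // /l -addnS leq_addr.
have -> : t ^+ l.+1 = t ^+ k * t ^+ (l.+1 - k) by rewrite -exprD subnKC.
rewrite -!mulrA; apply: ler_wpM2l; first exact: exprn_ge0.
have h1 : t ^+ (l.+1 - k) <= B%:R ^+ l.+1.
  apply: (@le_trans _ _ (B%:R ^+ (l.+1 - k))).
    by apply: lerXn2r; rewrite // nnegrE // ler0n.
  by apply: ler_weXn2l; [rewrite ler1n|exact: leq_subr].
apply: (@le_trans _ _ (B%:R ^+ l.+1 / (l.+1`!)%:R)).
  by rewrite ler_pM2r // invr_gt0 fact_gt0R.
rewrite ler_pdivrMr ?fact_gt0R // mulrAC ler_pdivlMr ?exprn_gt0 //.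
by rewrite -exprMn -!natrM -natrX ler_nat muln2 pow_le_fact.
Qed.

Lemma tay_bounded B : exists2 E : nat, (0 < E)%N &
  forall t n, 0 <= t -> t <= B%:R -> tay t n <= E%:R.
Proof.
pose B' := B.+1; exists (1 + B'.*2 ^ B'.*2)%N => // t n t0 tB.
have tB' : t <= B'%:R by rewrite (le_trans tB) // ler_nat.
have := @tail_geom B' 0 0 n t isT isT (leq0n n) t0 tB'.
rewrite tay_0n expr0 mul1r expr0 invr1 natrD.
have : 0 <= (B'.*2 ^ B'.*2)%:R :> K by rewrite ler0n.
have : 0 <= 2 ^- n :> K by rewrite invr_ge0 exprn_ge0.
set C := (_ ^ _)%:R; set e := 2 ^- n; nra.
Qed.

Lemma tail_small B k n : exists N0, forall N t, (N0 <= N)%N -> 0 <= t -> t <= B%:R ->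
  n%:R * tail t N <= t ^+ k.
Proof.
pose B' := B.+1; pose C := (B'.*2 ^ B'.*2)%N.
exists (maxn k (n * C)) => N t; rewrite geq_max => /andP[kN nN] t0 tB.
have tB' : t <= B'%:R by rewrite (le_trans tB) // ler_nat.
have N2 : (N <= N.*2)%N by rewrite -addnn leq_addr.
have h := @tail_geom B' k N N.*2 t isT kN N2 t0 tB'; rewrite -/C in h.
apply: (@le_trans _ _ (n%:R * (t ^+ k * C%:R * 2 ^- N))).
  apply: ler_wpM2l => //; apply: le_trans h _; apply: ler_wpM2l.
    by rewrite mulr_ge0 ?exprn_ge0.
  by rewrite lerBlDr lerDl invr_ge0 exprn_ge0.
have -> : n%:R * (t ^+ k * C%:R * 2 ^- N) = t ^+ k * ((n * C)%:R / 2 ^+ N).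
  by rewrite natrM; field; rewrite expf_neq0 ?pnatr_eq0.
rewrite ler_piMr ?exprn_ge0 // ler_pdivrMr ?exprn_gt0 // mul1r -natrX ler_nat.
by apply: leq_trans nN _; apply: ltnW; rewrite ltn_expl.
Qed.

Lemma tail_ge0 t n : 0 <= t -> 0 <= tail t n.
Proof. by move=> t0; rewrite subr_ge0 tay_mono_n // -addnn leq_addr. Qed.

(** For negative p, the product of the truncations at p and -p is within 1/2 of 1, and the one at -p
    is bounded above. *)
Lemma tod_lower B : exists E r0, (0 < E)%N /\ forall p r, `|p| <= B%:R -> (r0 <= r)%N ->
  E%:R^-1 <= tod p r.
Proof.
have [E E0 hE] := tay_bounded B; have [N0 hN] := tail_small B.*2 0 2.
exists (2 * E)%N, N0; split=> [|p r pB rN]; first by rewrite muln_gt0.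
have E0K : 0 < E%:R :> K by rewrite ltr0n.
have [p0|p0] := lerP 0 p.
  apply: le_trans (tay_ge1 _ p0); rewrite invf_le1 ?ler1n ?ltr0n muln_gt0 //.
have := tayM_approx p (- p) r.*2.+1; rewrite subrr tay0 normrN => h1.
have := hN r.*2.+1 (`|p| + `|p|); rewrite expr0 => h2.
have {}h2 : 2 * tail (`|p| + `|p|) r.*2.+1 <= 1.
  apply: h2; first by rewrite (leq_trans rN) // -addnn -addnS leq_addr.
    by rewrite addr_ge0.
  by rewrite -addnn natrD lerD.
have h3 : tay (- p) r.*2.+1 <= E%:R.
  by apply: hE; [rewrite oppr_ge0 ltW|rewrite -(ltr0_norm p0)].
have h4 : 1 <= tay (- p) r.*2.+1 by apply: tay_ge1; rewrite oppr_ge0 ltW.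
move: h1; rewrite ler_norml => /andP[h1 _].
have h5 : 1 / 2 <= tod p r * tay (- p) r.*2.+1 by move: h1 h2; rewrite /tod; lra.
have h6 : 0 < tod p r by move: h5 h4; nra.
rewrite natrM -[leLHS]mul1r ler_pdivrMr ?mulr_gt0 //.
have := ler_wpM2l (ltW h6) h3; move: h5; nra.
Qed.

(* Each partial product is short of the next one by a multiple of the first   *)
(* omitted even power, which absorbs the tail for s large.                    *)
Lemma tod_mul_fin B r : exists s0, forall s p q, (s0 <= s)%N ->
  `|p| <= B%:R -> `|q| <= B%:R -> 0 < tod p r -> 0 < tod q r ->
  tod p r * tod q r <= tod (p + q) s.
Proof.
have [E [r0 [E0 hE]]] := tod_lower B.
pose k := r.+1.*2; pose M := (2 ^ k * E * k.+1`!)%N.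
have [N0 hN] := tail_small B.*2 k M.
exists (maxn N0 (maxn r0 r.+1)) => s p q; rewrite !geq_max => /and3P[s1 s2 s3].
have E0K : 0 < E%:R :> K by rewrite ltr0n.
wlog qp : p q / `|q| <= `|p|.
  move=> H pB qB tp tq; have /orP[h|h] := le_total `|q| `|p|; first exact: H.
  by rewrite mulrC addrC; apply: H.
move=> pB qB tp tq.
have gp := tod_gap (ltW (tod_gt0_bound tp)) s3.
have gq := tod_gt0_mono tq (ltnW s3).
have lp := hE p s pB s2; have lq := hE q s qB s2.
have := tayM_approx p q s.*2.+1; rewrite ler_norml => /andP[_].
rewrite -/(tod p s) -/(tod q s) -/(tod (p + q) s) => h1.
have h2 : M%:R * tail (`|p| + `|q|) s.*2.+1 <= (`|p| + `|q|) ^+ k.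
  apply: hN; [by rewrite (leq_trans s1) // -addnn -addnS leq_addr|by rewrite addr_ge0|].
  by rewrite -addnn natrD lerD.
have h3 : (`|p| + `|q|) ^+ k <= 2 ^+ k * p ^+ k.
  have -> : p ^+ k = `|p| ^+ k by rewrite -normrX ger0_norm // even_expr_ge0.
  rewrite -exprMn; apply: lerXn2r; rewrite ?nnegrE ?addr_ge0 ?mulr_ge0 //.
  by rewrite mulrDl mul1r lerD2l.
have pk0 : 0 <= p ^+ k by exact: even_expr_ge0.
have fk := fact_gt0R k.+1.
have h4 : tail (`|p| + `|q|) s.*2.+1 <= p ^+ k / (E%:R * (k.+1)`!%:R).
  rewrite ler_pdivlMr ?mulr_gt0 //.
  have P2 : 0 < 2 ^+ k :> K by rewrite exprn_gt0.
  rewrite -(ler_pM2l P2); apply: le_trans h3; apply: le_trans h2.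
  have -> : M%:R = 2 ^+ k * E%:R * (k.+1)`!%:R :> K by rewrite /M natrM natrM natrX.
  by apply: eq_ler; ring.
have h5 : tod p r * tod q r + p ^+ k / (E%:R * (k.+1)`!%:R) <= tod p s * tod q s.
  have h6 : p ^+ k / (E%:R * (k.+1)`!%:R) <= (tod p s - tod p r) * tod q s.
    apply: (@le_trans _ _ (p ^+ k / (k.+1)`!%:R * E%:R^-1)).
      by apply: eq_ler; rewrite invfM; ring.
    apply: ler_pM => //; first by rewrite divr_ge0 // ltW.
    rewrite lerBrDl; apply: le_trans gp; rewrite lerD2l -/k.
    have -> : 2 / (k.+1)`!%:R * p ^+ k = p ^+ k / (k.+1)`!%:R + p ^+ k / (k.+1)`!%:R by ring.
    by rewrite lerDl divr_ge0 // ltW.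
  have h7 := ler_wpM2l (ltW tp) gq; set X := _ / _ in h6 *.
  by rewrite mulrBl in h6; rewrite -lerBrDl; apply: le_trans h6 _; rewrite lerD2l lerN2.
set X := _ / _ in h4 h5; set Y := tail _ _ in h1 h4.
by move: h1 h4 h5; rewrite lerBlDr; move: (tod p s * _) (tod p r * _) (tod (p + q) s) => *; lra.
Qed.

(** Two nonnegative arguments compare termwise. A negative q is finite by [tod_gt0_bound]; if p + q
    >= 0, then the truncation at p is at most the product of those at p + q and -q, and those at q
    and -q multiply to at most 1. Otherwise both arguments are finite and [tod_mul_fin] applies. *)
Lemma tod_mul p q r : 0 < tod p r -> 0 < tod q r ->
  exists s, forall s', (s <= s')%N -> tod p r * tod q r <= tod (p + q) s'.
Proof.
wlog qp : p q / q <= p.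
  move=> H tp tq; have /orP[h|h] := le_total q p; first exact: H.
  by rewrite mulrC addrC; apply: H.
move=> tp tq; have [q0|q0] := lerP 0 q.
  have p0 : 0 <= p by exact: le_trans q0 qp.
  exists r.*2.+1 => s' ss; apply: le_trans (tayM_le _ _ p0 q0) _.
  by apply: tay_mono_n; [exact: addr_ge0|lia].
have bq := tod_gt0_bound tq.
have nq : `|q| <= r.*2.+1%:R by rewrite ltr0_norm // lerNl ltW.
have [pq|pq] := lerP 0 (p + q).
  have [s0 hs] := tod_mul_fin r.*2.+1 r.
  have nq0 : 0 <= - q by rewrite oppr_ge0 ltW.
  have h1 : tod (- q) r * tod q r <= 1.
    have := hs s0 (- q) q (leqnn _); rewrite addNr /tod tay0; apply=> //.
      by rewrite normrN.
    by apply: lt_le_trans (tay_ge1 _ nq0).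
  exists r => s' ss; apply: (@le_trans _ _ (tod (p + q) r)); last first.
    by apply: tay_mono_n => //; rewrite ltnS leq_double.
  have h2 := tayD_le r.*2.+1 pq nq0; rewrite addrK in h2.
  have h3 := tay_ge1 r.*2.+1 pq; move: h1 h2 h3 tq tp; rewrite /tod.
  set A := tay p _; set D := tay q _; set G := tay (p + q) _; set H := tay (- q) _.
  move=> h1 h2 h3 tq tp; have := ler_wpM2r (ltW tq) h2; nra.
have np : `|p| <= r.*2.+1%:R.
  rewrite ler_norml; apply/andP; split; first exact/ltW/tod_gt0_bound.
  by move: bq pq; lra.
have [s0 hs] := tod_mul_fin r.*2.+1 r.
by exists s0 => s' ss; apply: hs.
Qed.

Lemma tod_mul_lt p q r : p != 0 -> 0 < tod p r -> 0 < tod q r ->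
  exists s, forall s', (s <= s')%N -> tod p r * tod q r < tod (p + q) s'.
Proof.
move=> p0 tp tq.
have h1 := tod_strict p0 tp (ltnSn r); have h2 := tod_gt0_mono tq (leqnSn r).
have [||s hs] := @tod_mul p q r.+1; [exact: lt_trans h1|exact: lt_le_trans h2|].
exists s => s' ss; apply: lt_le_trans (hs _ ss); nra.
Qed.

(** Counterpart of [tod_mul] for arguments of equal sign. For negative arguments both are finite,
    and the gap between two truncations at p + q absorbs the error of [tayM_approx]. *)
Lemma tod_split p q r : (0 <= p) && (0 <= q) || (p <= 0) && (q <= 0) ->
  0 < tod (p + q) r ->
  exists s, [/\ 0 < tod p s, 0 < tod q s & tod (p + q) r <= tod p s * tod q s].
Proof.
case/orP=> /andP[p0 q0] tpq.
  exists r; split; last exact: tayD_le.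
    by apply: lt_le_trans (tay_ge1 _ p0).
  by apply: lt_le_trans (tay_ge1 _ q0).
have b := tod_gt0_bound tpq; pose B := r.*2.+1; pose k := r.+1.*2.
have [E [r0 [E0 hE]]] := tod_lower B.
have [N0 hN] := tail_small B k k.+1`!.
pose s := maxn N0 (maxn r0 r.+1).
have s1 : (N0 <= s)%N by exact: leq_maxl.
have s2 : (r0 <= s)%N by rewrite /s; lia.
have s3 : (r < s)%N by rewrite /s; lia.
have E0K : 0 < E%:R^-1 :> K by rewrite invr_gt0 ltr0n.
have pB : `|p| <= B%:R by rewrite ler0_norm //; move: b; rewrite -/B; lra.
have qB : `|q| <= B%:R by rewrite ler0_norm //; move: b; rewrite -/B; lra.
exists s; split.
- by apply: lt_le_trans (hE _ _ pB s2).
- by apply: lt_le_trans (hE _ _ qB s2).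
have g := tod_gap (ltW b) s3.
have := tayM_approx p q s.*2.+1; rewrite ler_norml => /andP[+ _].
rewrite -/(tod p s) -/(tod q s) -/(tod (p + q) s) => h1.
have T : `|p| + `|q| = - (p + q) by rewrite !ler0_norm // opprD.
have h2 : (k.+1)`!%:R * tail (`|p| + `|q|) s.*2.+1 <= (p + q) ^+ k.
  have -> : (p + q) ^+ k = (`|p| + `|q|) ^+ k.
    by rewrite T exprNn -signr_odd /k odd_double mul1r.
  apply: hN; [by rewrite (leq_trans s1) // -addnn -addnS leq_addr|by rewrite addr_ge0|].
  by rewrite T; move: b; rewrite -/B; lra.
have fk := fact_gt0R k.+1.
have h3 : tail (`|p| + `|q|) s.*2.+1 <= (p + q) ^+ k / (k.+1)`!%:R.
  by rewrite ler_pdivlMr // mulrC.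
have h4 : 0 <= (p + q) ^+ k / (k.+1)`!%:R.
  by rewrite divr_ge0 ?even_expr_ge0 // ltW.
move: g; rewrite -/k mulrAC -mulrA; move: h1 h3 h4.
by set X := _ ^+ _ / _; set Y := tail _ _; lra.
Qed.

End Taylor.

(** * Gonshor's exponential *)

(** The default [gzero] agrees with the field convention 0^-1 = 0, so zero is included. *)
Lemma ginvP x : surreal x -> surreal (ginv x) /\ cl (ginv x) = (cl x)^-1.
Proof.
move=> sx; rewrite /ginv; case: xgetP => [z _ [sz E]|H].
  have {}E : cl x * cl z = 1.
    by rewrite -clM //; apply/cl_eq => //; exact: surreal_mul.
  split=> //; apply: (@mulfI _ (cl x)).
    by apply: contra_eq_neq E => ->; rewrite mul0r eq_sym oner_eq0.
  by rewrite E mulfV //; apply: contra_eq_neq E => ->; rewrite mul0r eq_sym oner_eq0.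
split; first exact: surreal_zero.
have [->|x0] := eqVneq (cl x) 0; first by rewrite invr0 cl0.
exfalso; apply: (H (No_rep (cl x)^-1)); split; first exact: surreal_rep.
apply/cl_eq; [by apply: surreal_mul => //; exact: surreal_rep|exact: surreal_one|].
by rewrite clM ?cl_rep ?mulfV //; exact: surreal_rep.
Qed.

Lemma surreal_div x y : surreal x -> surreal y -> surreal (gdiv x y).
Proof. by move=> sx /ginvP[sy _]; exact: surreal_mul. Qed.

Lemma cl_div x y : surreal x -> surreal y -> cl (gdiv x y) = cl x / cl y.
Proof. by move=> sx /ginvP[sy <-]; rewrite clM. Qed.

Lemma surreal_nat n : surreal (gnat n).
Proof.
by elim: n => [|n IH]; [exact: surreal_zero|apply: surreal_add => //; exact: surreal_one].
Qed.

Lemma cl_nat n : cl (gnat n) = n%:R.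
Proof.
elim: n => [|n IH]; first exact: cl0.
rewrite -[gnat n.+1]/(gadd (gnat n) gone) clD ?IH ?cl1 ?natr1 //.
  exact: surreal_nat.
Qed.

Lemma gexpnP x n : surreal x -> surreal (gexpn x n) /\ cl (gexpn x n) = cl x ^+ n.
Proof.
move=> sx; elim: n => [|n [s1 s2]].
  by split; [exact: surreal_one|rewrite expr0; exact: cl1].
rewrite -[gexpn x n.+1]/(gmul x (gexpn x n)).
by split; [exact: surreal_mul|rewrite clM // s2 exprS].
Qed.

Lemma gtaylorP x n : surreal x -> surreal (gtaylor x n) /\ cl (gtaylor x n) = tay (cl x) n.
Proof.
move=> sx; rewrite /gtaylor /tay; elim/big_rec2: _ => [|i y1 y2 _ [s1 s2]].
  by split; [exact: surreal_zero|exact: cl0].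
have [t1 t2] := gexpnP i sx; have sn := surreal_nat i`!.
have sd := surreal_div t1 sn.
split; first exact: surreal_add.
by rewrite clD // cl_div // s2 t2 cl_nat.
Qed.

Definition ex x := cl (gexp x).

Lemma gexp_optl x c : Op true (gexp x) c <->
  [\/ c = gzero,
      exists2 o, Op true x o & exists n, c = gmul (gexp o) (gtaylor (gsub x o) n)
    | exists2 o, Op false x o & exists2 n, glt gzero (gtaylor (gsub x o) n.*2.+1) &
        c = gmul (gexp o) (gtaylor (gsub x o) n.*2.+1)].
Proof.
case: x => L R l r; split.
  case=> -[[[]|[i n]]|[[j n] h]] ->; first exact: Or31.
    by apply: Or32; exists (l i); [exists i|exists n].
  by apply: Or33; exists (r j); [exists j|exists n].
case=> [->|[z [i ->] [n ->]]|[z [j ->] [n h ->]]].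
- by exists (inl (inl tt)).
- by exists (inl (inr (i, n))).
- by exists (inr (exist _ (j, n) h)).
Qed.

Lemma gexp_optr x c : Op false (gexp x) c <->
  (exists2 o, Op true x o & exists2 n, glt gzero (gtaylor (gsub o x) n.*2.+1) &
     c = gdiv (gexp o) (gtaylor (gsub o x) n.*2.+1)) \/
  (exists2 o, Op false x o & exists n, c = gdiv (gexp o) (gtaylor (gsub o x) n)).
Proof.
case: x => L R l r; split.
  case=> -[[[i n] h]|[j n]] ->.
    by left; exists (l i); [exists i|exists n].
  by right; exists (r j); [exists j|exists n].
case=> [[ o [i ->] [n h ->]]|[ o [j ->] [n ->]]].
- by exists (inl (exist _ (i, n) h)).
- by exists (inr (j, n)).
Qed.

Lemma ex_gt0 x : surreal (gexp x) -> 0 < ex x.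
Proof.
move=> se; rewrite -cl0; apply: (@cl_opt true) => //; apply/gexp_optl.
exact: Or31.
Qed.

Lemma glt0 x : surreal x -> glt gzero x <-> 0 < cl x.
Proof.
move=> sx; rewrite -cl0; have s0 := surreal_zero; split=> [[_ h]|/cl_lt h].
  exact/cl_lt.
by split; [apply: surreal_total; last exact: h|exact: h].
Qed.

Section ExpOptions.
Variable x : game.
Hypothesis sx : surreal x.
Hypothesis so : forall s o, Op s x o -> surreal (gexp o).

Let taylor_sub o n : surreal o ->
  (surreal (gtaylor (gsub x o) n) /\ cl (gtaylor (gsub x o) n) = tay (cl x - cl o) n) /\
  (surreal (gtaylor (gsub o x) n) /\ cl (gtaylor (gsub o x) n) = tay (cl o - cl x) n).
Proof.
move=> s1; have [] := gtaylorP n (surreal_sub sx s1).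
have [] := gtaylorP n (surreal_sub s1 sx).
by rewrite !clB.
Qed.

Lemma tay_le_tod (p : No) n : 0 <= p -> tay p n <= tod p n.
Proof. by move=> p0; apply: tay_mono_n => //; lia. Qed.

(** Odd truncations are cofinal, because [tay] is at most [tod] at nonnegative arguments. Left and
    right options of x then contribute bounds of the same form. *)
Lemma gexp_left c : Op true (gexp x) c -> surreal c /\
  (cl c = 0 \/ exists s o r, [/\ Op s x o, 0 < tod (cl x - cl o) r, 0 <= cl c &
     cl c <= ex o * tod (cl x - cl o) r]).
Proof.
case/gexp_optl=> [->|[ o oo [n ->]]|[ o oo [n h ->]]].
- by split; [exact: surreal_zero|left; exact: cl0].
- have s1 := surreal_opt sx oo; have [[t1 t2] _] := taylor_sub n s1.
  have se := so oo; have e0 := ex_gt0 se.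
  have := cl_opt sx oo => /= lt; have p0 : 0 <= cl x - cl o by rewrite subr_ge0 ltW.
  have q0 := tay_ge1 n p0; have q1 := tay_le_tod n p0.
  split; first exact: surreal_mul.
  right; exists true, o, n; split=> //.
  + by apply: lt_le_trans q1; apply: lt_le_trans q0.
  + by rewrite clM // t2 mulr_ge0 ?ltW //; apply: lt_le_trans q0.
  + by rewrite clM // t2 ler_pM2l.
- have s1 := surreal_opt sx oo; have [[t1 t2] _] := taylor_sub n.*2.+1 s1.
  have se := so oo; have e0 := ex_gt0 se.
  move/glt0: h => /(_ t1); rewrite t2 => h.
  split; first exact: surreal_mul.
  right; exists false, o, n; split=> //.
  + by rewrite clM // t2 mulr_ge0 ?ltW.
  + by rewrite clM // t2.
Qed.

Lemma gexp_right c : Op false (gexp x) c -> surreal c /\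
  exists s o r, [/\ Op s x o, 0 < tod (cl o - cl x) r &
     ex o / tod (cl o - cl x) r <= cl c].
Proof.
case/gexp_optr=> [[ o oo [n h ->]]|[ o oo [n ->]]].
- have s1 := surreal_opt sx oo; have [_ [t1 t2]] := taylor_sub n.*2.+1 s1.
  have se := so oo; have e0 := ex_gt0 se.
  move/glt0: h => /(_ t1); rewrite t2 => h.
  split; first exact: surreal_div.
  exists true, o, n; split=> //.
  by rewrite cl_div // t2.
- have s1 := surreal_opt sx oo; have [_ [t1 t2]] := taylor_sub n s1.
  have se := so oo; have e0 := ex_gt0 se.
  have := cl_opt sx oo => /= lt; have p0 : 0 <= cl o - cl x by rewrite subr_ge0 ltW.
  have q0 := tay_ge1 n p0; have q1 := tay_le_tod n p0.
  have q2 : 0 < tay (cl o - cl x) n by apply: lt_le_trans q0.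
  have q3 := lt_le_trans q2 q1.
  split; first exact: surreal_div.
  exists false, o, n; split=> //.
  by rewrite cl_div // t2 ler_pM2l // lef_pV2.
Qed.

Lemma gexp_leftI s o r : Op s x o -> 0 < tod (cl x - cl o) r ->
  exists2 c, Op true (gexp x) c & cl c = ex o * tod (cl x - cl o) r.
Proof.
move=> oo h; have s1 := surreal_opt sx oo; have [[t1 t2] _] := taylor_sub r.*2.+1 s1.
exists (gmul (gexp o) (gtaylor (gsub x o) r.*2.+1)).
  apply/gexp_optl; case: s oo => oo; first by apply: Or32; exists o => //; exists r.*2.+1.
  by apply: Or33; exists o => //; exists r => //; apply/glt0; rewrite ?t2.
by rewrite clM ?t2 //; exact: so oo.
Qed.

Lemma gexp_rightI s o r : Op s x o -> 0 < tod (cl o - cl x) r ->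
  exists2 c, Op false (gexp x) c & cl c = ex o / tod (cl o - cl x) r.
Proof.
move=> oo h; have s1 := surreal_opt sx oo; have [_ [t1 t2]] := taylor_sub r.*2.+1 s1.
exists (gdiv (gexp o) (gtaylor (gsub o x) r.*2.+1)).
  apply/gexp_optr; case: s oo => oo; last by right; exists o => //; exists r.*2.+1.
  by left; exists o => //; exists r => //; apply/glt0; rewrite ?t2.
by rewrite cl_div ?t2 //; exact: so oo.
Qed.

Lemma cl_opt_neq s o : Op s x o -> cl x - cl o != 0.
Proof.
by move=> oo; have := cl_opt sx oo; rewrite subr_eq0; case: s oo => oo;
  [move/gt_eqF|move/lt_eqF] => ->.
Qed.

Lemma ex_opt s o r : surreal (gexp x) -> Op s x o ->
  ex o * tod (cl x - cl o) r < ex x /\ ex x * tod (cl o - cl x) r < ex o.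
Proof.
move=> sex oo; have e0 := ex_gt0 sex; have e1 := ex_gt0 (so oo).
split.
  have [h|h] := lerP (tod (cl x - cl o) r) 0.
    by apply: le_lt_trans e0; rewrite pmulr_rle0.
  by have [c oc <-] := gexp_leftI oo h; apply: (@cl_opt true).
have [h|h] := lerP (tod (cl o - cl x) r) 0.
  by apply: le_lt_trans e1; rewrite pmulr_rle0.
by have [c oc E] := gexp_rightI oo h; rewrite -ltr_pdivlMr // -E; apply: (@cl_opt false).
Qed.

End ExpOptions.

(** Gonshor's defining inequalities, extended from options of x to arbitrary pairs, together with
    compatibility with equality of surreals. *)
Definition ex_ok x y := (cl x = cl y -> ex x = ex y) /\
  (cl x != cl y -> forall r, ex x * tod (cl y - cl x) r < ex y /\
                             ex y * tod (cl x - cl y) r < ex x).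

Lemma ex_ok_weak x y : ex_ok x y ->
  forall r, ex x * tod (cl y - cl x) r <= ex y /\ ex y * tod (cl x - cl y) r <= ex x.
Proof.
move=> [h1 h2] r; have [E|ne] := eqVneq (cl x) (cl y).
  by rewrite E subrr /tod tay0 !mulr1 h1.
by have [h3 h4] := h2 ne r; split; apply: ltW.
Qed.

Lemma ex_ok_sym x y : ex_ok x y -> ex_ok y x.
Proof.
move=> [h1 h2]; split=> [/esym/h1 -> //|]; rewrite eq_sym => /h2 h r.
by have [] := h r.
Qed.

(** For b between a and c, [tod_split] factors the truncation at c - a through b. *)
Lemma ex_chain (u v w : No) (a b c : No) : 0 < u -> 0 < v -> 0 < w ->
  (a <= b <= c) || (c <= b <= a) ->
  (forall r, u * tod (b - a) r <= v) -> (forall r, v * tod (c - b) r <= w) ->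
  (forall r, u * tod (b - a) r < v) \/ (forall r, v * tod (c - b) r < w) ->
  forall r, u * tod (c - a) r < w.
Proof.
move=> u0 v0 w0 abc h1 h2 h3 r.
have [h|h] := lerP (tod (c - a) r) 0; first by apply: le_lt_trans w0; rewrite pmulr_rle0.
have E : c - a = (b - a) + (c - b) by ring.
rewrite E in h *.
have [|s [s1 s2 s3]] := tod_split _ h.
  by case/orP: abc => /andP[ab bc]; rewrite !subr_ge0 !subr_le0 ab bc ?orbT.
apply: (@le_lt_trans _ _ (u * tod (b - a) s * tod (c - b) s)).
  by rewrite -mulrA ler_pM2l.
case: h3 => [h3|h3].
  by apply: lt_le_trans (h2 s); rewrite ltr_pM2r.
by apply: le_lt_trans (h3 s); rewrite ler_pM2r.
Qed.

Section ExpMonotone.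
Variable V : game -> Prop.
Hypothesis Vo : forall s x a, V x -> Op s x a -> V a.
Hypothesis Vs : forall x, V x -> surreal x.
Hypothesis Ve : forall x, V x -> surreal (gexp x).

(** Equality follows from simplicity; for x < y, one chains through an option lying between them. As
    in [mul_monoP], [V] is the class on which [gexp] is already known to be surreal. *)
Lemma ex_okP x y : V x -> V y -> ex_ok x y.
Proof.
elim/game_opt_ind: x y => x IHx y; elim/game_opt_ind: y => y IHy Vx Vy.
have sx := Vs Vx; have sy := Vs Vy; have ux := Ve Vx; have uy := Ve Vy.
have ex0 := ex_gt0 ux; have ey0 := ex_gt0 uy.
have sox s o : Op s x o -> surreal (gexp o) by move=> oo; apply/Ve/(Vo Vx oo).
have soy s o : Op s y o -> surreal (gexp o) by move=> oo; apply/Ve/(Vo Vy oo).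
split=> [E|].
  have half u v : V u -> V v -> cl u = cl v ->
      (forall s o, Op s u o -> ex_ok o v) ->
      (forall b, Op true (gexp u) b -> cl b < ex v) /\
      (forall b, Op false (gexp u) b -> ex v < cl b).
    move=> Vu Vv uv H; have su := Vs Vu; have ev0 := ex_gt0 (Ve Vv).
    have sou s o : Op s u o -> surreal (gexp o) by move=> oo; apply/Ve/(Vo Vu oo).
    split=> c.
      case/(gexp_left su sou) => _ [->//|[s [ o [r [oo h _ hc]]]]].
      have [_ h2] := H _ _ oo; have := cl_opt_neq su oo; rewrite uv subr_eq0 eq_sym => ne.
      by apply: le_lt_trans hc _; rewrite uv; have [] := h2 ne r.
    case/(gexp_right su sou) => _ [s [ o [r [oo h hc]]]].
    have [_ h2] := H _ _ oo; have := cl_opt_neq su oo; rewrite uv subr_eq0 eq_sym => ne.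
    apply: lt_le_trans hc; rewrite ltr_pdivlMr //; rewrite uv in h *.
    by have [] := h2 ne r.
  have [|h1 h2] := half x y Vx Vy E; first by move=> s o oo; apply: IHx oo _ (Vo Vx oo) Vy.
  have [|h3 h4] := half y x Vy Vx (esym E).
    by move=> s o oo; apply/ex_ok_sym/(IHy _ _ oo) => //; exact: Vo oo.
  exact: cl_simplest.
have lt u v : V u -> V v -> (forall s o, Op s u o -> ex_ok o v) ->
    (forall s o, Op s v o -> ex_ok u o) -> cl u < cl v ->
    forall r, ex u * tod (cl v - cl u) r < ex v /\ ex v * tod (cl u - cl v) r < ex u.
  move=> Vu Vv Hu Hv /cl_lt-/(_ (Vs Vu) (Vs Vv)) /ngleP lt r.
  have su := Vs Vu; have sv := Vs Vv.
  have u0 := ex_gt0 (Ve Vu); have v0 := ex_gt0 (Ve Vv).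
  have sou s o : Op s u o -> surreal (gexp o) by move=> oo; apply/Ve/(Vo Vu oo).
  have sov s o : Op s v o -> surreal (gexp o) by move=> oo; apply/Ve/(Vo Vv oo).
  case: lt => [[ o oo uo]|[ o oo ov]].
    have so := surreal_opt sv oo; have o0 := ex_gt0 (sov _ _ oo).
    have {uo} uo : cl u <= cl o by apply/cl_le.
    have /= ov := cl_opt sv oo.
    have W := ex_ok_weak (Hv _ _ oo); have S k := ex_opt sv sov k (Ve Vv) oo.
    split.
      apply: (@ex_chain _ (ex o) _ _ (cl o)) => //.
      - by rewrite uo ltW.
      - by move=> k; have [] := W k.
      - by move=> k; have [/ltW] := S k.
      - by right=> k; have [] := S k.
    apply: (@ex_chain _ (ex o) _ _ (cl o)) => //.
    - by rewrite uo (ltW ov) orbT.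
    - by move=> k; have [_ /ltW] := S k.
    - by move=> k; have [] := W k.
    - by left=> k; have [] := S k.
  have so := surreal_opt su oo; have o0 := ex_gt0 (sou _ _ oo).
  have {ov} ov : cl o <= cl v by apply/cl_le.
  have /= uo := cl_opt su oo.
  have W := ex_ok_weak (Hu _ _ oo); have S k := ex_opt su sou k (Ve Vu) oo.
  split.
    apply: (@ex_chain _ (ex o) _ _ (cl o)) => //.
    - by rewrite ov ltW.
    - by move=> k; have [_ /ltW] := S k.
    - by move=> k; have [] := W k.
    - by left=> k; have [] := S k.
  apply: (@ex_chain _ (ex o) _ _ (cl o)) => //.
  - by rewrite ov (ltW uo) orbT.
  - by move=> k; have [] := W k.
  - by move=> k; have [/ltW] := S k.
  - by right=> k; have [] := S k.
rewrite neq_lt => /orP[xy|yx] r.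
  apply: lt => // s o oo; first by apply: IHx oo _ (Vo Vx oo) Vy.
  by apply: (IHy _ _ oo) => //; exact: Vo oo.
have := lt y x Vy Vx _ _ yx r; case=> // s o oo.
  by apply/ex_ok_sym/(IHy _ _ oo) => //; exact: Vo oo.
by apply/ex_ok_sym/(IHx _ _ oo) => //; exact: Vo oo.
Qed.

End ExpMonotone.

(** A left option from o stays below a right option from o' because the truncations at x - o and o'
    - x multiply to less than one at o' - o, which is at most exp o' / exp o by induction. *)
Lemma surreal_exp x : surreal x -> surreal (gexp x).
Proof.
elim/gsub_ind: x => x IH sx.
have so s o : Op s x o -> surreal (gexp o).
  by move=> oo; apply: IH (gsub_opt oo) (surreal_opt sx oo).
have ok s o t o' : Op s x o -> Op t x o' -> ex_ok o o'.
  move=> oo oo'; apply: (@ex_okP (gsub_pos x)).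
  - by move=> u y a; apply: gsub_trans.
  - by move=> y; apply: surreal_sub_pos.
  - by move=> y xy; apply: IH xy (surreal_sub_pos sx xy).
  - exact: gsub_opt oo.
  - exact: gsub_opt oo'.
apply/surrealP; split=> [c d oc od|[] c oc]; last first.
- by have [] := gexp_right sx so oc.
- by have [] := gexp_left sx so oc.
have [sc hc] := gexp_left sx so oc; have [sd hd] := gexp_right sx so od.
apply/cl_lt => //; case: hd => t [ o' [r' [oo' h' hd]]]; apply: lt_le_trans hd.
have e0' := ex_gt0 (so _ _ oo').
case: hc => [->|[s [ o [r [oo h _ hc]]]]]; first by rewrite divr_gt0.
apply: le_lt_trans hc _; have e0 := ex_gt0 (so _ _ oo).
pose m := maxn r r'.
have p1 := tod_gt0_mono h (leq_maxl r r'); have p2 := tod_gt0_mono h' (leq_maxr r r').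
rewrite ltr_pdivlMr // -mulrA.
have [||s0 hs] := @tod_mul_lt _ (cl x - cl o) (cl o' - cl x) m (cl_opt_neq sx oo).
- exact: lt_le_trans p1.
- exact: lt_le_trans p2.
have := hs _ (leqnn _); have -> : cl x - cl o + (cl o' - cl x) = cl o' - cl o by ring.
move=> H; have [W _] := ex_ok_weak (ok _ _ _ _ oo oo') s0.
apply: lt_le_trans W; rewrite ltr_pM2l //; apply: le_lt_trans H.
by apply: ler_pM => //; apply: ltW.
Qed.

Lemma ex_okT x y : surreal x -> surreal y -> ex_ok x y.
Proof.
apply: (@ex_okP surreal) => //; last exact: surreal_exp.
by move=> s u v su; apply: surreal_opt su.
Qed.

Definition Exp (a : No) : No := ex (No_rep a).

Lemma Exp_cl x : surreal x -> cl (gexp x) = Exp (cl x).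
Proof.
move=> sx; have [h _] := ex_okT sx (surreal_rep (cl x)).
by apply: h; rewrite cl_rep.
Qed.

Lemma Exp_gt0 a : 0 < Exp a.
Proof. by apply/ex_gt0/surreal_exp/surreal_rep. Qed.

Lemma Exp_cut a b r : a != b -> Exp a * tod (b - a) r < Exp b.
Proof.
have [_ h] := ex_okT (surreal_rep a) (surreal_rep b).
by move: h; rewrite !cl_rep => h /h/(_ r)[].
Qed.

Lemma Exp0 : Exp 0 = 1.
Proof.
rewrite -cl0 -Exp_cl; last exact: surreal_zero.
have s0 := surreal_zero; have s1 := surreal_one.
have se := surreal_exp s0.
rewrite -cl1; apply: cl_simplest => // b.
- by case/(gexp_left s0) => [s o /gzero_opt//|_ [->|[s [ o [r [/gzero_opt]]]]]] //; rewrite cl1.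
- by case/(gexp_right s0) => [s o /gzero_opt//|_ [s [ o [r [/gzero_opt]]]]].
- by case/gone_opt=> _ ->; rewrite cl0; exact: ex_gt0.
- by case/gone_opt.
Qed.

(** * Multiplicativity of the exponential *)

Section HomEstimates.
Variable K : realFieldType.
Implicit Types (p q z u v a b : K) (s t : bool).

(** These inequalities hold for z = exp p but do not determine z; [zeta_small] and [inf_gap] measure
    the remaining freedom. *)
Definition ecut p z := 0 < z /\ forall r, tod p r < z /\ z * tod (- p) r < 1.

(* [u * z] is one of the options by which the cut [ecut p] is defined. *)
Definition eapp s p z u := exists k, if s then 0 < tod p k /\ u * z = tod p k
  else 0 < tod (- p) k /\ u * z * tod (- p) k = 1.

Definition edist s u : K := if s then 1 - u else u - 1.

Lemma tay_le_norm p n : tay p n <= tay `|p| n.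
Proof.
apply: ler_sum => i _; rewrite ler_pM2r ?invr_gt0 ?fact_gt0R // -normrX.
exact: ler_norm.
Qed.

(** The next truncation still satisfies the cut, so an option misses z by at least the gap of
    [tod_gapS]: a fixed power of p, up to a natural factor. *)
Lemma fin_gap B p z s u : `|p| <= B%:R -> p != 0 -> ecut p z -> eapp s p z u ->
  exists m n, 0 < edist s u /\ `|p| ^+ m <= n%:R * edist s u.
Proof.
move=> pB p0 [z0 hz] [k hk]; have [E E0 hE] := @tay_bounded K B.
have E0K : 0 < E%:R :> K by rewrite ltr0n.
have tE q : `|q| = `|p| -> forall r, tod q r <= E%:R.
  by move=> qp r; apply: le_trans (tay_le_norm _ _) _; rewrite qp; exact: hE.
pose m := k.+1.*2; exists m, (E * m.+1`!)%N.
have pm q : `|q| = `|p| -> q ^+ m = `|p| ^+ m.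
  by move=> <-; rewrite -normrX ger0_norm // even_expr_ge0.
have pm0 : 0 < `|p| ^+ m by rewrite exprn_gt0 // normr_gt0.
have f0 := fact_gt0R K m.+1.
have key q : `|q| = `|p| -> 0 < tod q k -> `|p| ^+ m <= m.+1`!%:R * (tod q k.+1 - tod q k).
  move=> qp tq; have := tod_gapS (ltW (tod_gt0_bound tq)); rewrite -/m pm // => h.
  have {h} h : 2 / m.+1`!%:R * `|p| ^+ m <= tod q k.+1 - tod q k by rewrite lerBrDl.
  rewrite -ler_pdivrMl //; apply: le_trans h.
  have : 0 < m.+1`!%:R^-1 * `|p| ^+ m by rewrite mulr_gt0 ?invr_gt0.
  by rewrite -mulrA; set X := _ * _; lra.
suff [h1 h2] : 0 < edist s u /\ m.+1`!%:R^-1 * `|p| ^+ m <= E%:R * edist s u.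
  split=> //; rewrite ler_pdivrMl // in h2.
  by rewrite natrM [E%:R * _]mulrC -mulrA.
have gap_pos q : `|q| = `|p| -> 0 < tod q k ->
    0 < tod q k.+1 - tod q k /\ m.+1`!%:R^-1 * `|p| ^+ m <= tod q k.+1 - tod q k.
  move=> qp tq; have h := key _ qp tq; split; last by rewrite ler_pdivrMl.
  by rewrite -(pmulr_rgt0 _ f0); apply: lt_le_trans h.
case: s hk => -[t0 hu].
  have [g1 g2] := gap_pos _ erefl t0; have [h1 _] := hz k.+1.
  have t1E := tE _ erefl k.+1; rewrite /edist.
  have u0 : 0 < u by rewrite -(pmulr_lgt0 _ z0) hu.
  have h3 : tod p k.+1 - tod p k <= tod p k.+1 * (1 - u).
    by rewrite -hu; move: h1 u0; nra.
  have t1 : 0 < tod p k.+1 by move: g1 t0; lra.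
  have d0 : 0 < 1 - u by rewrite -(pmulr_rgt0 _ t1); apply: lt_le_trans h3.
  split=> //; apply: le_trans g2 _; apply: le_trans h3 _; by rewrite ler_pM2r.
have np : `|- p| = `|p| by rewrite normrN.
have [g1 g2] := gap_pos _ np t0; have [_ h1] := hz k.+1.
have t1E := tE _ np k; rewrite /edist.
have h3 : tod (- p) k.+1 - tod (- p) k <= tod (- p) k * (u - 1).
  suff : tod (- p) k.+1 <= u * tod (- p) k by nra.
  by rewrite -(ler_pM2l z0); apply: ltW; apply: lt_le_trans h1 _; rewrite -hu; nra.
have d0 : 0 < u - 1 by rewrite -(pmulr_rgt0 _ t0); apply: lt_le_trans h3.
split=> //; apply: le_trans g2 _; apply: le_trans h3 _; by rewrite ler_pM2r.
Qed.

Lemma tay_inf_step p n : (forall m, m%:R < p) -> 4 * tay p n <= tay p n.+1.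
Proof.
move=> hp; have p1 : 1 < p := hp 1%N; have p0 : 0 < p := hp 0%N.
have h1 : tay p n <= n.+1%:R * p ^+ n.
  have -> : n.+1%:R * p ^+ n = \sum_(i < n.+1) p ^+ n.
    by rewrite sumr_const card_ord mulr_natl.
  apply: ler_sum => i _; apply: (@le_trans _ _ (p ^+ i)).
    by rewrite ler_pdivrMr ?fact_gt0R // ler_peMr ?ler1n ?fact_gt0 // exprn_ge0 // ltW.
  by apply: ler_weXn2l; [exact: ltW|rewrite -ltnS].
have h2 : p ^+ n.+1 / (n.+1`!)%:R <= tay p n.+1.
  by rewrite tayS lerDr; apply: le_trans (tay_ge1 _ (ltW p0)).
apply: le_trans h2; rewrite ler_pdivlMr ?fact_gt0R //.
apply: (@le_trans _ _ (4 * (n.+1%:R * p ^+ n) * (n.+1`!)%:R)).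
  by rewrite ler_pM2r ?fact_gt0R // ler_pM2l.
have -> : 4 * (n.+1%:R * p ^+ n) * (n.+1`!)%:R = (4 * n.+1 * n.+1`!)%:R * p ^+ n.
  by rewrite natrM natrM; ring.
by rewrite exprS ler_pM2r ?exprn_gt0 // ltW.
Qed.

Lemma tod_inf_step p k : (forall m, m%:R < p) -> 4 * tod p k <= tod p k.+1.
Proof.
move=> hp; apply: le_trans (tay_inf_step _ hp) _.
by apply: tay_mono_n; [exact/ltW/(hp 0%N)|lia].
Qed.

(** At a positive infinite argument, the next odd truncation is at least four times larger; options
    therefore miss both z and w z by a factor 4. *)
Lemma inf_gap p z w s u : (forall n, n%:R < `|p|) -> 0 < w ->
  ecut p z -> ecut p (w * z) -> eapp s p z u ->
  if s then [/\ 0 < u, 4 * u < 1 & 4 * u < w] else 4 < u /\ 4 * w < u.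
Proof.
move=> pinf w0 [z0 hz] [wz0 hwz] [k hk]; have [_ hz2] := hz k.+1; have [h1 h2] := hwz k.+1.
have inf q : `|q| = `|p| -> 0 < tod q k -> forall n, n%:R < q.
  move=> qp /tod_gt0_bound bq n.
  have q0 : 0 <= q.
    rewrite leNgt; apply/negP => qn; have h := pinf (k.*2.+1).
    rewrite -qp ltr0_norm // ltrNr in h.
    by have := lt_trans bq h; rewrite ltxx.
  by rewrite -(ger0_norm q0) qp.
case: s hk => -[t0 hu].
  have st := tod_inf_step k (inf _ erefl t0); have [hz1 _] := hz k.+1.
  have u0 : 0 < u by rewrite -(pmulr_lgt0 _ z0) hu.
  rewrite -hu in st; split=> //.
    by rewrite -(ltr_pM2r z0) mul1r -mulrA; apply: le_lt_trans hz1.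
  by rewrite -(ltr_pM2r z0) -mulrA; apply: le_lt_trans h1.
have np : `|- p| = `|p| by rewrite normrN.
have st := tod_inf_step k (inf _ np t0).
have zt0 : 0 < z * tod (- p) k by exact: mulr_gt0.
split; rewrite -(ltr_pM2r zt0).
  rewrite [u * _]mulrA hu; apply: le_lt_trans hz2.
  by rewrite mulrCA ler_pM2l.
rewrite [u * _]mulrA hu; apply: le_lt_trans h2.
have -> : 4 * w * (z * tod (- p) k) = w * z * (4 * tod (- p) k) by ring.
by rewrite ler_pM2l.
Qed.

(** Both z and w z lie between the truncation at p and the inverse of the one at -p, whose ratio is
    closer to 1 than any prescribed power of p. *)
Lemma zeta_small B p z w M n : `|p| <= B%:R -> 0 < w -> ecut p z -> ecut p (w * z) ->
  n%:R * `|w - 1| <= `|p| ^+ M.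
Proof.
move=> pB w0 [z0 hz] [wz0 hwz].
have [N0 hN] := @tail_small K B.*2 0 2.
have [N1 hN1] := @tail_small K B.*2 M (2 * n * 2 ^ M).
have [E [r0 [E0 hE]]] := @tod_lower K B.
pose r := maxn r0 (maxn N0 N1); pose m := r.*2.+1; pose tau := tail (`|p| + `|p|) m.
have b1 : (r0 <= r)%N by rewrite /r; lia.
have b2 : (N0 <= m)%N by rewrite /m /r; lia.
have b3 : (N1 <= m)%N by rewrite /m /r; lia.
have T0 : 0 <= `|p| + `|p| by rewrite addr_ge0.
have TB : `|p| + `|p| <= B.*2%:R by rewrite -addnn natrD lerD.
have h1 : 2 * tau <= 1 by have := hN _ _ b2 T0 TB; rewrite expr0.
have h2 : 2 * n%:R * tau <= `|p| ^+ M.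
  have P2 : 0 < 2 ^+ M :> K by rewrite exprn_gt0.
  have Ep : 2 ^+ M * `|p| ^+ M = (`|p| + `|p|) ^+ M by rewrite -exprMn mulr_natl mulr2n.
  rewrite -(ler_pM2l P2) Ep; apply: le_trans (hN1 _ _ b3 T0 TB).
  have -> : (2 * n * 2 ^ M)%:R = 2 * n%:R * 2 ^+ M :> K by rewrite natrM natrM natrX.
  by apply: eq_ler; rewrite /tau; ring.
have tau0 : 0 <= tau by exact: tail_ge0.
have E0K : 0 < E%:R^-1 :> K by rewrite invr_gt0 ltr0n.
have t0 : 0 < tod p r by apply: lt_le_trans (hE _ _ pB b1).
have t0' : 0 < tod (- p) r by apply: lt_le_trans (hE _ _ _ b1); rewrite ?normrN.
have := tayM_approx p (- p) m; rewrite subrr tay0 normrN ler_norml => /andP[h3 _].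
rewrite -/(tod p r) -/(tod (- p) r) -/tau in h3.
have [z1 z2] := hz r; have [w1 w2] := hwz r.
set t := tod p r in t0 h3 z1 w1; set t' := tod (- p) r in t0' h3 z2 w2.
have h4 : 1 - tau <= t * t' by move: h3; lra.
have h5 : w * (t * t') < 1.
  apply: le_lt_trans w2; rewrite -[w * z * t']mulrA ler_pM2l // ler_pM2r //.
  exact: ltW.
have h6 : t * t' < w.
  have : w * (z * t') < w * 1 by rewrite ltr_pM2l.
  have : t * t' < w * z * t' by rewrite ltr_pM2r.
  by rewrite mulr1 mulrA; exact: lt_trans.
have h7 : `|w - 1| <= 2 * tau.
  rewrite ler_norml; apply/andP; split; first by move: h4 h6 tau0; lra.
  have : w * (1 - tau) < 1 by apply: le_lt_trans h5; rewrite ler_pM2l.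
  by move: h1 tau0 w0; nra.
apply: le_trans h2; rewrite [2 * _]mulrC -mulrA; exact: ler_wpM2l.
Qed.

Lemma finP p : (exists B, `|p| <= B%:R) \/ (forall n, n%:R < `|p|).
Proof.
have [h|h] := pselect (exists B, `|p| <= B%:R); [by left|right=> n].
by rewrite ltNge; apply/negP => hn; apply: h; exists n.
Qed.

(** As 1 - (u + v - u v) = (1 - u) (1 - v), the sign is right for w = 1. If the smaller of p and q
    is finite, w is closer to 1 than this product; if both are infinite, the factors 4 of [inf_gap]
    decide. *)
Lemma hom_sign p q a b w s t u v : p != 0 -> q != 0 -> 0 < w ->
  ecut p a -> ecut p (w * a) -> ecut q b -> ecut q (w * b) ->
  eapp s p a u -> eapp t q b v ->
  if s == t then u + v - u * v < w else w < u + v - u * v.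
Proof.
wlog pq : p q a b s t u v / `|p| <= `|q|.
  move=> H p0 q0 w0 h1 h2 h3 h4 h5 h6.
  have /orP[h|h] := le_total `|p| `|q|; first exact: (H p q a b).
  by rewrite eq_sym [u + v]addrC [u * v]mulrC; apply: (H q p b a).
move=> p0 q0 w0 h1 h2 h3 h4 h5 h6.
suff H : (`|w - 1| < edist s u * edist t v) \/
    (if s == t then u + v - u * v < w else w < u + v - u * v).
  case: H => //; rewrite ltr_norml => /andP[].
  by rewrite /edist; case: (s) (t) => -[] /=; lra.
have [[B pB]|pinf] := finP p; last first.
  right; have qinf n : n%:R < `|q| by exact: lt_le_trans (pinf n) pq.
  have := inf_gap pinf w0 h1 h2 h5; have := inf_gap qinf w0 h3 h4 h6.
  by case: (s) (t) => -[] /=; [case=> ? ? ? [? ? ?]|case=> ? ? [? ? ?]|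
    case=> ? ? ? [? ?]|case=> ? ? [? ?]]; nra.
left; have [m [n [d0 dn]]] := fin_gap pB p0 h1 h5.
have pp M : 0 < `|p| ^+ M by rewrite exprn_gt0 // normr_gt0.
have n0 : 0 < n%:R :> K by rewrite -(pmulr_lgt0 _ d0); exact: lt_le_trans (pp m) dn.
have [[B' qB]|qinf] := finP q; last first.
  have e : 1 / 2 < edist t v.
    have := inf_gap qinf w0 h3 h4 h6.
    by rewrite /edist; case: (t); [case=> ? ? ?|case=> ? ?]; lra.
  have := zeta_small m (4 * n) pB w0 h1 h2; rewrite natrM => h.
  have {h} : n%:R * (4 * `|w - 1|) <= n%:R * edist s u.
    by apply: le_trans dn; apply: le_trans h; rewrite mulrA [n%:R * 4]mulrC.
  by rewrite ler_pM2l //; move: e d0; nra.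
have [m' [n' [d0' dn']]] := fin_gap qB q0 h3 h6.
have n0' : 0 < n'%:R :> K.
  rewrite -(pmulr_lgt0 _ d0'); apply: lt_le_trans dn'.
  by rewrite exprn_gt0 // normr_gt0.
have := zeta_small (m + m') (2 * (n * n')) pB w0 h1 h2; rewrite !natrM => h.
have {h} : n%:R * n'%:R * (2 * `|w - 1|) <= n%:R * n'%:R * (edist s u * edist t v).
  apply: (@le_trans _ _ (`|p| ^+ (m + m'))).
    by apply: le_trans h; apply: eq_ler; ring.
  have -> : n%:R * n'%:R * (edist s u * edist t v) =
     (n%:R * edist s u) * (n'%:R * edist t v) by ring.
  rewrite exprD; apply: ler_pM => //; do ?exact: ltW.
  by apply: le_trans dn'; apply: lerXn2r; rewrite ?nnegrE.
rewrite ler_pM2l ?mulr_gt0 //.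
have : 0 < edist s u * edist t v by rewrite mulr_gt0.
by have := normr_ge0 (w - 1); lra.
Qed.

End HomEstimates.

Lemma ecut_Exp a b : a != b -> ecut (a - b) (Exp a / Exp b).
Proof.
move=> ab; have a0 := Exp_gt0 a; have b0 := Exp_gt0 b.
split=> [|r]; first exact: divr_gt0.
rewrite opprB ltr_pdivlMr // mulrAC ltr_pdivrMr // mul1r mulrC.
by split; apply: Exp_cut; rewrite // eq_sym.
Qed.

(* [exp_opt s a A b]: [A] is bounded by an option of [exp a] coming from [b]. *)
Definition exp_opt (s : bool) (a A b : No) := a != b /\ exists k,
  if s then [/\ 0 < tod (a - b) k, 0 <= A & A <= Exp b * tod (a - b) k]
  else 0 < tod (b - a) k /\ Exp b / tod (b - a) k <= A.

Lemma exp_optP s x c : surreal x -> Op s (gexp x) c -> s && (cl c == 0) \/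
  exists t o, Op t x o /\ exp_opt s (cl x) (cl c) (cl o).
Proof.
move=> sx; have so t o : Op t x o -> surreal (gexp o).
  by move=> oo; apply/surreal_exp/(surreal_opt sx oo).
have E t o : Op t x o -> ex o = Exp (cl o).
  by move=> oo; apply/Exp_cl/(surreal_opt sx oo).
case: s => oc.
  have [_ [->|[t [ o [r [oo h1 h2 h3]]]]]] := gexp_left sx so oc; first by left; rewrite eqxx.
  right; exists t, o; split=> //; split; first by rewrite -subr_eq0; exact: cl_opt_neq oo.
  by exists r; split=> //; rewrite -(E _ _ oo).
have [_ [t [ o [r [oo h1 h2]]]]] := gexp_right sx so oc.
right; exists t, o; split=> //; split; first by rewrite -subr_eq0; exact: cl_opt_neq oo.
by exists r; split=> //; rewrite -(E _ _ oo).
Qed.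

Lemma exp_opt_bound s a A b : exp_opt s a A b -> if s then A < Exp a else Exp a < A.
Proof.
case=> ab [k]; case: s => [[h1 h2 h3]|[h1 h3]].
  by apply: le_lt_trans h3 _; apply: Exp_cut; rewrite eq_sym.
by apply: lt_le_trans h3; rewrite ltr_pdivlMr //; apply: Exp_cut.
Qed.

(** Handles the options of exp x exp y in which one of the two factors contributes the option 0. *)
Lemma exp_opt_shift s a A b c : exp_opt s a A b -> Exp (b + c) = Exp b * Exp c ->
  if s then A * Exp c < Exp (a + c) else Exp (a + c) < A * Exp c.
Proof.
move=> [ab [k hk]] E; have c0 := Exp_gt0 c; have b0 := Exp_gt0 b.
have bc : b + c != a + c by rewrite (inj_eq (addIr c)) eq_sym.
have h1 := Exp_cut k bc; have h2 := Exp_cut k (_ : a + c != b + c).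
rewrite eq_sym in h2; have {}h2 := h2 bc.
have E1 : a + c - (b + c) = a - b by ring.
have E2 : b + c - (a + c) = b - a by ring.
rewrite E1 E in h1; rewrite E2 E in h2.
case: s hk => [[p1 p2 p3]|[p1 p3]].
  by apply: le_lt_trans h1; rewrite mulrAC ler_pM2r.
apply: (@lt_le_trans _ _ (Exp b / tod (b - a) k * Exp c)); last by rewrite ler_pM2r.
by rewrite mulrAC ltr_pdivlMr.
Qed.

(** Divide by exp a exp b and put w = exp (a + b) / (exp a exp b). The inductive identity turns w
    exp a / exp o into exp (a + b) / exp (o + b), which satisfies the cut at a - o; similarly for b.
    Then [hom_sign] applies. *)
Lemma exp_opt_mul s t a b A B o o' : exp_opt s a A o -> exp_opt t b B o' ->
  Exp (o + b) = Exp o * Exp b -> Exp (a + o') = Exp a * Exp o' ->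
  if s == t then A * Exp b + Exp a * B - A * B < Exp (a + b)
  else Exp (a + b) < A * Exp b + Exp a * B - A * B.
Proof.
move=> HA HB E1 E2; set v := _ - _.
have X0 := Exp_gt0 a; have Y0 := Exp_gt0 b; have S0 := Exp_gt0 (a + b).
have o0 := Exp_gt0 o; have o0' := Exp_gt0 o'.
set X := Exp a in X0 E2 v *; set Y := Exp b in Y0 E1 v *.
set S := Exp (a + b) in S0 *.
pose w := S / (X * Y); have w0 : 0 < w by rewrite divr_gt0 // mulr_gt0.
have [ao [k hk]] := HA; have [bo [l hl]] := HB.
(* [A] and [B] are merely bounded by options; [A'] and [B'] are those options, and replacing one by
   the other moves the term in the harmless direction. *)
pose A' := if s then Exp o * tod (a - o) k else Exp o / tod (o - a) k.
pose B' := if t then Exp o' * tod (b - o') l else Exp o' / tod (o' - b) l.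
have Xn := lt0r_neq0 X0; have Yn := lt0r_neq0 Y0.
have on := lt0r_neq0 o0; have on' := lt0r_neq0 o0'.
have cX : ecut (a - o) (w * (X / Exp o)).
  have := @ecut_Exp (a + b) (o + b); rewrite (inj_eq (addIr b)) => /(_ ao).
  have -> : a + b - (o + b) = a - o by ring.
  rewrite E1 -/S; have -> // : w * (X / Exp o) = S / (Exp o * Y).
  by rewrite /w; field; rewrite Xn Yn on.
have cY : ecut (b - o') (w * (Y / Exp o')).
  have := @ecut_Exp (a + b) (a + o'); rewrite (inj_eq (addrI a)) => /(_ bo).
  have -> : a + b - (a + o') = b - o' by ring.
  rewrite E2 -/S; have -> // : w * (Y / Exp o') = S / (X * Exp o').
  by rewrite /w; field; rewrite Xn Yn on'.
have eX : eapp s (a - o) (X / Exp o) (A' / X).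
  exists k; rewrite /A' opprB; case: (s) hk => -[h1 h2]; split=> //.
    by field; rewrite Xn on.
  by field; rewrite Xn on gt_eqF.
have eY : eapp t (b - o') (Y / Exp o') (B' / Y).
  exists l; rewrite /B' opprB; case: (t) hl => -[h1 h2]; split=> //.
    by field; rewrite Yn on'.
  by field; rewrite Yn on' gt_eqF.
have ao0 : a - o != 0 by rewrite subr_eq0.
have bo0 : b - o' != 0 by rewrite subr_eq0.
have := hom_sign ao0 bo0 w0 (ecut_Exp ao) cX (ecut_Exp bo) cY eX eY.
have Ew : X * Y * w = S by rewrite /w; field; rewrite Xn Yn.
have XY0 : 0 < X * Y by rewrite mulr_gt0.
have Ev : X * Y * (A' / X + B' / Y - A' / X * (B' / Y)) = A' * Y + X * B' - A' * B'.
  by field; rewrite Xn Yn.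
have {HA} HA := exp_opt_bound HA; have {HB} HB := exp_opt_bound HB.
have HA' : if s then A <= A' /\ A' < X else A' <= A /\ X < A'.
  rewrite /A'; case: (s) hk => [[h1 h2 h3]|[h1 h2]]; split=> //.
    by apply: Exp_cut; rewrite eq_sym.
  by rewrite ltr_pdivlMr //; exact: Exp_cut.
have HB' : if t then B <= B' /\ B' < Y else B' <= B /\ Y < B'.
  rewrite /B'; case: (t) hl => [[h1 h2 h3]|[h1 h2]]; split=> //.
    by apply: Exp_cut; rewrite eq_sym.
  by rewrite ltr_pdivlMr //; exact: Exp_cut.
case: eqP => st.
  rewrite -(ltr_pM2l XY0) Ev Ew; apply: le_lt_trans; rewrite /v.
  move: HA HB HA' HB'; rewrite -st; case: (s) => HA HB [h1 h2] [h3 h4].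
    by rewrite -/X -/Y in HA HB; nra.
  by rewrite -/X -/Y in HA HB; nra.
rewrite -(ltr_pM2l XY0) Ev Ew => /lt_le_trans; apply; rewrite /v.
move: HA HB HA' HB'; case: (s) (t) st => -[] // _ HA HB [h1 h2] [h3 h4].
  by rewrite -/X -/Y in HA HB; nra.
by rewrite -/X -/Y in HA HB; nra.
Qed.

(** By simplicity, it suffices that each option of either side is on the proper side of the other
    value. Options of exp (x + y) reduce to Gonshor's inequalities for x or y, those of the product
    to [exp_opt_mul]. *)
Lemma Exp_add_cl x y : surreal x -> surreal y ->
  Exp (cl x + cl y) = Exp (cl x) * Exp (cl y).
Proof.
elim/game_opt_ind: x y => x IHx y; elim/game_opt_ind: y => y IHy sx sy.
have {IHx} IHx s o z : Op s x o -> surreal z -> Exp (cl o + cl z) = Exp (cl o) * Exp (cl z).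
  by move=> oo sz; apply: IHx oo _ (surreal_opt sx oo) sz.
have {IHy} IHy s o : Op s y o -> Exp (cl x + cl o) = Exp (cl x) * Exp (cl o).
  by move=> oo; apply: IHy oo sx (surreal_opt sy oo).
have sxy := surreal_add sx sy.
have ux := surreal_exp sx; have uy := surreal_exp sy; have uxy := surreal_exp sxy.
have X0 := Exp_gt0 (cl x); have Y0 := Exp_gt0 (cl y); have S0 := Exp_gt0 (cl x + cl y).
rewrite -clD // -!Exp_cl // -clM //.
have ES : cl (gexp (gadd x y)) = Exp (cl x + cl y) by rewrite Exp_cl ?clD.
have EM : cl (gmul (gexp x) (gexp y)) = Exp (cl x) * Exp (cl y) by rewrite clM ?Exp_cl.
have optS s c : Op s (gexp (gadd x y)) c ->
    if s then cl c < Exp (cl x) * Exp (cl y) else Exp (cl x) * Exp (cl y) < cl c.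
  case/(exp_optP sxy) => [/andP[-> /eqP ->]|[t [ o [/gadd_opt oo [no [k hk]]]]]].
    by rewrite mulr_gt0.
  suff H : Exp (cl o) * tod (cl x + cl y - cl o) k < Exp (cl x) * Exp (cl y) /\
      Exp (cl x) * Exp (cl y) * tod (cl o - (cl x + cl y)) k < Exp (cl o).
    rewrite clD // in hk; case: s hk => [[h1 h2 h3]|[h1 h3]].
      by apply: le_lt_trans h3 _; case: H.
    by apply: lt_le_trans h3; rewrite ltr_pdivlMr //; case: H.
  case: oo => [[z oz Eo]|[z oz Eo]].
    have sz := surreal_opt sx oz; rewrite Eo clD // (IHx _ _ _ oz sy).
    have -> : cl x + cl y - (cl z + cl y) = cl x - cl z by ring.
    have -> : cl z + cl y - (cl x + cl y) = cl z - cl x by ring.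
    have ne : cl z != cl x by rewrite eq_sym -subr_eq0; exact: cl_opt_neq oz.
    rewrite !(mulrAC _ (Exp (cl y))) !ltr_pM2r //.
    by split; apply: Exp_cut; rewrite // eq_sym.
  have sz := surreal_opt sy oz; rewrite Eo clD // (IHy _ _ oz).
  have -> : cl x + cl y - (cl x + cl z) = cl y - cl z by ring.
  have -> : cl x + cl z - (cl x + cl y) = cl z - cl y by ring.
  have ne : cl z != cl y by rewrite eq_sym -subr_eq0; exact: cl_opt_neq oz.
  rewrite -!mulrA !ltr_pM2l //.
  by split; apply: Exp_cut; rewrite // eq_sym.
have optM s c : Op s (gmul (gexp x) (gexp y)) c ->
    if s then cl c < Exp (cl x + cl y) else Exp (cl x + cl y) < cl c.
  case/gmul_opt=> [t [A [B [oA oB ->]]]].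
  have sA := surreal_opt ux oA; have sB := surreal_opt uy oB.
  rewrite cl_mul_term // !Exp_cl //.
  have hB0 z u : Op u y z -> exp_opt (s == t) (cl y) (cl B) (cl z) -> 
      if s == t then Exp (cl x) * cl B < Exp (cl x + cl y)
      else Exp (cl x + cl y) < Exp (cl x) * cl B.
    move=> oz hz; rewrite [Exp _ * _]mulrC [cl x + _]addrC.
    apply: (exp_opt_shift hz); rewrite addrC (IHy _ _ oz); exact: mulrC.
  case: (exp_optP sx oA) => [/andP[tt /eqP A0]|[t1 [z [oz hA]]]].
    rewrite A0 !mul0r add0r subr0; rewrite tt in oB hB0.
    case: (exp_optP sy oB) => [/andP[ss /eqP ->]|[u [z [oz hz]]]].
      by move: ss; rewrite mulr0; case: (s).
    by have := hB0 _ _ oz hz; case: (s).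
  case: (exp_optP sy oB) => [/andP[st /eqP B0]|[u [z' [oz' hB]]]].
    rewrite B0 !mulr0 subr0 addr0; rewrite (eqP st) in hA *.
    move: st => /eqP st.
    have sz := surreal_opt sx oz.
    have := exp_opt_shift hA (IHx _ _ _ oz sy); by case: (t).
  have := exp_opt_mul hA hB (IHx _ _ _ oz sy) (IHy _ _ oz').
  by case: (s) (t) => -[].
apply: cl_simplest => //; do ?exact: surreal_mul.
- by move=> b /optS; rewrite EM.
- by move=> b /optS; rewrite EM.
- by move=> b /optM; rewrite ES.
- by move=> b /optM; rewrite ES.
Qed.

Lemma ExpD a b : Exp (a + b) = Exp a * Exp b.
Proof.
by rewrite -[a]cl_rep -[b]cl_rep Exp_add_cl //; exact: surreal_rep.
Qed.

Lemma Exp_ge1D a : 1 + a <= Exp a.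
Proof.
have [->|a0] := eqVneq a 0; first by rewrite Exp0 addr0.
have := @Exp_cut 0 a 0; rewrite eq_sym => /(_ a0).
by rewrite Exp0 mul1r subr0 [tod a 0]tay_1n => /ltW.
Qed.

Lemma ExpN a : Exp (- a) = (Exp a)^-1.
Proof.
apply: (@mulfI _ (Exp a)); first by rewrite gt_eqF // Exp_gt0.
by rewrite -ExpD subrr Exp0 mulfV // gt_eqF // Exp_gt0.
Qed.

Lemma tod_lt_Exp a r : a != 0 -> tod a r < Exp a.
Proof.
move=> a0; have := @Exp_cut 0 a r; rewrite eq_sym => /(_ a0).
by rewrite Exp0 mul1r subr0.
Qed.

(** * Existence of logarithms *)

Lemma Exp_lt a b : (Exp a < Exp b) = (a < b).
Proof.
have lt c d : c < d -> Exp c < Exp d.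
  move=> cd; have -> : d = c + (d - c) by ring.
  rewrite ExpD ltr_pMr ?Exp_gt0 //; apply: lt_le_trans (Exp_ge1D _).
  by rewrite ltrDl subr_gt0.
have [ab|ba|->] := ltgtP a b; last by rewrite ltxx.
  by rewrite lt.
by apply/negbTE; rewrite -leNgt ltW // lt.
Qed.

Lemma Exp_le a b : (Exp a <= Exp b) = (a <= b).
Proof. by rewrite leNgt Exp_lt -leNgt. Qed.

Lemma Exp_inj : injective Exp.
Proof. by move=> a b E; apply/eqP; rewrite eq_le -(Exp_le a b) -(Exp_le b a) E lexx. Qed.

(** Invert 1 - d <= exp (-d). *)
Lemma Exp_quad d : `|d| <= 1 / 2 -> Exp d <= 1 + d + 2 * d ^+ 2.
Proof.
rewrite ler_norml => /andP[d1 d2].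
have h : 1 - d <= (Exp d)^-1 by rewrite -ExpN; exact: Exp_ge1D.
have e0 := Exp_gt0 d.
have {h} h : (1 - d) * Exp d <= 1 by rewrite -ler_pdivlMr // mul1r.
by rewrite expr2; nra.
Qed.

Definition tiny (t : No) := forall n, n%:R * `|t| < 1.

Lemma tiny_le s t : `|s| <= `|t| -> tiny t -> tiny s.
Proof. by move=> st ht n; apply: le_lt_trans (ht n); apply: ler_wpM2l. Qed.

Lemma tiny_leM s t n : `|s| <= n%:R * `|t| -> tiny t -> tiny s.
Proof.
move=> st ht m; apply: le_lt_trans (ht (m * n)%N).
by rewrite natrM -mulrA; apply: ler_wpM2l.
Qed.

Lemma tinyD s t : tiny s -> tiny t -> tiny (s + t).
Proof.
move=> hs ht n; have := hs (2 * n)%N; have := ht (2 * n)%N; rewrite natrM => h1 h2.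
have h3 : n%:R * `|s + t| <= n%:R * (`|s| + `|t|) by apply: ler_wpM2l => //; exact: ler_normD.
apply: le_lt_trans h3 _; move: h1 h2; rewrite -!mulrA mulrDr.
by move: (n%:R * `|s|) (n%:R * `|t|) => X Y; lra.
Qed.

Lemma tinyN t : tiny t -> tiny (- t).
Proof. by apply: tiny_le; rewrite normrN. Qed.

Lemma tiny_lt t n : tiny t -> (0 < n)%N -> `|t| < n%:R^-1.
Proof.
by move=> ht n0; rewrite -[ltRHS]mul1r ltr_pdivlMr ?ltr0n // mulrC.
Qed.

(** Newton's iteration for exp u = z. Its iterates stay in every ring that contains z and is closed
    under the exponential. *)
Fixpoint newton (z : No) (j : nat) : No :=
  if j is j'.+1 then newton z j' - 1 + z * Exp (- newton z j') else z - 1.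

(** The residual stays nonnegative because exp d >= 1 + d. Each step squares it up to a factor 4;
    gaining one power of t per step is all that is recorded. *)
Lemma newton_err (t : No) j : tiny t -> t != 0 ->
  0 <= Exp (newton (1 + t) j) - (1 + t) <= 2 * `|t| ^+ j.+2.
Proof.
move=> ht t0; have t8 := tiny_lt ht (isT : (0 < 16)%N).
have tp : 0 < `|t| by rewrite normr_gt0.
elim: j => [|j IH].
  have E : newton (1 + t) 0 = t by rewrite /=; ring.
  rewrite E subr_ge0 Exp_ge1D /= lerBlDr addrC.
  have -> : `|t| ^+ 2 = t ^+ 2 by rewrite -normrX ger0_norm // sqr_ge0.
  by apply: Exp_quad; move: t8; lra.
set u := newton _ j in IH *; set z := 1 + t in IH *.
have -> : newton z j.+1 = u + (z * Exp (- u) - 1) by rewrite /= -/u; ring.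
set e := Exp u - z in IH; set d := z * Exp (- u) - 1.
have e0 := Exp_gt0 u; have z2 : 1 / 2 < z.
  by rewrite /z; move: t8; rewrite ltr_norml => /andP[]; lra.
case/andP: IH => h1 h2.
have Ed : d * Exp u = - e by rewrite /d /e ExpN; field; rewrite gt_eqF.
have tj : `|t| ^+ j.+2 <= `|t| / 16.
  rewrite exprS ler_pM2l // exprS; apply: (@le_trans _ _ `|t|); last by move: t8; lra.
  by rewrite ler_piMr //; apply: exprn_ile1 => //; move: t8; lra.
have e1 : 1 / 2 < Exp u by move: h1; rewrite /e; lra.
have dn : `|d| <= 1 / 2.
  have : `|d| * Exp u = e by rewrite -(ger0_norm (ltW e0)) -normrM Ed normrN ger0_norm.
  have := normr_ge0 d; move: h2 tj t8; rewrite /e; nra.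
rewrite ExpD; apply/andP; split.
  have : Exp u * (1 + d) <= Exp u * Exp d by rewrite ler_pM2l // Exp_ge1D.
  by rewrite mulrDr mulr1 [Exp u * d]mulrC Ed /e; lra.
have h3 : Exp u * Exp d <= Exp u * (1 + d + 2 * d ^+ 2) by rewrite ler_pM2l // Exp_quad.
have h4 : Exp u * (1 + d + 2 * d ^+ 2) - z = 2 * (d * Exp u) * d.
  have -> : Exp u * (1 + d + 2 * d ^+ 2) - z = Exp u + d * Exp u - z + 2 * (d * Exp u) * d by ring.
  by rewrite Ed /e; ring.
have h5 : 2 * (d * Exp u) * d <= 4 * e ^+ 2.
  rewrite Ed; have Ed' : - d = e / Exp u by rewrite -[e]opprK -Ed; field; rewrite gt_eqF.
  have -> : 2 * - e * d = 2 * e * (e / Exp u) by rewrite -Ed'; ring.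
  have : e / Exp u <= 2 * e by rewrite ler_pdivrMr //; nra.
  by rewrite expr2; nra.
apply: (@le_trans _ _ (4 * e ^+ 2)); first by move: h3 h4 h5; lra.
have h6 : e ^+ 2 <= (2 * `|t| ^+ j.+2) ^+ 2.
  by apply: lerXn2r => //; rewrite nnegrE // mulr_ge0 // exprn_ge0.
have -> : 2 * `|t| ^+ j.+3 = 2 * `|t| * `|t| ^+ j.+2 by rewrite [`|t| ^+ j.+3]exprS mulrA.
have p0 : 0 <= `|t| ^+ j.+2 by exact: exprn_ge0.
apply: (@le_trans _ _ (16 * `|t| ^+ j.+2 * `|t| ^+ j.+2)).
  by move: h6; rewrite !expr2; lra.
by rewrite ler_wpM2r //; move: tj; lra.
Qed.

Lemma newton_bounds (t : No) j : tiny t -> t != 0 ->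
  let u := newton (1 + t) j in `|t| <= 2 * `|u| /\ `|u| <= 2 * `|t|.
Proof.
move=> ht t0 u; have t8 := tiny_lt ht (isT : (0 < 16)%N).
have tp : 0 < `|t| by rewrite normr_gt0.
have /andP[] := newton_err j ht t0; rewrite -/u; set e := Exp u - _ => h1 h2.
have tj : `|t| ^+ j.+2 <= `|t| / 16.
  rewrite exprS ler_pM2l // exprS; apply: (@le_trans _ _ `|t|); last by move: t8; lra.
  by rewrite ler_piMr //; apply: exprn_ile1 => //; move: t8; lra.
have h3 := Exp_ge1D u; have h4 := Exp_ge1D (- u); rewrite ExpN in h4.
have e0 := Exp_gt0 u.
have h5 : (1 - u) * Exp u <= 1 by rewrite -ler_pdivlMr // mul1r.
have Ee : Exp u = 1 + t + e by rewrite /e; ring.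
rewrite Ee in h3 h5 e0.
have [tpos|tneg] := ltrP 0 t.
  rewrite gtr0_norm // in h2 tj t8 *.
  have u0 : 0 <= u by nra.
  by rewrite ger0_norm //; split; nra.
have {}tneg : t < 0 by rewrite lt_neqAle t0.
rewrite ltr0_norm // in h2 tj t8 *.
have u0 : u < 0 by lra.
by rewrite ltr0_norm //; split; nra.
Qed.

(** After 2k+1 steps the residual is at most 2 |t|^(2k+3), while the gap between truncations k and
    k+1 is of order u^(2k+2); as |t| <= 2 |u| and t is infinitesimal, the gap wins. *)
Lemma newton_tod (t : No) k : tiny t -> t != 0 ->
  tod (newton (1 + t) k.*2.+1) k <= 1 + t.
Proof.
move=> ht t0; have [b1 b2] := newton_bounds k.*2.+1 ht t0.
have /andP[_ h2] := newton_err k.*2.+1 ht t0.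
set u := newton _ _ in b1 b2 h2 *.
have tp : 0 < `|t| by rewrite normr_gt0.
have t8 := tiny_lt ht (isT : (0 < 16)%N).
have u1 : `|u| <= 1 by move: b2 t8; lra.
have u0 : u != 0 by rewrite -normr_gt0; move: b1 tp; lra.
have lb : - (k.*2.+1)%:R <= u.
  apply: (@le_trans _ _ (-1)); first by rewrite lerN2 ler1n.
  by move: u1; rewrite ler_norml => /andP[].
have g := tod_gapS lb; have lt := tod_lt_Exp k.+1 u0.
pose m := k.+1.*2; rewrite -/m in g.
suff : `|t| ^+ k.*2.+3 <= m.+1`!%:R^-1 * u ^+ m.
  move: h2 g lt; rewrite -[2 / _ * _]mulrA; set X := _^-1 * _; set Y := _ ^+ _.+3.
  by move: (tod u k) (tod u k.+1) (Exp u) => *; lra.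
have um : u ^+ m = `|u| ^+ m by rewrite -normrX ger0_norm // even_expr_ge0.
rewrite ler_pdivlMl ?fact_gt0R // um.
have P2 : 0 < 2 ^+ m :> No by rewrite exprn_gt0.
rewrite -(ler_pM2l P2) -exprMn.
apply: (@le_trans _ _ (`|t| ^+ m)); last first.
  by apply: lerXn2r; rewrite ?nnegrE ?mulr_ge0.
have -> : k.*2.+3 = m.+1 by rewrite /m doubleS.
have -> : 2 ^+ m * (m.+1`!%:R * `|t| ^+ m.+1) = (2 ^ m * m.+1`!)%:R * `|t| * `|t| ^+ m.
  by rewrite natrM natrX exprS; ring.
by rewrite ler_piMl ?exprn_ge0 //; apply/ltW/ht.
Qed.

(* The logarithm of y is cut out of the ring closed under exp that is         *)
(* generated by y, 1/y and the logarithms of the options of y; Newton         *)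
(* approximations supply the elements beating each Taylor bound.              *)
Lemma log_near1 (c : No) : tiny (c - 1) -> exists a, Exp a = c.
Proof.
suff H : tiny (c - 1) -> exists2 a, tiny a & Exp a = c by move/H => [a _]; exists a.
have [y sy <-] := clP c; elim/game_opt_ind: y sy => y IH sy ty.
set c' := cl y in ty *.
have t8 := tiny_lt ty (isT : (0 < 4)%N).
have c0 : 1 / 2 < c' by move: t8; rewrite ltr_norml => /andP[]; lra.
have c0p : 0 < c' by lra.
pose X := ((lindex y + rindex y) + bool)%type.
pose op (k : lindex y + rindex y) : game :=
  match k with inl i => @lopt y i | inr j => @ropt y j end.
have op_opt k : exists s, Op s y (op k).
  by case: k => i; [exists true|exists false]; exists i.
have logs k : exists2 z, surreal z & (tiny (cl (op k) - 1) ->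
    tiny (cl z) /\ Exp (cl z) = cl (op k)).
  have [h|h] := pselect (tiny (cl (op k) - 1)); last first.
    by exists gzero => //; exact: surreal_zero.
  have [s os] := op_opt k.
  have [a ta Ea] := IH _ _ os (surreal_opt sy os) h.
  by exists (No_rep a); [exact: surreal_rep|rewrite cl_rep].
pose w (x : X) : game := match x with
  | inl k => s2val (cid2 (logs k)) | inr true => y | inr false => No_rep c'^-1 end.
have sw x : surreal (w x).
  case: x => [k|[]] //=; [by case: cid2|exact: surreal_rep].
pose v := reval gexp w.
have sv t : surreal (v t) by apply: surreal_reval => //; exact: surreal_exp.
pose P a := exists t, cl (v t) = a.
have P1 : P 1 by exists TOne; exact: cl1.
have PD a b : P a -> P b -> P (a + b).
  by move=> [s <-] [t <-]; exists (TAdd s t); rewrite -clD.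
have PN a : P a -> P (- a) by move=> [s <-]; exists (TOpp s); rewrite -clN.
have PM a b : P a -> P b -> P (a * b).
  by move=> [s <-] [t <-]; exists (TMul s t); rewrite -clM.
have PE a : P a -> P (Exp a) by move=> [s <-]; exists (TFun s); rewrite -Exp_cl.
have Pc : P c' by exists (TVar (inr true)).
have Pci : P c'^-1 by exists (TVar (inr false)); exact: cl_rep.
have PB a b : P a -> P b -> P (a - b) by move=> ? ?; apply: PD => //; exact: PN.
have Pn z j : P z -> P (newton z j).
  move=> Pz; elim: j => [|j IHj] /=; first exact: PB.
  by apply: PD; [exact: PB|apply: PM => //; apply/PE/PN].
(* If the ring already contains an infinitesimal logarithm, nothing is left to construct. Otherwise
   every infinitesimal element falls strictly on one side of the cut. *)
have [[a [Pa ta Ea]]|noex] := pselect (exists a, [/\ P a, tiny a & Exp a = c']).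
  by exists a.
have ne a : P a -> tiny a -> Exp a != c'.
  by move=> Pa ta; apply/eqP => Ea; apply: noex; exists a.
pose x := gcut v (fun t => tiny (cl (v t)) /\ Exp (cl (v t)) < c')
                 (fun t => tiny (cl (v t)) /\ c' < Exp (cl (v t))).
have sx : surreal x.
  apply: surreal_gcut => // s t [_ h1] [_ h2].
  by rewrite -[No_lt _ _]/(cl (v s) < cl (v t)) -Exp_lt; exact: lt_trans h2.
have xl a : P a -> tiny a -> Exp a < c' -> a < cl x.
  move=> [t <-] ta h; apply: (@cl_opt true) => //; apply/gcut_opt; by exists t.
have xr a : P a -> tiny a -> c' < Exp a -> cl x < a.
  move=> [t <-] ta h; apply: (@cl_opt false) => //; apply/gcut_opt; by exists t.
(* The elementary bounds 1 - 1/c <= log c <= c - 1 enclose the cut and make it infinitesimal. *)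
pose l := 1 - c'^-1; pose u := c' - 1.
have Pl : P l by exact: PB.
have Pu : P u by exact: PB.
have tl : tiny l.
  apply: (@tiny_leM _ (c' - 1) 2) => //.
  have -> : l = c'^-1 * (c' - 1) by rewrite /l; field; rewrite gt_eqF.
  rewrite normrM ler_wpM2r // gtr0_norm ?invr_gt0 // -[leLHS]mul1r ler_pdivrMr //; lra.
have lx : l < cl x.
  apply: xl => //; rewrite lt_neqAle ne //=.
  have := Exp_ge1D (- l); rewrite ExpN => h.
  have E1 : c' * (1 - l) = 1 by rewrite /l; field; rewrite gt_eqF.
  have l1 : 0 < 1 - l by rewrite -(pmulr_rgt0 _ c0p) E1.
  by rewrite -(ler_pM2r l1) E1 mulrC -ler_pdivlMr ?Exp_gt0 // mul1r.
have xu : cl x < u.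
  apply: xr => //; rewrite lt_neqAle eq_sym ne //=.
  by apply: le_trans (Exp_ge1D _); rewrite /u; lra.
have tx : tiny (cl x).
  move=> n; have := ty n; have := tl n; rewrite -/u.
  have n0 : 0 <= n%:R :> No by rewrite ler0n.
  have [xn|xn] := ltrP (cl x) 0.
    move=> h _; apply: le_lt_trans h; apply: ler_wpM2l => //.
    have l0 : l < 0 := lt_trans lx xn.
    by rewrite (ltr0_norm xn) (ltr0_norm l0) lerN2 ltW.
  move=> _; apply: le_lt_trans; apply: ler_wpM2l => //.
  have u0 : 0 <= u := le_trans xn (ltW xu).
  by rewrite (ger0_norm xn) (ger0_norm u0) ltW.
have optx s o : Op s x o -> [/\ P (cl o), tiny (cl o) & Exp (cl o) != c'].
  move/gcut_opt => [t ht ->]; have tt : tiny (cl (v t)) by case: s ht => -[].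
  have Pt : P (cl (v t)) by exists t.
  by split=> //; exact: ne.
(* For z = c / exp o, an element u with [tod u k <= z < Exp u]. *)
have approx z k : P z -> tiny (z - 1) -> z != 1 ->
    exists u', [/\ P u', tiny u', tod u' k <= z & z <= Exp u'].
  move=> Pz tz z1; exists (newton z k.*2.+1).
  have z0 : z - 1 != 0 by rewrite subr_eq0.
  have Ez : z = 1 + (z - 1) by ring.
  split; first exact: Pn.
  - apply: (@tiny_leM _ (z - 1) 2) => //; rewrite Ez.
    by have [_] := newton_bounds k.*2.+1 tz z0; have -> : 1 + (z - 1) - 1 = z - 1 by ring.
  - by rewrite {1 2}Ez; exact: newton_tod.
  - have /andP[+ _] := newton_err k.*2.+1 tz z0.
    by rewrite subr_ge0 -Ez.
have Et a : tiny a -> tiny (Exp a - 1).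
  move=> ta; have a4 := tiny_lt ta (isT : (0 < 4)%N).
  apply: (@tiny_leM _ a 2) => //.
  have h1 := Exp_ge1D a; have h2 : Exp a <= 1 + a + 2 * a ^+ 2 by apply: Exp_quad; move: a4; lra.
  have h3 : a ^+ 2 = `|a| ^+ 2 by rewrite -normrX ger0_norm // sqr_ge0.
  rewrite h3 in h2; have h4 : `|a| ^+ 2 <= `|a| / 4.
    by rewrite expr2 ler_wpM2l //; move: a4; lra.
  have /andP[h5 h6] : - `|a| <= a <= `|a| by rewrite -ler_norml.
  by rewrite ler_norml; apply/andP; split; lra.
have div_tiny a b : 1 / 2 < b -> tiny (a - 1) -> tiny (b - 1) -> tiny (a / b - 1).
  move=> b2 ha hb; have b0 : 0 < b by lra.
  apply: (@tiny_leM _ (a - b) 2).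
    have -> : a / b - 1 = b^-1 * (a - b) by field; rewrite gt_eqF.
    rewrite normrM ler_wpM2r // gtr0_norm ?invr_gt0 // -[leLHS]mul1r ler_pdivrMr //; lra.
  have -> : a - b = (a - 1) - (b - 1) by ring.
  by apply: tinyD => //; exact: tinyN.
have half a : tiny a -> 1 / 2 < Exp a.
  move=> /Et/tiny_lt/(_ (isT : (0 < 2)%N)); rewrite ltr_norml => /andP[h _].
  by move: h; rewrite mul1r; lra.
have key o k z : P o -> tiny o -> P z -> tiny (z - 1) -> z != 1 ->
    forall d, tiny d -> 0 < tod d k ->
    (forall u', P u' -> tiny u' -> z <= Exp u' -> d < u') -> tod d k < z.
  move=> Po to Pz tz z1 d td d0 H.
  (* As d < u', multiplying the truncation at d by the one at u' - d > 0 enlarges it strictly, and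
     the product is at most a truncation at u', hence at most z. *)
  have [s0 hs] := @tod_mul_fin No 1 k.
  have [u' [Pu' tu' h1 h2]] := approx z s0 Pz tz z1.
  have du := H _ Pu' tu' h2.
  apply: lt_le_trans h1.
  have e0 : 0 < u' - d by rewrite subr_gt0.
  have e1 := tay_strict e0 (isT : (0 < k.*2.+1)%N); rewrite tay_0n in e1.
  have b1 a : tiny a -> `|a| <= 1%:R.
    by move=> /(_ 1%N); rewrite mul1r; exact: ltW.
  have := hs s0 d (u' - d) (leqnn _) (b1 _ td).
  have -> : d + (u' - d) = u' by ring.
  move=> h; apply: lt_le_trans (h _ d0 _).
  - by rewrite ltr_pMr.
  - by apply: b1; apply: tinyD => //; exact: tinyN.
  - by apply: lt_trans e1.
exists (cl x) => //; rewrite -Exp_cl //; apply: cl_simplest => //.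
- exact: surreal_exp.
- move=> b /(exp_optP sx)[/andP[_ /eqP ->] //|[s [ o [oo [_ [k [p1 p2 p3]]]]]]].
  have [Po to no] := optx _ _ oo; apply: le_lt_trans p3 _.
  have e0 := Exp_gt0 (cl o); rewrite -ltr_pdivlMl // mulrC.
  apply: (key (cl o)) => //.
  + by apply: PM => //; rewrite -ExpN; apply/PE/PN.
  + by apply: div_tiny => //; [exact: half|exact: Et].
  + apply: contra no => /eqP E; apply/eqP.
    by rewrite -[RHS](divfK (lt0r_neq0 e0)) E mul1r.
  + by apply: tinyD => //; exact: tinyN.
  + move=> u' Pu' tu' h; rewrite ltrBlDl; apply: xr; [exact: PD|exact: tinyD|].
    have Pt : P (cl o + u') by exact: PD.
    have tt : tiny (cl o + u') by exact: tinyD.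
    rewrite lt_neqAle eq_sym ne //= ExpD -ler_pdivrMl //.
    by rewrite mulrC.
- move=> b /(exp_optP sx)[//|[s [ o [oo [_ [k [p1 p2]]]]]]].
  have [Po to no] := optx _ _ oo; apply: lt_le_trans p2.
  have e0 := Exp_gt0 (cl o); rewrite ltr_pdivlMr // mulrC -ltr_pdivlMr //.
  apply: (key (cl o)) => //.
  + by apply: PM => //; exact: PE.
  + by apply: div_tiny => //; exact: Et.
  + apply: contra no => /eqP E; apply/eqP.
    by rewrite -[LHS](divfK (lt0r_neq0 c0p)) E mul1r.
  + by apply: tinyD => //; exact: tinyN.
  + move=> u' Pu' tu' h; rewrite ltrBlDr -ltrBlDl.
    have Pt : P (cl o - u') by exact: PB.
    have tt : tiny (cl o - u') by apply: tinyD => //; exact: tinyN.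
    apply: xl => //; rewrite lt_neqAle ne //= ExpD ExpN.
    by rewrite ler_pdivrMr ?Exp_gt0 // mulrC -ler_pdivrMr.
- move=> b ob; have sb := surreal_opt sy ob; have bc : cl b < c' := cl_opt sy ob.
  rewrite Exp_cl //; have [tb|tb] := pselect (tiny (cl b - 1)).
    have [k Ek] : exists k, b = op k by case: ob => i ->; exists (inl i).
    have Ew : tiny (cl (w (inl k))) /\ Exp (cl (w (inl k))) = cl b.
      by rewrite /w; case: cid2 => z /= _; rewrite -Ek; apply.
    case: Ew => tw Ew; rewrite -Ew Exp_lt; apply: xl => //; last by rewrite Ew.
    by exists (TVar (inl k)).
  (* A left option of y that is not infinitely close to 1 need not have its logarithm in the ring;
     it already lies below exp l. *)
  apply: (@lt_trans _ _ (Exp l)); last by rewrite Exp_lt.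
  apply: lt_le_trans (Exp_ge1D _); rewrite ltNge; apply/negP => h; apply: tb => n.
  have [b1|b1] := lerP 0 (cl b - 1).
    apply: le_lt_trans (ty n); apply: ler_wpM2l => //; rewrite !ger0_norm //.
      by rewrite lerD2r ltW.
    by apply: le_trans b1 _; rewrite lerD2r ltW.
  apply: le_lt_trans (tl n); apply: ler_wpM2l => //; rewrite ltr0_norm //.
  by rewrite ler0_norm; lra.
- move=> b ob; have sb := surreal_opt sy ob; have bc : c' < cl b := cl_opt sy ob.
  rewrite Exp_cl //; have [tb|tb] := pselect (tiny (cl b - 1)).
    have [k Ek] : exists k, b = op k by case: ob => i ->; exists (inr i).
    have Ew : tiny (cl (w (inl k))) /\ Exp (cl (w (inl k))) = cl b.
      by rewrite /w; case: cid2 => z /= _; rewrite -Ek; apply.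
    case: Ew => tw Ew; rewrite -Ew Exp_lt; apply: xr => //; last by rewrite Ew.
    by exists (TVar (inl k)).
  apply: (@lt_trans _ _ (Exp u)); first by rewrite Exp_lt.
  rewrite ltNge; apply/negP => h; apply: tb => n.
  have [b1|b1] := lerP (cl b - 1) 0.
    apply: le_lt_trans (ty n); apply: ler_wpM2l => //; rewrite !ler0_norm //.
      by rewrite lerN2 lerD2r ltW.
    by apply: le_trans b1; rewrite lerD2r ltW.
  apply: le_lt_trans (Et _ ty n); apply: ler_wpM2l => //; rewrite gtr0_norm //.
  by rewrite ger0_norm -/u; lra.
Qed.

(** * Logarithms of finite surreals, of sums and of omega *)

Definition has_log (c : No) := exists a, Exp a = c.

Lemma has_logM c d : has_log c -> has_log d -> has_log (c * d).
Proof. by move=> [a <-] [b <-]; exists (a + b); exact: ExpD. Qed.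

(* The cut of the rationals at log c determines c up to a factor 1 + tiny. *)
Lemma has_log_fin c N : 1 <= c -> c <= N%:R -> has_log c.
Proof.
move=> c1 cN; have c0 : 0 < c by lra.
(* A rational logarithm is set aside, so that all comparisons with rationals are strict. *)
have [[q Eq]|noq] := pselect (exists q : rat, Exp (ratr q) = c); first by exists (ratr q).
pose v (q : rat) := No_rep (ratr q).
have sv q : surreal (v q) by exact: surreal_rep.
have vE q : cl (v q) = ratr q by exact: cl_rep.
pose x := gcut v (fun q => Exp (ratr q) < c) (fun q => c < Exp (ratr q)).
have sx : surreal x.
  apply: surreal_gcut => // s t h1 h2.
  by rewrite -[No_lt _ _]/(cl (v s) < cl (v t)) !vE -Exp_lt; exact: lt_trans h2.
have xl q : Exp (ratr q) < c -> ratr q < cl x.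
  by move=> h; rewrite -vE; apply: (@cl_opt true) => //; apply/gcut_opt; exists q.
have xr q : c < Exp (ratr q) -> cl x < ratr q.
  by move=> h; rewrite -vE; apply: (@cl_opt false) => //; apply/gcut_opt; exists q.
suff [a Ea] : has_log (c / Exp (cl x)).
  by exists (a + cl x); rewrite ExpD Ea divfK // gt_eqF // Exp_gt0.
apply: log_near1.
have step n : (0 < n)%N -> exists q : rat, ratr q < cl x < ratr q + n%:R^-1.
  move=> n0; pose f m : rat := m%:R / n%:R.
  have fE m : ratr (f m) = m%:R / n%:R :> No by rewrite rmorphM fmorphV /= !ratr_nat.
  have ex : exists m, c < Exp (ratr (f m)).
    exists (N * n)%N; rewrite fE natrM mulfK ?pnatr_eq0 -?lt0n //.
    by apply: lt_le_trans (Exp_ge1D _); lra.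
  case: (ex_minnP ex) => -[|m] hm min.
    by move: hm; rewrite fE mul0r Exp0; lra.
  exists (f m); apply/andP; split.
    apply: xl; rewrite lt_neqAle; apply/andP; split.
      by apply/eqP => E; apply: noq; exists (f m).
    by rewrite leNgt; apply/negP => /min; rewrite ltnn.
  have := xr _ hm; rewrite !fE; suff -> : m.+1%:R / n%:R = m%:R / n%:R + n%:R^-1 :> No by [].
  by rewrite -natr1 mulrDl mul1r.
move=> n; have [q /andP[h1 h2]] := step (n.+1.*2).*2 isT.
set e := _^-1 in h2.
have e0 : 0 < e by rewrite invr_gt0 ltr0n.
have Ec : ratr q < cl x /\ Exp (ratr q) < c /\ c < Exp (ratr q + e).
  split=> //; split.
    rewrite ltNge; apply/negP; rewrite le_eqVlt => /orP[/eqP E|/xr].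
      by apply: noq; exists q.
    by move/(lt_trans h1); rewrite ltxx.
  have E : ratr q + e = ratr (q + (n.+1.*2).*2%:R^-1).
    by rewrite rmorphD fmorphV /= ratr_nat.
  rewrite E in h2 *; rewrite ltNge; apply/negP; rewrite le_eqVlt => /orP[/eqP E'|/xl].
    by apply: noq; eexists; exact: E'.
  by move/(lt_trans h2); rewrite ltxx.
case: Ec => _ [c1' c2]; set X := cl x in h1 h2 *.
have X0 := Exp_gt0 X.
have u1 : c / Exp X < Exp e.
  rewrite ltr_pdivrMr // -ExpD; apply: lt_trans c2 _; rewrite Exp_lt; lra.
have u2 : Exp (- e) < c / Exp X.
  by rewrite ltr_pdivlMr // -ExpD; apply: le_lt_trans c1'; rewrite Exp_le; lra.
have e2 : n.+1.*2%:R * e = 1 / 2.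
  by rewrite /e -!mul2n !natrM; field; rewrite ?pnatr_eq0 //= -natrM pnatr_eq0.
have n1 : 1 <= n.+1%:R :> No by rewrite ler1n.
have e4 : e <= 1 / 4.
  by move: e2; rewrite -mul2n natrM; nra.
have q1 : Exp e <= 1 + e + 2 * e ^+ 2 by apply: Exp_quad; rewrite gtr0_norm //; lra.
have q2 := Exp_ge1D (- e).
have : `|c / Exp X - 1| <= 2 * e.
  by rewrite ler_norml; apply/andP; split; [lra|rewrite expr2 in q1; nra].
move/(ler_wpM2l (ler0n No n)) => h; apply: le_lt_trans h _.
have nn : n%:R < n.+1%:R :> No by rewrite ltr_nat.
by move: e2; rewrite -mul2n natrM; nra.
Qed.

(** With d <= c, write c + d = c (1 + d/c), where the second factor lies between 1 and 2. *)
Lemma has_logD c d : 0 < c -> 0 < d -> has_log c -> has_log d -> has_log (c + d).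
Proof.
wlog cd : c d / d <= c.
  move=> H c0 d0 hc hd; have /orP[h|h] := le_total d c; first exact: H.
  by rewrite addrC; apply: H.
move=> c0 d0 hc _; have -> : c + d = c * (1 + d / c) by field; rewrite gt_eqF.
apply: has_logM => //; apply: (@has_log_fin _ 2).
  by rewrite lerDl divr_ge0 // ltW.
by have : d / c <= 1 by [rewrite ler_pdivrMr // mul1r]; lra.
Qed.

Lemma has_log1 : has_log 1. Proof. by exists 0; exact: Exp0. Qed.

Definition infinite_No (a : No) := forall n, n%:R < a.

(* Surreals presented like the powers omega^(2^-k): left options natural,     *)
(* right options at least proportional to the square.                         *)
Definition root_shape W := [/\ surreal W, infinite_No (cl W),
  forall b, Op true W b -> exists n, cl b <= n%:R &
  forall b, Op false W b -> exists2 m, 0 < cl b & cl W ^+ 2 <= m%:R * cl b].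

(** The root is { n | W/(m+1) }: its square equals W by simplicity, and its right options satisfy
    the shape condition with constant m+1. *)
Lemma root_shape_sqrt W : root_shape W ->
  exists2 W', root_shape W' & cl W' ^+ 2 = cl W.
Proof.
move=> [sW iW lW rW].
pose v (k : nat + nat) : game :=
  match k with inl n => gnat n | inr m => No_rep (cl W / m.+1%:R) end.
have sv k : surreal (v k) by case: k => n; [exact: surreal_nat|exact: surreal_rep].
pose W' := gcut v (fun k => if k is inl _ then True else False)
                  (fun k => if k is inr _ then True else False).
have W0 : 0 < cl W := iW 0%N.
have sW' : surreal W'.
  apply: surreal_gcut => // -[n|//] [//|m] _ _.
  suff : cl (v (inl n)) < cl (v (inr m)) by [].
  rewrite /= cl_nat cl_rep ltr_pdivlMr ?ltr0n // -natrM.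
  exact: iW.
have gl n : n%:R < cl W'.
  rewrite -cl_nat; apply: (@cl_opt true) => //; apply/gcut_opt; by exists (inl n).
have gr m : cl W' * m.+1%:R < cl W.
  rewrite -ltr_pdivlMr ?ltr0n // -[cl W / _]cl_rep.
  apply: (@cl_opt false) => //; apply/gcut_opt; by exists (inr m).
have optl b : Op true W' b -> exists n, cl b = n%:R.
  by case/gcut_opt=> -[n|m] // _ ->; exists n; exact: cl_nat.
have optr b : Op false W' b -> exists m, cl b = cl W / m.+1%:R.
  by case/gcut_opt=> -[n|m] // _ ->; exists m; exact: cl_rep.
have E : cl W' ^+ 2 = cl W.
  rewrite expr2 -clM //; apply: cl_simplest => //; first exact: surreal_mul.
  - move=> c /gmul_opt[t [A [B [oA oB ->]]]].
    have sA := surreal_opt sW' oA; have sB := surreal_opt sW' oB.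
    rewrite cl_mul_term //.
    case: t oA oB => [/optl[n ->] /optl[m ->]|/optr[n ->] /optr[m ->]].
      have := gr (n + m)%N; have := gl 0%N; rewrite -natr1 natrD.
      have : 0 <= n%:R * m%:R :> No by rewrite -natrM ler0n.
      by move: (n%:R) (m%:R) => N M; nra.
    have := gr (n + m).+1; have n0 : 0 < n.+1%:R :> No by rewrite ltr0n.
    have m0 : 0 < m.+1%:R :> No by rewrite ltr0n.
    have -> : (n + m).+2%:R = n.+1%:R + m.+1%:R :> No by rewrite -natrD addnS.
    move: (n.+1%:R) (m.+1%:R) n0 m0 => N M N0 M0 h.
    apply: (@lt_trans _ _ 0) => //.
    have -> : cl W / N * cl W' + cl W' * (cl W / M) - cl W / N * (cl W / M) =
      cl W / (N * M) * (cl W' * (N + M) - cl W) by field; rewrite !gt_eqF.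
    by rewrite pmulr_rlt0 ?subr_lt0 // divr_gt0 // mulr_gt0.
  - move=> c /gmul_opt[t [A [B [oA oB ->]]]].
    have sA := surreal_opt sW' oA; have sB := surreal_opt sW' oB.
    rewrite cl_mul_term //.
    have key n m : cl W < n%:R * cl W' + cl W' * (cl W / m.+1%:R) - n%:R * (cl W / m.+1%:R).
      have -> : n%:R * cl W' + cl W' * (cl W / m.+1%:R) - n%:R * (cl W / m.+1%:R) =
        n%:R * cl W' + cl W / m.+1%:R * (cl W' - n%:R) by ring.
      have h : cl W < cl W / m.+1%:R * (cl W' - n%:R).
        rewrite mulrAC ltr_pdivlMr ?ltr0n // ltr_pM2l // ltrBrDl -natrD; exact: gl.
      by apply: lt_le_trans h _; rewrite lerDr mulr_ge0 // ltW // (gl 0%N).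
    case: t oA oB => [/optl[n ->] /optr[m ->]|/optr[m ->] /optl[n ->]].
      exact: key.
    by have := key n m; congr (_ < _); ring.
  - move=> b ob; have [n hn] := lW _ ob; apply: le_lt_trans hn _; rewrite clM //.
    by have := gl n; have := gl 1%N; have : 0 <= n%:R :> No by []; nra.
  - move=> b ob; have [m b0 hm] := rW _ ob; rewrite clM //.
    have h := gr m; have W1 := gl 0%N.
    have m1 : 0 < m.+1%:R :> No by rewrite ltr0n.
    have h2 : (cl W' * m.+1%:R) ^+ 2 < cl W ^+ 2.
      by rewrite ltrXn2r // ?nnegrE ?mulr_ge0 ?ltW.
    have h3 := lt_le_trans h2 hm.
    have h4 : m%:R * cl b <= m.+1%:R ^+ 2 * cl b.
      rewrite ler_pM2r // expr2 -natrM ler_nat; lia.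
    have := lt_le_trans h3 h4; rewrite exprMn mulrC ltr_pM2l ?exprn_gt0 //.
exists W' => //; split=> //.
- by move=> b /optl[n ->]; exists n.
- move=> b /optr[m ->]; exists m.+1; first by rewrite divr_gt0 ?ltr0n.
  by rewrite E mulrC divfK // pnatr_eq0.
Qed.

Lemma gomega_opt s b : Op s gomega b <-> s /\ exists n, b = gnat n.
Proof.
case: s; split.
- by case=> n ->; split=> //; exists n.
- by case=> _ [n ->]; exists n.
- by case=> -[].
- by case.
Qed.

Lemma surreal_omega : surreal gomega.
Proof.
apply/surrealP; split=> [a b _ /gomega_opt[]//|s a /gomega_opt[_ [n ->]]].
exact: surreal_nat.
Qed.

Lemma omega_infinite : infinite_No (cl gomega).
Proof.
move=> n; rewrite -cl_nat; apply: (@cl_opt true); first exact: surreal_omega.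
by apply/gomega_opt; split=> //; exists n.
Qed.

Lemma omega_root k : exists2 a, infinite_No a & a ^+ (2 ^ k) = cl gomega.
Proof.
suff [W [_ iW _ _] EW] : exists2 W, root_shape W & cl W ^+ (2 ^ k) = cl gomega.
  by exists (cl W).
elim: k => [|k [W hW EW]].
  exists gomega; last by rewrite expn0 expr1.
  split; [exact: surreal_omega|exact: omega_infinite| |].
    by move=> b /gomega_opt[_ [n ->]]; exists n; rewrite cl_nat.
  by move=> b /gomega_opt[].
have [W' hW' E] := root_shape_sqrt hW; exists W' => //.
by rewrite expnS exprM E.
Qed.

Lemma pow_lt_Exp a J N : infinite_No a -> N%:R * a ^+ J < Exp a.
Proof.
move=> ia; have a0 : 0 < a := ia 0%N.
apply: lt_trans (tod_lt_Exp J (lt0r_neq0 a0)).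
apply: (@lt_le_trans _ _ (tay a J.+1)); last by apply: tay_mono_n; [exact: ltW|lia].
apply: (@lt_le_trans _ _ (a ^+ J.+1 / (J.+1)`!%:R)).
  rewrite ltr_pdivlMr ?fact_gt0R // exprS mulrAC -natrM ltr_pM2r ?exprn_gt0 //.
by rewrite tayS lerDr; apply: le_trans (tay_ge1 _ (ltW a0)).
Qed.

Lemma tod_le_pow (a : No) k : 1 <= a -> tod a k <= (k.*2.+2)%:R * a ^+ k.*2.+1.
Proof.
move=> a1; have a0 : 0 <= a by lra.
have -> : k.*2.+2%:R * a ^+ k.*2.+1 = \sum_(i < k.*2.+2) a ^+ k.*2.+1.
  by rewrite sumr_const card_ord mulr_natl.
apply: ler_sum => i _; apply: (@le_trans _ _ (a ^+ i)).
  by rewrite ler_pdivrMr ?fact_gt0R // ler_peMr ?ler1n ?fact_gt0 // exprn_ge0.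
by apply: ler_weXn2l => //; rewrite -ltnS.
Qed.

Lemma Exp_nat_fin n : exists N, Exp n%:R <= N%:R.
Proof.
elim: n => [|n [N hN]]; first by exists 1%N; rewrite Exp0.
exists (N * 4)%N; rewrite -natr1 ExpD natrM; apply: ler_pM => //; do ?exact/ltW/Exp_gt0.
have h := @Exp_quad (1 / 2); have -> : 1 = 1 / 2 + 1 / 2 :> No by lra.
have {}h : Exp (1 / 2) <= 2.
  by apply: le_trans (h _) _; [rewrite ger0_norm //; lra|rewrite expr2; lra].
by rewrite ExpD; have := Exp_gt0 (1 / 2); nra.
Qed.

(* log omega = { n | omega^(2^-k) } *)
Lemma has_log_omega : has_log (cl gomega).
Proof.
pose a k := s2val (cid2 (omega_root k)).
have ia k : infinite_No (a k) by rewrite /a; case: cid2.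
have Ea k : a k ^+ (2 ^ k) = cl gomega by rewrite /a; case: cid2.
pose v (k : nat + nat) : game :=
  match k with inl n => gnat n | inr k => No_rep (a k) end.
have sv k : surreal (v k) by case: k => n; [exact: surreal_nat|exact: surreal_rep].
pose x := gcut v (fun k => if k is inl _ then True else False)
                 (fun k => if k is inr _ then True else False).
have sx : surreal x.
  apply: surreal_gcut => // -[n|//] [//|m] _ _.
  suff : cl (v (inl n)) < cl (v (inr m)) by [].
  by rewrite /= cl_nat cl_rep; exact: ia.
have gl n : n%:R < cl x.
  rewrite -cl_nat; apply: (@cl_opt true) => //; apply/gcut_opt; by exists (inl n).
have gr m : cl x < a m.
  rewrite -[a m]cl_rep; apply: (@cl_opt false) => //; apply/gcut_opt; by exists (inr m).
have optx s b : Op s x b -> (exists n, cl b = n%:R) \/ (exists k, cl b = a k).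
  case/gcut_opt=> -[n|m] _ ->; [left; exists n; exact: cl_nat|right; exists m; exact: cl_rep].
have x1 : 1 <= cl x := ltW (gl 1%N).
have x0 : 0 < cl x := gl 0%N.
have xpow J N : N%:R * cl x ^+ J < cl gomega.
  have : (J < 2 ^ J)%N by rewrite ltn_expl.
  move=> h; rewrite -(Ea J).
  apply: (@le_lt_trans _ _ (cl x ^+ (2 ^ J))); last first.
    rewrite ltrXn2r // ?nnegrE ?(ltW x0) ?expn_eq0 // ltW //; exact: ia J 0%N.
  apply: (@le_trans _ _ (cl x ^+ J.+1)); last exact: ler_weXn2l.
  by rewrite exprS ler_pM2r ?exprn_gt0 // ltW.
have aax k n : n%:R < a k - cl x.
  have E : a k = a k.+1 ^+ 2.
    have h : (a k.+1 ^+ 2) ^+ (2 ^ k) = a k ^+ (2 ^ k) by rewrite -exprM -expnS Ea Ea.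
    apply/esym/eqP; rewrite -(@eqrXn2 _ (2 ^ k)) ?h ?expn_gt0 ?exprn_ge0 //.
      exact/ltW/(ia k.+1 0%N).
    exact/ltW/(ia k 0%N).
  have := gr k.+1; have := ia k.+1 (n + 2)%N; have : 0 <= n%:R :> No by [].
  by rewrite E expr2 natrD; move: (n%:R) (a k.+1) => N A; nra.
(* Hence the right options of x contribute no nonzero left option to exp x, and its left options
   contribute no right option. *)
have tod_neg (p : No) k : p <= - (k.*2.+1)%:R -> ~ (0 < tod p k).
  by move=> h /tod_gt0_bound; rewrite ltNge h.
exists (cl x); rewrite -Exp_cl //; apply: cl_simplest; first exact: surreal_exp.
- exact: surreal_omega.
- move=> b /(exp_optP sx)[/andP[_ /eqP ->]|[s [ o [oo [_ [k [p1 p2 p3]]]]]]].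
    exact: (omega_infinite 0).
  apply: le_lt_trans p3 _; case: (optx _ _ oo) => [[n En]|[l El]]; last first.
    by case: (tod_neg _ _ _ p1); rewrite El lerNr opprB ltW.
  have [N hN] := Exp_nat_fin n; rewrite En.
  apply: le_lt_trans (xpow k.*2.+1 (N * k.*2.+2)%N).
  rewrite natrM -mulrA; apply: ler_pM => //; do ?exact/ltW/Exp_gt0.
    by rewrite -En ltW.
  apply: le_trans (tod_le_pow _ x1); apply: tay_mono_p; first by rewrite subr_ge0 ltW.
  by rewrite lerBlDr lerDl.
- move=> b /(exp_optP sx)[//|[s [ o [oo [_ [k [p1 p2]]]]]]].
  apply: lt_le_trans p2; case: (optx _ _ oo) => [[n En]|[l El]].
    case: (tod_neg _ _ _ p1); rewrite En lerNr opprB lerBrDl -natrD.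
    exact: ltW.
  rewrite El in p1 *; rewrite ltr_pdivlMr // -(Ea l).
  have al1 : 1 <= a l := ltW (ia l 1%N).
  have al0 : 0 < a l := ia l 0%N.
  apply: le_lt_trans (pow_lt_Exp (2 ^ l + k.*2.+1) k.*2.+2 (ia l)).
  rewrite exprD mulrCA ler_pM2l ?exprn_gt0 //.
  apply: le_trans (tod_le_pow _ al1); apply: tay_mono_p; first by rewrite subr_ge0 ltW.
  by rewrite lerBlDr lerDl ltW.
- move=> b /gomega_opt[_ [n ->]]; rewrite Exp_cl // cl_nat.
  by apply: lt_le_trans (Exp_ge1D _); have := gl n; lra.
- by move=> b /gomega_opt[].
Qed.

Lemma glogP x : surreal x -> has_log (cl x) ->
  surreal (glog x) /\ Exp (cl (glog x)) = cl x.
Proof.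
move=> sx [a Ea]; rewrite /glog; case: xgetP => [z _ [sz E]|H].
  split=> //; rewrite -Exp_cl //; apply/cl_eq => //; exact: surreal_exp.
exfalso; apply: (H (No_rep a)); split; first exact: surreal_rep.
apply/cl_eq => //; first exact/surreal_exp/surreal_rep.
Qed.

(** * Skolem surreals are well ordered *)

Definition omg : No := cl gomega.
Definition Log (c : No) : No := xget 0 [set a | Exp a = c].
Definition powN (a b : No) : No := Exp (b * Log a).

Lemma LogK c : has_log c -> Exp (Log c) = c.
Proof. by move=> [a Ea]; rewrite /Log; case: xgetP => [x _ //|H]; case: (H a). Qed.

Lemma Log_Exp a : Log (Exp a) = a.
Proof. by apply: Exp_inj; rewrite LogK //; exists a. Qed.

Inductive SkN : No -> Prop :=
| SkN_one : SkN 1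
| SkN_omega : SkN omg
| SkN_add a b : SkN a -> SkN b -> SkN (a + b)
| SkN_mul a b : SkN a -> SkN b -> SkN (a * b)
| SkN_pow a b : SkN a -> SkN b -> SkN (powN a b).

Lemma SkN_log_ge1 a : SkN a -> has_log a /\ 1 <= a.
Proof.
elim=> [||{}a b _ [la ga] _ [lb gb]|{}a b _ [la ga] _ [lb gb]|{}a b _ [la ga] _ [lb gb]].
- by split=> //; exact: has_log1.
- by split; [exact: has_log_omega|apply/ltW/(omega_infinite 1)].
- by split; [apply: has_logD => //; lra|lra].
- by split; [exact: has_logM|nra].
- split; first by eexists.
  rewrite -Exp0 Exp_le mulr_ge0 //; first lra.
  by rewrite -Exp_le Exp0 LogK.
Qed.

Lemma SkN_ge1 a : SkN a -> 1 <= a. Proof. by move/SkN_log_ge1 => []. Qed.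
Lemma SkN_gt0 a : SkN a -> 0 < a. Proof. by move/SkN_ge1; lra. Qed.
Lemma SkN_LogK a : SkN a -> Exp (Log a) = a.
Proof. by move/SkN_log_ge1 => [/LogK]. Qed.

Lemma Exp_half : Exp (1 / 2) <= 2.
Proof.
apply: le_trans (Exp_quad _) _; first by rewrite ger0_norm //; lra.
by rewrite expr2; lra.
Qed.

Lemma Log_ge_half a : SkN a -> 2 <= a -> 1 / 2 <= Log a.
Proof.
by move=> Sa a2; rewrite -Exp_le SkN_LogK //; exact: le_trans Exp_half a2.
Qed.

Lemma powN_ge_base a b : SkN a -> 1 <= b -> a <= powN a b.
Proof.
move=> Sa b1; rewrite -{1}(SkN_LogK Sa) Exp_le ler_peMl //.
by rewrite -Exp_le Exp0 SkN_LogK // SkN_ge1.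
Qed.

Lemma powN_ge_exp a b : SkN a -> 2 <= a -> 0 <= b -> b <= powN a b.
Proof.
move=> Sa a2 b0; have l2 := Log_ge_half Sa a2.
apply: (@le_trans _ _ (Exp (b / 4 + b / 4))); last first.
  rewrite Exp_le; have : b * (1 / 2) <= b * Log a by exact: ler_wpM2l.
  by lra.
rewrite ExpD; have h := Exp_ge1D (b / 4); have e0 : 0 <= 1 + b / 4 by lra.
apply: le_trans (ler_pM e0 e0 h h); have := sqr_ge0 (1 - b / 4).
by rewrite expr2; lra.
Qed.

Lemma powN_mono a a' b b' : SkN a -> SkN a' -> SkN b -> a <= a' -> b <= b' ->
  powN a b <= powN a' b'.
Proof.
move=> Sa Sa' Sb aa bb; rewrite Exp_le; apply: ler_pM => //.
- by apply/ltW/SkN_gt0.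
- by rewrite -Exp_le Exp0 SkN_LogK // SkN_ge1.
- by rewrite -Exp_le !SkN_LogK.
Qed.

Lemma powN1 b : powN 1 b = 1.
Proof. by have := Log_Exp 0; rewrite /powN Exp0 => ->; rewrite mulr0 Exp0. Qed.

(** A base different from 1 is thus at least 2, which makes [powN] inflationary in the exponent. *)
Lemma SkN_1or2 a : SkN a -> a = 1 \/ 2 <= a.
Proof.
elim=> [||{}a b Sa _ Sb _|{}a b Sa ha Sb hb|{}a b Sa ha Sb _].
- by left.
- by right; apply/ltW/(omega_infinite 2).
- by right; have := SkN_ge1 Sa; have := SkN_ge1 Sb; lra.
- case: ha => [->|ha]; first by rewrite mul1r.
  by right; have := SkN_ge1 Sb; nra.
- case: ha => [->|ha]; [by left; exact: powN1|right].
  by apply: le_trans ha (powN_ge_base Sa (SkN_ge1 Sb)).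
Qed.

Variant sop := SAdd | SMul | SPow.
Definition opv s a b : No :=
  match s with SAdd => a + b | SMul => a * b | SPow => powN a b end.

(** The index counts the operations in a term. Powers of 1 are excluded: they equal 1 and could be
    smaller than their exponent, against [opv_ge]. *)
Inductive SkS : nat -> No -> Prop :=
| SkS_leaf a : a = 1 \/ a = omg -> SkS 0 a
| SkS_op n m s a b : SkS n a -> SkS m b -> (s = SPow -> 2 <= a) ->
    SkS (n + m).+1 (opv s a b).

Lemma SkS_inv n y : SkS n y -> (y = 1 \/ y = omg) \/ exists k m s a b,
  [/\ n = (k + m).+1, y = opv s a b, SkS k a, SkS m b & (s = SPow -> 2 <= a)].
Proof.
case=> [a h|k m s a b Sa Sb h]; first by left.
by right; exists k, m, s, a, b.
Qed.

Lemma SkS_SkN n a : SkS n a -> SkN a.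
Proof.
elim=> [{}a [->|->]|{}n m s {}a b _ Sa _ Sb _]; [exact: SkN_one|exact: SkN_omega|].
by case: s; [exact: SkN_add|exact: SkN_mul|exact: SkN_pow].
Qed.

Lemma SkN_SkS a : SkN a -> exists n, SkS n a.
Proof.
elim=> [||{}a b _ [n ha] _ [m hb]|{}a b _ [n ha] _ [m hb]|{}a b Sa [n ha] _ [m hb]].
- by exists 0%N; constructor; left.
- by exists 0%N; constructor; right.
- by exists (n + m).+1; exact: (SkS_op (s := SAdd)).
- by exists (n + m).+1; exact: (SkS_op (s := SMul)).
- case: (SkN_1or2 Sa) => [->|a2]; first by rewrite powN1; exists 0%N; constructor; left.
  by exists (n + m).+1; exact: (SkS_op (s := SPow)).
Qed.

Lemma opv_ge s a b : SkN a -> SkN b -> (s = SPow -> 2 <= a) ->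
  a <= opv s a b /\ b <= opv s a b.
Proof.
move=> Sa Sb; have a1 := SkN_ge1 Sa; have b1 := SkN_ge1 Sb.
case: s => /= h; [by split; lra|by split; nra|split; first exact: powN_ge_base].
by apply: powN_ge_exp => //; [exact: h|lra].
Qed.

Lemma opv_mono s a b a' b' : SkN a -> SkN b -> SkN a' -> SkN b' -> a <= a' -> b <= b' ->
  opv s a b <= opv s a' b'.
Proof.
move=> Sa Sb Sa' Sb' aa bb; have a1 := SkN_ge1 Sa; have b1 := SkN_ge1 Sb.
by case: s => /=; [lra|nra|exact: powN_mono].
Qed.

(** * Accessibility and nondecreasing subsequences *)

Definition SkR (y x : No) := SkN y /\ y < x.

Definition incr (phi : nat -> nat) := forall i j, (i < j)%N -> (phi i < phi j)%N.

Lemma incr_ge phi n : incr phi -> (n <= phi n)%N.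
Proof. by move=> h; elim: n => // n IH; apply: leq_ltn_trans IH (h _ _ _). Qed.

Lemma incr_le phi i j : incr phi -> (i <= j)%N -> (phi i <= phi j)%N.
Proof. by move=> h; rewrite leq_eqVlt => /orP[/eqP -> //|/h/ltnW]. Qed.

Lemma incr_comp phi psi : incr phi -> incr psi -> incr (phi \o psi).
Proof. by move=> h1 h2 i j ij; apply/h1/h2. Qed.

Lemma inf_often (P : nat -> Prop) : (forall N, exists2 n, (N <= n)%N & P n) ->
  exists2 phi, incr phi & forall n, P (phi n).
Proof.
move=> H; pose nx N := s2val (cid2 (H N)).
have nx1 N : (N <= nx N)%N by rewrite /nx; case: cid2.
have nx2 N : P (nx N) by rewrite /nx; case: cid2.
pose phi := fix phi n := if n is n'.+1 then nx (phi n').+1 else nx 0%N.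
exists phi; last by case=> [|n]; exact: nx2.
by move=> i j; elim: j => // j IH; rewrite ltnS leq_eqVlt => /orP[/eqP ->|/IH h];
  [exact: nx1|apply: ltn_trans h (nx1 _)].
Qed.

Lemma inf_or (P Q : nat -> Prop) : (forall n, P n \/ Q n) ->
  exists2 phi, incr phi & (forall n, P (phi n)) \/ (forall n, Q (phi n)).
Proof.
move=> PQ; have [h|h] := pselect (forall N, exists2 n, (N <= n)%N & P n).
  by have [phi h1 h2] := inf_often h; exists phi => //; left.
have [phi h1 h2] : exists2 phi, incr phi & forall n, Q (phi n).
  apply: inf_often => N; apply: contrapT => hN; apply: h => M.
  exists (maxn N M); first exact: leq_maxr.
  by case: (PQ (maxn N M)) => // q; case: hN; exists (maxn N M) => //; exact: leq_maxl.
by exists phi => //; right.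
Qed.

Lemma Acc_min (P : No -> Prop) x : Acc SkR x -> P x -> (forall y, P y -> SkN y) ->
  exists2 m, P m & forall y, P y -> m <= y.
Proof.
move=> Ax Px PS; elim: Ax Px => {}x _ IH Px.
have [[y Py yx]|h] := pselect (exists2 y, P y & y < x).
  by apply: (IH y) => //; split=> //; exact: PS.
by exists x => // y Py; rewrite leNgt; apply/negP => yx; apply: h; exists y.
Qed.

(** Each tail attains its least value, so infinitely many indices carry a value at most all later
    ones. *)
Lemma Acc_subseq (a : nat -> No) : (forall n, SkN (a n) /\ Acc SkR (a n)) ->
  exists2 phi, incr phi & forall i j, (i <= j)%N -> a (phi i) <= a (phi j).
Proof.
move=> H; have tail N : exists2 n, (N <= n)%N & forall k, (n <= k)%N -> a n <= a k.
  have [|||m [n Nn <-] hm] := @Acc_min (fun x => exists2 n, (N <= n)%N & a n = x) (a N).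
  - by have [] := H N.
  - by exists N.
  - by move=> _ [n _ <-]; have [] := H n.
  by exists n => // k nk; apply: hm; exists k => //; exact: leq_trans nk.
have [phi hphi h] := inf_often tail.
by exists phi => // i j ij; apply: h; exact: incr_le.
Qed.

(* A descending sequence each of whose terms is chosen of minimal size among  *)
(* the non-accessible elements below the previous one: the immediate subterms *)
(* of its members are accessible.                                             *)
Lemma SkN_Acc x : SkN x -> Acc SkR x.
Proof.
move=> Sx; apply: contrapT => nAx.
pose NA y := SkN y /\ ~ Acc SkR y.
pose best (B : No -> Prop) y n :=
  [/\ NA y, B y, SkS n y & forall z m, NA z -> B z -> SkS m z -> (n <= m)%N].
have bestP B : (exists2 y, NA y & B y) -> exists y, exists n, best B y n.
  case=> y NAy By; have [n hn] := SkN_SkS NAy.1.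
  have ex : exists n, `[< exists2 y, NA y /\ B y & SkS n y >].
    by exists n; apply/asboolP; exists y.
  case: (ex_minnP ex) => k /asboolP[z [NAz Bz] Sz] min.
  exists z, k; split=> // z' m NAz' Bz' Sz'; apply: min.
  by apply/asboolP; exists z'.
have start : exists y, exists n, best (fun=> True) y n.
  by apply: bestP; exists x.
have next y : exists z, NA y -> exists n, best (fun z => z < y) z n.
  have [NAy|] := pselect (NA y); last by exists 0.
  have [|z hz] := bestP (fun z => z < y); last by exists z.
  apply: contrapT => h; apply: NAy.2; constructor=> z [Sz zy].
  by apply: contrapT => nz; apply: h; exists z.
pose nx y := sval (cid (next y)).
pose f := fix f n := if n is n'.+1 then nx (f n') else sval (cid start).
pose B n := if n is n'.+1 then (fun z => z < f n') else (fun=> True).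
have fP n : exists k, best (B n) (f n) k.
  elim: n => [|n [k [NAf _ _ _]]] /=; first by case: cid.
  by rewrite /nx; case: cid => z /=; apply.
have fNA n : NA (f n) by have [k []] := fP n.
have fS n : f n.+1 < f n by have [k []] := fP n.+1.
have fd i j : (i < j)%N -> f j < f i.
  elim: j => // j IH; rewrite ltnS leq_eqVlt => /orP[/eqP -> //|/IH].
  exact: lt_trans (fS j).
have dec n : (f n = 1 \/ f n = omg) \/ exists s a b, [/\ f n = opv s a b,
    SkN a /\ Acc SkR a & SkN b /\ Acc SkR b].
  have [k [NAf Bf Sf min]] := fP n.
  (* A term of smaller size that is at most f n also meets the bound imposed on f n, so minimality
     makes it accessible. *)
  have sub z m : SkN z -> SkS m z -> (m < k)%N -> z <= f n -> Acc SkR z.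
    move=> Sz hz mk zf; apply: contrapT => nz.
    suff : (k <= m)%N by rewrite leqNgt mk.
    by apply: (min z) => //; case: (n) Bf zf => //= n' h1 h2; exact: le_lt_trans h1.
  case: (SkS_inv Sf) => [h|[k1 [m [s [a [b [Ek Ef Sa Sb h]]]]]]]; first by left.
  rewrite Ek Ef in sub; have ka := SkS_SkN Sa; have kb := SkS_SkN Sb; have [g1 g2] := opv_ge ka kb h.
  have k1l : (k1 < (k1 + m).+1)%N by rewrite ltnS leq_addr.
  have ml : (m < (k1 + m).+1)%N by rewrite ltnS leq_addl.
  right; exists s, a, b; split; first exact: Ef.
    exact: (conj ka (sub _ _ ka Sa k1l g1)).
  exact: (conj kb (sub _ _ kb Sb ml g2)).
have [phi iphi [hleaf|hop]] := inf_or dec.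
  have [psi ipsi H] := inf_or hleaf; have ic := incr_comp iphi ipsi.
  have := fd _ _ (ic 0%N 1%N isT); rewrite /=.
  by case: H => H; rewrite !H ltxx.
have /choice[t ht] : forall n, exists t : sop * No * No,
    [/\ f (phi n) = opv t.1.1 t.1.2 t.2, SkN t.1.2 /\ Acc SkR t.1.2 & SkN t.2 /\ Acc SkR t.2].
  by move=> n; have [s [a [b h]]] := hop n; exists (s, a, b).
have [psi ipsi [s hs]] : exists2 psi, incr psi & exists s, forall n, (t (psi n)).1.1 = s.
  have c3 n : (t n).1.1 = SAdd \/ ((t n).1.1 = SMul \/ (t n).1.1 = SPow).
    by case: (t n).1.1; [left|right; left|right; right].
  have [p1 i1 [h|h]] := inf_or c3; first by exists p1 => //; exists SAdd.
  have [p2 i2 [h'|h']] := inf_or h; exists (p1 \o p2); do ?exact: incr_comp.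
    by exists SMul.
  by exists SPow.
have [|p1 i1 h1] := @Acc_subseq (fun n => (t (psi n)).1.2).
  by move=> n; have [] := ht (psi n).
have [|p2 i2 h2] := @Acc_subseq (fun n => (t (psi (p1 n))).2).
  by move=> n; have [] := ht (psi (p1 n)).
pose g := psi \o (p1 \o p2).
have ig : incr g by apply: incr_comp => //; exact: incr_comp.
(* Two terms built by the same operation from nondecreasing arguments cannot descend. *)
have := fd _ _ (iphi _ _ (ig 0%N 1%N isT)).
have [E0 [S0 _] [T0 _]] := ht (g 0%N); have [E1 [S1 _] [T1 _]] := ht (g 1%N).
rewrite E0 E1 /g /= !hs ltNge; apply/negP/negPn.
apply: opv_mono => //; last exact: h2.
by apply: h1; apply: incr_le.
Qed.

Lemma SkN_subseq (a : nat -> No) : (forall n, SkN (a n)) ->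
  exists2 phi, incr phi & forall i j, (i <= j)%N -> a (phi i) <= a (phi j).
Proof. by move=> Sa; apply: Acc_subseq => n; exact: (conj (Sa n) (SkN_Acc (Sa n))). Qed.

(** * Bounded monotone sequences of Skolem surreals are eventually stable *)

(** One-sided: infinitesimal or negative. This avoids absolute values, as it is used for increments
    of nondecreasing sequences. *)
Definition tv (x : No) := forall m, m%:R * x <= 1.
Definition nd (h : nat -> No) := forall i j, (i <= j)%N -> h i <= h j.
Definition bnd (w : No) (M : nat) (h : nat -> No) := forall n, w * (h n - h 0%N) <= M%:R.
Definition stab (w : No) (h : nat -> No) N :=
  forall j, (N <= j)%N -> tv (w * (h j - h N)).
Definition stable w h := exists N, stab w h N.
Definition ll (a b : No) := forall m, m%:R * a < b.

Lemma tv_le x y : x <= y -> tv y -> tv x.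
Proof. by move=> xy ty m; apply: le_trans (ty m); exact: ler_wpM2l. Qed.

Lemma tvM n x : tv x -> tv (n%:R * x).
Proof. by move=> tx m; rewrite mulrA -natrM; exact: tx. Qed.

Lemma tvD x y : tv x -> tv y -> tv (x + y).
Proof.
move=> tx ty m; have := tx (2 * m)%N; have := ty (2 * m)%N.
by rewrite natrM -!mulrA mulrDr; move: (m%:R * x) (m%:R * y) => X Y; lra.
Qed.

Lemma tv0 x : x <= 0 -> tv x.
Proof. by move=> x0 m; have : m%:R * x <= 0 by [rewrite mulr_ge0_le0]; lra. Qed.

Lemma stab_mono w h N N' : 0 < w -> nd h -> stab w h N -> (N <= N')%N -> stab w h N'.
Proof.
move=> w0 hnd hs NN j Nj; apply: tv_le (hs j (leq_trans NN Nj)).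
by rewrite ler_pM2l // lerD2l lerN2; exact: hnd.
Qed.

Lemma nd_sub h phi : nd h -> incr phi -> nd (h \o phi).
Proof. by move=> hnd ip i j ij; apply/hnd/incr_le. Qed.

Lemma bnd_sub w M h phi : 0 < w -> nd h -> bnd w M h -> bnd w M (h \o phi).
Proof.
move=> w0 hnd hb n; apply: le_trans (hb (phi n)).
by rewrite ler_pM2l // lerD2l lerN2; exact: hnd.
Qed.

Lemma stable_sub w h phi : 0 < w -> nd h -> incr phi -> stable w (h \o phi) -> stable w h.
Proof.
move=> w0 hnd ip [N hN]; exists (phi N) => j Nj.
apply: tv_le (hN (maxn N j) (leq_maxl _ _)); rewrite ler_pM2l // lerD2r.
by apply: hnd; apply: leq_trans (incr_ge _ ip); exact: leq_maxr.
Qed.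

Lemma stable_ext w h g : h =1 g -> stable w h -> stable w g.
Proof. by move=> /funext ->. Qed.

Lemma stableD w a b : 0 < w -> nd a -> nd b -> stable w a -> stable w b ->
  stable w (fun n => a n + b n).
Proof.
move=> w0 na nb [N hN] [N' hN']; exists (maxn N N') => j hj.
have h1 := stab_mono w0 na hN (leq_maxl N N') hj.
have h2 := stab_mono w0 nb hN' (leq_maxr N N') hj.
by apply: tv_le (tvD h1 h2); rewrite -mulrDr; apply: eq_ler; ring.
Qed.

Lemma ll_le a b c k : ll a b -> 0 < b -> b <= k%:R * c -> ll a c.
Proof.
move=> ab b0 bc m.
have k0 : 0 < k%:R :> No.
  by rewrite ltr0n lt0n; apply/eqP => k0; move: bc; rewrite k0 mul0r; lra.
rewrite -(ltr_pM2l k0) mulrA -natrM; exact: lt_le_trans bc.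
Qed.

Lemma nllP a b : ~ ll a b -> exists m, b <= m%:R * a.
Proof.
move=> h; apply: contrapT => h'; apply: h => m; rewrite ltNge; apply/negP => hm.
by apply: h'; exists m.
Qed.

(** Stability for sequences in archimedean classes below q, for every weight; it serves as induction
    hypothesis for the components. *)
Definition ok_below q := forall w M h, 0 < w -> (forall n, SkN (h n)) -> nd h ->
  bnd w M h -> (forall n, ll (h n) q) -> stable w h.

(** Increments of F G split as F_j (G_j - G_N) + G_N (F_j - F_N). The factors are bounded for the
    weights w G_0 and w F_0; as w F_0 G_0 is not infinitesimal, F_j and G_N are at most natural
    multiples of F_0 and G_0, so stability of the factors transfers back. *)
Lemma prod_stable q w M m F G : ok_below q -> 0 < w ->
  (forall n, SkN (F n)) -> (forall n, SkN (G n)) -> nd F -> nd G ->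
  bnd w M (fun n => F n * G n) -> 1 <= m%:R * (w * (F 0%N * G 0%N)) ->
  (forall n, ll (F n) q) -> (forall n, ll (G n) q) -> stable w (fun n => F n * G n).
Proof.
move=> ok w0 SF SG nF nG hb hm lF lG.
have F0 n : 0 < F n by exact/SkN_gt0.
have G0 n : 0 < G n by exact/SkN_gt0.
have wF : 0 < w * F 0%N by exact: mulr_gt0.
have wG : 0 < w * G 0%N by exact: mulr_gt0.
have bG : bnd (w * F 0%N) M G.
  move=> n; apply: le_trans (hb n); rewrite -mulrA ler_pM2l // mulrBr lerD2r.
  by rewrite ler_pM2r //; exact: nF.
have bF : bnd (w * G 0%N) M F.
  move=> n; apply: le_trans (hb n); rewrite -mulrA ler_pM2l // mulrBr [G _ * F _]mulrC.
  by rewrite [G _ * F _]mulrC lerD2r ler_pM2l //; exact: nG.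
have [N1 s1] := ok _ _ _ wF SG nG bG lG; have [N2 s2] := ok _ _ _ wG SF nF bF lF.
pose C := (M * m + 1)%N.
have CF j : F j <= C%:R * F 0%N.
  have h1 : (w * G 0%N) * (F j - F 0%N) <= (w * G 0%N) * ((M * m)%:R * F 0%N).
    apply: le_trans (bF j) _; rewrite natrM.
    have := ler_wpM2l (ler0n No M) hm; rewrite mulr1 => /le_trans; apply.
    by apply: eq_ler; ring.
  by move: h1; rewrite ler_pM2l // /C natrD mulrDl mul1r; lra.
have CG j : G j <= C%:R * G 0%N.
  have h1 : (w * F 0%N) * (G j - G 0%N) <= (w * F 0%N) * ((M * m)%:R * G 0%N).
    apply: le_trans (bG j) _; rewrite natrM.
    have := ler_wpM2l (ler0n No M) hm; rewrite mulr1 => /le_trans; apply.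
    by apply: eq_ler; ring.
  by move: h1; rewrite ler_pM2l // /C natrD mulrDl mul1r; lra.
pose N := maxn N1 N2; exists N => j hj.
have t1 := stab_mono wF nG s1 (leq_maxl N1 N2) hj.
have t2 := stab_mono wG nF s2 (leq_maxr N1 N2) hj.
apply: tv_le (tvM C (tvD t1 t2)).
have -> : w * (F j * G j - F N * G N) = w * (F j * (G j - G N)) + w * (G N * (F j - F N)).
  by ring.
have g0 : 0 <= G j - G N by rewrite subr_ge0; exact: nG.
have f0 : 0 <= F j - F N by rewrite subr_ge0; exact: nF.
have -> : C%:R * (w * F 0%N * (G j - G N) + w * G 0%N * (F j - F N)) =
  w * (C%:R * F 0%N * (G j - G N)) + w * (C%:R * G 0%N * (F j - F N)) by ring.
by apply: lerD; rewrite ler_pM2l //; apply: ler_wpM2r.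
Qed.

(** With L = log f, the exponents G L have bounded increments, on which exp is linear up to natural
    factors. An infinite G leaves log f a variation of at most 1/2, so increments of log f amount to
    increments of f over f_0, up to such factors. *)
Lemma pow_stable q w M m f G : ok_below q -> 0 < w ->
  (forall n, SkN (f n)) -> (forall n, SkN (G n)) -> (forall n, 2 <= f n) ->
  infinite_No (G 0%N) -> nd f -> nd G ->
  bnd w M (fun n => powN (f n) (G n)) -> 1 <= m%:R * (w * powN (f 0%N) (G 0%N)) ->
  (forall n, ll (f n) q) -> (forall n, ll (G n) q) ->
  stable w (fun n => powN (f n) (G n)).
Proof.
move=> ok w0 Sf SG f2 iG nf nG hb hm lf lG.
pose L n := Log (f n); pose t n := powN (f n) (G n).
have fE n : f n = Exp (L n) by rewrite SkN_LogK.
have tE n : t n = Exp (G n * L n) by [].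
have L2 n : 1 / 2 <= L n by exact: Log_ge_half.
have nL : nd L by move=> i j ij; rewrite -Exp_le -!fE; exact: nf.
have G0 n : 0 < G n by exact/SkN_gt0.
have f0 n : 0 < f n by exact/SkN_gt0.
have t0 n : 0 < t n by exact: Exp_gt0.
pose W := w * t 0%N; have W0 : 0 < W by exact: mulr_gt0.
pose D i j := G j * L j - G i * L i.
have DE i j : D i j = (G j - G i) * L j + G i * (L j - L i) by rewrite /D; ring.
have tD i j : t j = t i * Exp (D i j) by rewrite !tE -ExpD /D; congr Exp; ring.
have D1 i j : (i <= j)%N -> 0 <= (G j - G i) * L j.
  by move=> ij; rewrite mulr_ge0 ?subr_ge0 ?nG //; have := L2 j; lra.
have D2 i j : (i <= j)%N -> 0 <= G i * (L j - L i).
  by move=> ij; rewrite mulr_ge0 ?subr_ge0 ?nL // ltW.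
have WD n : W * D 0%N n <= M%:R.
  apply: le_trans (hb n); rewrite -/(t n) -/(t 0%N) (tD 0%N n) /W -mulrA ler_pM2l //.
  have -> : t 0%N * Exp (D 0%N n) - t 0%N = t 0%N * (Exp (D 0%N n) - 1) by ring.
  by rewrite ler_pM2l //; have := Exp_ge1D (D 0%N n); lra.
have Dn n : D 0%N n <= (M * m)%:R.
  rewrite -(ler_pM2l W0); apply: le_trans (WD n) _; rewrite natrM.
  have := ler_wpM2l (ler0n No M) hm; rewrite mulr1 => /le_trans; apply.
  by rewrite /W; apply: eq_ler; rewrite -/(t 0%N); ring.
have wG : 0 < W * L 0%N by rewrite mulr_gt0 //; have := L2 0%N; lra.
have bG : bnd (W * L 0%N) M G.
  move=> n; apply: le_trans (WD n); rewrite -mulrA ler_pM2l // DE.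
  have h1 := D2 0%N n isT; have := nL 0%N n isT; have := nG 0%N n isT.
  by move: h1; nra.
have wf : 0 < W * G 0%N / f 0%N by rewrite divr_gt0 // mulr_gt0.
have Lsmall n : G 0%N * (L n - L 0%N) <= (M * m)%:R.
  by apply: le_trans (Dn n); rewrite DE lerDr; exact: D1.
have Lhalf n : L n - L 0%N <= 1 / 2.
  rewrite -(ler_pM2l (G0 0%N)); apply: le_trans (Lsmall n) _.
  by have := iG (2 * (M * m))%N; rewrite natrM; lra.
have bf : bnd (W * G 0%N / f 0%N) (2 * M) f.
  move=> n; have d0 : 0 <= L n - L 0%N by rewrite subr_ge0; exact: nL.
  have -> : W * G 0%N / f 0%N * (f n - f 0%N) = W * G 0%N * (f n / f 0%N - 1).
    by field; rewrite gt_eqF.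
  have -> : f n / f 0%N = Exp (L n - L 0%N) by rewrite ExpD ExpN -!fE.
  have h1 : Exp (L n - L 0%N) - 1 <= 2 * (L n - L 0%N).
    have := Exp_quad (_ : `|L n - L 0%N| <= 1 / 2); rewrite ger0_norm // => /(_ (Lhalf n)).
    by have := Lhalf n; rewrite expr2; nra.
  have h2 : W * G 0%N * (L n - L 0%N) <= M%:R.
    by apply: le_trans (WD n); rewrite -mulrA ler_pM2l // DE lerDr; exact: D1.
  have WG0 : 0 < W * G 0%N by exact: mulr_gt0.
  have := ler_wpM2l (ltW WG0) h1; rewrite natrM; move: h2; lra.
have [N1 s1] := ok _ _ _ wG SG nG bG lG; have [N2 s2] := ok _ _ _ wf Sf nf bf lf.
have [E hE] := Exp_nat_fin (M * m)%N.
have E1 : 1 <= E%:R :> No.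
  apply: le_trans hE; apply: le_trans (Exp_ge1D _).
  by rewrite lerDl ler0n.
pose N := maxn N1 N2; exists N => j hj.
have t1 := stab_mono wG nG s1 (leq_maxl N1 N2) hj.
have t2 := stab_mono wf nf s2 (leq_maxr N1 N2) hj.
apply: tv_le (tvM (E * E * 2) (tvD t1 t2)).
rewrite -/(t j) -/(t N) -/N.
set A := W * L 0%N * _; set B := W * G 0%N / _ * _.
have d0 : 0 <= D N j by rewrite DE addr_ge0 ?D1 ?D2.
have dE : D 0%N j = D 0%N N + D N j by rewrite /D; ring.
have d00 : 0 <= D 0%N N by rewrite DE addr_ge0 ?D1 ?D2.
have d1 : D N j <= (M * m)%:R by have := Dn j; rewrite dE; lra.
have e1 : Exp (D N j) <= E%:R by apply: le_trans hE; rewrite Exp_le.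
have e2 : Exp (D N j) - 1 <= D N j * E%:R.
  have h := Exp_ge1D (- D N j); have p := Exp_gt0 (D N j).
  rewrite ExpN in h; have {}h : (1 - D N j) * Exp (D N j) <= 1.
    by rewrite -ler_pdivlMr // mul1r.
  by have := ler_wpM2l d0 e1; nra.
have tN : t N <= E%:R * t 0%N.
  by rewrite (tD 0%N N) mulrC ler_pM2r //; apply: le_trans hE; rewrite Exp_le.
have h1 : w * (t j - t N) <= E%:R * E%:R * (W * D N j).
  have -> : w * (t j - t N) = w * (t N * (Exp (D N j) - 1)) by rewrite (tD N j); ring.
  have -> : E%:R * E%:R * (W * D N j) = w * (E%:R * t 0%N * (D N j * E%:R)).
    by rewrite /W; ring.
  rewrite ler_pM2l //; apply: ler_pM => //; first exact: ltW.
  by have := Exp_ge1D (D N j); lra.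
apply: le_trans h1 _; rewrite !natrM -[leRHS]mulrA ler_pM2l; last by rewrite mulr_gt0; lra.
have Lj : L j <= 2 * L 0%N by have := Lhalf j; have := L2 0%N; lra.
have GN : G N <= 2 * G 0%N.
  have : (G N - G 0%N) * L N <= (M * m)%:R.
    by apply: le_trans (Dn N); rewrite DE lerDl; exact: D2.
  have := L2 N; have := nG 0%N N isT; have := iG (2 * (M * m))%N; rewrite natrM.
  by nra.
rewrite DE [W * _]mulrDr [2 * (A + B)]mulrDr; apply: lerD.
  have -> : 2 * A = W * ((G j - G N) * (2 * L 0%N)) by rewrite /A; ring.
  by rewrite ler_pM2l // ler_wpM2l // subr_ge0; exact: nG.
have Lf : L j - L N <= (f j - f N) / f 0%N.
  have h : 1 + (L j - L N) <= Exp (L j - L N) by exact: Exp_ge1D.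
  rewrite ExpD ExpN -!fE in h.
  apply: (@le_trans _ _ (f j / f N - 1)); first by lra.
  have -> : f j / f N - 1 = (f j - f N) / f N by field; rewrite gt_eqF.
  apply: ler_wpM2l; first by rewrite subr_ge0; exact: nf.
  by rewrite lef_pV2 ?posrE //; exact: nf.
have -> : 2 * B = W * (2 * G 0%N * ((f j - f N) / f 0%N)) by rewrite /B; ring.
rewrite ler_pM2l //; apply: ler_pM => //; first exact: ltW.
by rewrite subr_ge0; exact: nL.
Qed.

(* Skolem surreals that are not presented as sums. *)
Inductive Hf : No -> Prop :=
| Hf_one : Hf 1
| Hf_omega : Hf omg
| Hf_mul F G : SkN F -> SkN G -> infinite_No F -> infinite_No G -> Hf (F * G)
| Hf_pow f G : SkN f -> SkN G -> 2 <= f -> infinite_No G -> Hf (powN f G).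

Lemma Hf_SkN t : Hf t -> SkN t.
Proof.
case=> [||F G SF SG _ _|f G Sf SG _ _].
- exact: SkN_one.
- exact: SkN_omega.
- exact: SkN_mul.
- exact: SkN_pow.
Qed.

Lemma Hf_inf t : Hf t -> t = 1 \/ infinite_No t.
Proof.
case=> [||F G SF SG iF iG|f G Sf SG f2 iG]; [by left|right..].
- exact: omega_infinite.
- by move=> n; apply: lt_le_trans (iF n) _; rewrite ler_peMr ?SkN_ge1 // ltW ?SkN_gt0.
- move=> n; apply: lt_le_trans (iG n) _; apply: powN_ge_exp => //.
  exact/ltW/SkN_gt0.
Qed.

Inductive Hsum : No -> Prop :=
| Hsum_H t : Hf t -> Hsum t
| Hsum_add a b : Hsum a -> Hsum b -> Hsum (a + b).

Lemma Hsum_SkN a : Hsum a -> SkN a.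
Proof. by elim=> [t /Hf_SkN//|{}a b _ Sa _ Sb]; exact: SkN_add. Qed.

Lemma Hsum_mul a b : Hsum a -> Hsum b -> Hsum (a * b).
Proof.
move=> ha hb; elim: ha => [t ht|a1 a2 _ h1 _ h2]; last first.
  by rewrite mulrDl; exact: Hsum_add.
elim: hb => [u hu|b1 b2 _ h1 _ h2]; last by rewrite mulrDr; exact: Hsum_add.
case: (Hf_inf ht) => [->|it]; first by rewrite mul1r; exact: Hsum_H.
case: (Hf_inf hu) => [->|iu]; first by rewrite mulr1; exact: Hsum_H.
by apply/Hsum_H/Hf_mul => //; exact: Hf_SkN.
Qed.

(** Products are expanded by distributivity and powers by a^(b1 + b2) = a^b1 a^b2. A term of [Hf]
    that is not infinite equals 1 and disappears from products and exponents. *)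
Lemma SkN_Hsum a : SkN a -> Hsum a.
Proof.
elim=> [||{}a b _ ha _ hb|{}a b _ ha _ hb|{}a b Sa ha _ hb].
- exact/Hsum_H/Hf_one.
- exact/Hsum_H/Hf_omega.
- exact: Hsum_add.
- exact: Hsum_mul.
case: (SkN_1or2 Sa) => [->|a2]; first by rewrite powN1; exact/Hsum_H/Hf_one.
elim: hb => [u hu|b1 b2 _ h1 _ h2]; last first.
  by rewrite /powN mulrDl ExpD; exact: Hsum_mul.
case: (Hf_inf hu) => [->|iu]; first by rewrite /powN mul1r SkN_LogK.
by apply/Hsum_H/Hf_pow => //; exact: Hf_SkN.
Qed.

Definition dec_rem h := exists t r, [/\ h = t + r, Hf t, SkN r & ll r t].
Definition dec_sum h := exists a b, [/\ h = a + b, SkN a, SkN b &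
  exists m, a <= m%:R * b /\ b <= m%:R * a].

Lemma llD a b c : 0 <= a -> 0 <= b -> ll a c -> ll b c -> ll (a + b) c.
Proof.
move=> a0 b0 ha hb m; have := ha (2 * m)%N; have := hb (2 * m)%N.
by rewrite natrM -!mulrA mulrDr; move: (m%:R * a) (m%:R * b) => X Y; lra.
Qed.

(** Add up the summands: either one atomic term dominates the rest, or the sum splits into two
    comparable parts; smaller contributions are merged into the remainder or into one of the
    parts. *)
Lemma SkN_dec h : SkN h -> Hf h \/ (dec_rem h \/ dec_sum h).
Proof.
move/SkN_Hsum; elim=> [t ht|a b ha Da hb Db]; first by left.
have Sa := Hsum_SkN ha; have Sb := Hsum_SkN hb.
right; clear ha hb.
wlog : a b Da Db Sa Sb / ~ ll a b.
  move=> H; have [ab|] := pselect (ll a b); last exact: H.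
  rewrite addrC; apply: H => // ba; have := ab 1%N; have := ba 1%N.
  by rewrite !mul1r => h1 h2; have := lt_trans h1 h2; rewrite ltxx.
move=> /nllP[m bma]; have [ba|/nllP[m' abm]] := pselect (ll b a); last first.
  right; exists a, b; split=> //; exists (maxn m m').
  have a0 := SkN_gt0 Sa; have b0 := SkN_gt0 Sb.
  split; [apply: le_trans abm _|apply: le_trans bma _];
    by rewrite ler_pM2r // ler_nat ?leq_maxl ?leq_maxr.
have a0 := SkN_gt0 Sa; have b0 := SkN_gt0 Sb.
case: Da => [Ha|[[t [r [Ea Ht Sr rt]]]|[a1 [a2 [Ea S1 S2 [k [h1 h2]]]]]]].
- by left; exists a, b.
- have r0 := SkN_gt0 Sr; have t0 := SkN_gt0 (Hf_SkN Ht).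
  left; exists t, (r + b); split=> //; first by rewrite Ea addrA.
    exact: SkN_add.
  apply: llD => //; do ?exact: ltW.
  apply: (ll_le (k := 2) ba) => //; rewrite Ea; have := rt 1%N; rewrite mul1r; lra.
- have p1 := SkN_gt0 S1; have p2 := SkN_gt0 S2.
  right; exists a1, (a2 + b); split=> //; first by rewrite Ea addrA.
    exact: SkN_add.
  have := ba 1%N; rewrite mul1r Ea => hb.
  exists (k + k + 1)%N; rewrite !natrD; have k0 : 0 <= k%:R :> No by [].
  by split; nra.
Qed.

Lemma pair_subseq (op : No -> No -> No) (P : No -> No -> Prop) (h : nat -> No) phi :
  incr phi ->
  (forall n, exists a b, [/\ h (phi n) = op a b, SkN a, SkN b & P a b]) ->
  exists psi A B, [/\ incr psi, nd A, nd B &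
    forall n, [/\ h (psi n) = op (A n) (B n), SkN (A n), SkN (B n) & P (A n) (B n)]].
Proof.
move=> ip H; have /choice[ab hab] : forall n, exists ab : No * No,
    [/\ h (phi n) = op ab.1 ab.2, SkN ab.1, SkN ab.2 & P ab.1 ab.2].
  by move=> n; have [a [b hn]] := H n; exists (a, b).
have [|a ia na] := @SkN_subseq (fun n => (ab n).1); first by move=> n; have [] := hab n.
have [|b ib nb] := @SkN_subseq (fun n => (ab (a n)).2).
  by move=> n; have [] := hab (a n).
exists (phi \o (a \o b)), (fun n => (ab (a (b n))).1), (fun n => (ab (a (b n))).2).
split=> //; first by do 2?[apply: incr_comp => //].
  by move=> i j ij; apply: na; exact: incr_le.
by move=> n; exact: hab (a (b n)).
Qed.

(** Along a subsequence all terms have the same shape. Leaves are constant; factors, bases and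
    exponents are infinitely smaller than the term, so [ok_below] applies to them. *)
Lemma Hf_stable q w M m t : ok_below q -> 0 < w -> (forall n, Hf (t n)) -> nd t ->
  bnd w M t -> 1 <= m%:R * (w * t 0%N) -> (forall n, exists k, t n <= k%:R * q) ->
  stable w t.
Proof.
move=> ok w0 Ht nt bt ht tq.
have St n : SkN (t n) by exact: Hf_SkN.
have t0 n : 0 < t n by exact: SkN_gt0.
have hm phi : 1 <= m%:R * (w * t (phi 0%N)).
  apply: le_trans ht _; apply: ler_wpM2l => //; rewrite ler_pM2l //; exact: nt.
have cst phi x : incr phi -> (forall n, t (phi n) = x) -> stable w t.
  move=> ip E; apply: (stable_sub w0 nt ip); exists 0%N => j _.
  by apply: tv0; rewrite /= !E subrr mulr0.
pose ismul x := exists F G, [/\ x = F * G, SkN F, SkN G & infinite_No F /\ infinite_No G].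
pose ispow x := exists f G, [/\ x = powN f G, SkN f, SkN G & 2 <= f /\ infinite_No G].
have c1 n : (t n = 1 \/ t n = omg) \/ (ismul (t n) \/ ispow (t n)).
  case: (Ht n) => [||F G SF SG iF iG|f G Sf SG f2 iG].
  - by left; left.
  - by left; right.
  - by right; left; exists F, G.
  - by right; right; exists f, G.
have [p1 i1 [leaf|op]] := inf_or c1.
  have [p2 i2 [h|h]] := inf_or leaf; exact: (cst _ _ (incr_comp i1 i2) h).
have [p2 i2 [h|h]] := inf_or op; have ip := incr_comp i1 i2; set phi := p1 \o p2 in ip.
- have [psi [F [G [ipsi nF nG hFG]]]] := pair_subseq ip h.
  apply: (stable_sub w0 nt ipsi).
  have E n : t (psi n) = F n * G n by have [] := hFG n.
  have SF n : SkN (F n) by have [] := hFG n.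
  have SG n : SkN (G n) by have [] := hFG n.
  have iF n : infinite_No (F n) by have [_ _ _ []] := hFG n.
  have iG n : infinite_No (G n) by have [_ _ _ []] := hFG n.
  have F0 n := SkN_gt0 (SF n); have G0 n := SkN_gt0 (SG n).
  apply: (stable_ext (fun n => esym (E n))).
  apply: (@prod_stable q w M m) => //.
  + have := @bnd_sub w M t psi w0 nt bt.
    by congr (bnd _ _ _); apply/funext => n /=; exact: E.
  + by rewrite -E; exact: hm.
  + move=> n; have [k hk] := tq (psi n); apply: (ll_le (k := k) _ (t0 (psi n)) hk).
    by move=> l; rewrite E mulrC ltr_pM2l //; exact: iG.
  + move=> n; have [k hk] := tq (psi n); apply: (ll_le (k := k) _ (t0 (psi n)) hk).
    by move=> l; rewrite E ltr_pM2r //; exact: iF.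
- have [psi [F [G [ipsi nF nG hFG]]]] := pair_subseq ip h.
  apply: (stable_sub w0 nt ipsi).
  have E n : t (psi n) = powN (F n) (G n) by have [] := hFG n.
  have SF n : SkN (F n) by have [] := hFG n.
  have SG n : SkN (G n) by have [] := hFG n.
  have F2 n : 2 <= F n by have [_ _ _ []] := hFG n.
  have iG n : infinite_No (G n) by have [_ _ _ []] := hFG n.
  have F0 n := SkN_gt0 (SF n); have G0 n := SkN_gt0 (SG n).
  have L2 n : 1 / 2 <= Log (F n) by exact: Log_ge_half.
  apply: (stable_ext (fun n => esym (E n))).
  apply: (@pow_stable q w M m) => //.
  + have := @bnd_sub w M t psi w0 nt bt.
    by congr (bnd _ _ _); apply/funext => n /=; exact: E.
  + by rewrite -E; exact: hm.
  + move=> n; have [k hk] := tq (psi n); apply: (ll_le (k := k) _ (t0 (psi n)) hk).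
    move=> l; rewrite E /powN.
    have -> : G n * Log (F n) = Log (F n) + (G n - 1) * Log (F n) by ring.
    rewrite ExpD SkN_LogK // mulrC ltr_pM2l //; apply: lt_le_trans (Exp_ge1D _).
    have g1 := iG n (2 * l + 1)%N; rewrite natrD natrM in g1.
    have l0 : 0 <= l%:R :> No by [].
    have : (G n - 1) * (1 / 2) <= (G n - 1) * Log (F n) by rewrite ler_pM2l //; lra.
    by lra.
  + move=> n; have [k hk] := tq (psi n); apply: (ll_le (k := k) _ (t0 (psi n)) hk).
    move=> l; rewrite E /powN; apply: (@lt_le_trans _ _ (Exp (G n / 2))); last first.
      by rewrite Exp_le ler_pM2l //; have := L2 n; lra.
    have ih : infinite_No (G n / 2).
      by move=> i; have := iG n (2 * i)%N; rewrite natrM; lra.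
    have := pow_lt_Exp 1 (2 * l) ih; rewrite expr1 natrM.
    by apply: le_lt_trans; apply: eq_ler; field.
Qed.

(** Outer induction on q along the well-founded order of Skolem surreals, inner induction on a
    natural bound for the ratio to the least element of the class of q. *)
Lemma core_stable q : SkN q -> forall w M h, 0 < w -> (forall n, SkN (h n)) -> nd h ->
  bnd w M h -> (forall n, exists k, h n <= k%:R * q) -> stable w h.
Proof.
move=> Sq; have Aq := SkN_Acc Sq; elim: Aq Sq => {}q _ IH Sq.
have q0 := SkN_gt0 Sq.
(* either the sequence is negligible for w, or it may be rebased *)
have rebase w M h : 0 < w -> (forall n, SkN (h n)) -> nd h -> bnd w M h ->
    stable w h \/ exists n0 m, [/\ forall k, 1 <= m%:R * (w * h (n0 + k)%N) &
      forall k, h (n0 + k)%N <= (M * m + 1)%:R * h n0].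
  move=> w0 Sh nh bh.
  have [H|H] := pselect (forall n, tv (w * h n)).
    left; exists 0%N => j _; apply: tv_le (H j).
    by rewrite ler_pM2l // gerBl ltW // SkN_gt0.
  right; apply: contrapT => H'; apply: H => n m; rewrite leNgt; apply/negP => h1.
  apply: H'; exists n, m; split=> k.
    apply: ltW; apply: lt_le_trans h1 _; apply: ler_wpM2l => //.
    by rewrite ler_pM2l //; apply: nh; exact: leq_addr.
  have hn := SkN_gt0 (Sh n).
  have : w * (h (n + k)%N - h n) <= M%:R.
    by apply: le_trans (bh (n + k)%N); rewrite ler_pM2l // lerD2l lerN2; exact: nh.
  move=> h2; have : w * (h (n + k)%N - h n) <= w * ((M * m)%:R * h n).
    apply: le_trans h2 _; rewrite natrM.
    have := ler_wpM2l (ler0n No M) (ltW h1); rewrite mulr1 => /le_trans; apply.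
    by apply: eq_ler; ring.
  by rewrite ler_pM2l // natrD mulrDl mul1r; lra.
have shift n0 : incr (addn n0) by move=> i j ij; rewrite ltn_add2l.
(* After rebasing, the sequence is dominated by its own term h n0 < q, where the outer induction
   hypothesis holds. *)
have ok : ok_below q.
  move=> w M h w0 Sh nh bh lh.
  case: (rebase w M h w0 Sh nh bh) => [//|[n0 [m [h1 h2]]]].
  apply: (stable_sub w0 nh (shift n0)).
  have lt : h n0 < q by have := lh n0 1%N; rewrite mul1r.
  apply: (IH (h n0) (conj (Sh n0) lt) (Sh n0) w M) => //.
  - by move=> n; exact: Sh.
  - by apply: nd_sub => //; exact: shift.
  - exact: bnd_sub.
  - by move=> n; eexists; exact: h2.
(* [qs] is the least Skolem surreal in the class of q: every Skolem surreal of that class or above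
   is at least [qs]. *)
have [qs [Sqs [ms hms]] qmin] : exists2 qs, SkN qs /\ (exists m, q <= m%:R * qs) &
    forall y, SkN y /\ (exists m, q <= m%:R * y) -> qs <= y.
  apply: (@Acc_min (fun x => SkN x /\ (exists m, q <= m%:R * x)) q).
  - exact: SkN_Acc.
  - by split=> //; exists 1%N; rewrite mul1r.
  - by move=> y [].
have qs0 := SkN_gt0 Sqs.
(* In a sum of two comparable terms of this class both are at least [qs], so each is at most one
   [qs] less than the sum and N decreases. *)
have inner N : forall w M m h, 0 < w -> (forall n, SkN (h n)) -> nd h -> bnd w M h ->
    1 <= m%:R * (w * h 0%N) -> (forall n, exists k, h n <= k%:R * q) ->
    (exists k, q <= k%:R * h 0%N) -> (forall n, h n <= N%:R * qs) -> stable w h.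
  elim: N => [|N IHN] w M m h w0 Sh nh bh hm hq hk hN.
    by have := hN 0%N; have := SkN_gt0 (Sh 0%N); rewrite mul0r; lra.
  have hm' n : 1 <= m%:R * (w * h n).
    by apply: le_trans hm _; apply: ler_wpM2l => //; rewrite ler_pM2l //; exact: nh.
  have hk' n : exists k, q <= k%:R * h n.
    case: hk => k hk; exists k; apply: le_trans hk _; apply: ler_wpM2l => //; exact: nh.
  have [p1 i1 [HH|H]] := inf_or (fun n => SkN_dec (Sh n)).
    apply: (stable_sub w0 nh i1); apply: (@Hf_stable q w M m) => //.
    - exact: nd_sub.
    - exact: bnd_sub.
    - exact: hm'.
    - by move=> n; exact: hq.
  have [p2 i2 [Hr|Hs]] := inf_or H; have ip := incr_comp i1 i2; set phi := p1 \o p2 in ip.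
    have [psi [t [r [ipsi nt nr htr]]]] := @pair_subseq _ (fun t r => Hf t /\ ll r t) _ _ ip
      (fun n => let: ex_intro t (ex_intro r (And4 e ht sr l)) := Hr n in
        ex_intro _ t (ex_intro _ r (And4 e (Hf_SkN ht) sr (conj ht l)))).
    apply: (stable_sub w0 nh ipsi).
    have E n : h (psi n) = t n + r n by have [] := htr n.
    have Ht n : Hf (t n) by have [_ _ _ []] := htr n.
    have Sr n : SkN (r n) by have [] := htr n.
    have rt n : ll (r n) (t n) by have [_ _ _ []] := htr n.
    have t0 n := SkN_gt0 (Hf_SkN (Ht n)); have r0 n := SkN_gt0 (Sr n).
    have bt : bnd w M t.
      move=> n; apply: le_trans (@bnd_sub w M h psi w0 nh bh n); rewrite /= !E ler_pM2l //.
      by have := nr 0%N n isT; lra.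
    have br : bnd w M r.
      move=> n; apply: le_trans (@bnd_sub w M h psi w0 nh bh n); rewrite /= !E ler_pM2l //.
      by have := nt 0%N n isT; lra.
    have tq n : exists k, t n <= k%:R * q.
      have [k hk1] := hq (psi n); exists k; apply: le_trans hk1.
      by rewrite E lerDl ltW.
    apply: (stable_ext (fun n => esym (E n))); apply: stableD => //.
      apply: (@Hf_stable q w M (m * 2)) => //.
      apply: le_trans (hm' (psi 0%N)) _; rewrite natrM -mulrA; apply: ler_wpM2l => //.
      rewrite mulrCA ler_pM2l // E; have := rt 0%N 1%N; rewrite mul1r; lra.
    apply: (ok w M r) => // n; have [k hk1] := tq n.
    exact: (ll_le (rt n) (t0 n) hk1).
  have [psi [t [r [ipsi nt nr htr]]]] := pair_subseq ip Hs.
  apply: (stable_sub w0 nh ipsi).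
  have E n : h (psi n) = t n + r n by have [] := htr n.
  have St n : SkN (t n) by have [] := htr n.
  have Sr n : SkN (r n) by have [] := htr n.
  have tr n : exists k, t n <= k%:R * r n /\ r n <= k%:R * t n by have [] := htr n.
  have t0 n := SkN_gt0 (St n); have r0 n := SkN_gt0 (Sr n).
  have bt : bnd w M t.
    move=> n; apply: le_trans (@bnd_sub w M h psi w0 nh bh n); rewrite /= !E ler_pM2l //.
    by have := nr 0%N n isT; lra.
  have br : bnd w M r.
    move=> n; apply: le_trans (@bnd_sub w M h psi w0 nh bh n); rewrite /= !E ler_pM2l //.
    by have := nt 0%N n isT; lra.
  have tq n : exists k, t n <= k%:R * q.
    have [k hk1] := hq (psi n); exists k; apply: le_trans hk1.
    by rewrite E lerDl ltW.
  have rq n : exists k, r n <= k%:R * q.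
    have [k hk1] := hq (psi n); exists k; apply: le_trans hk1.
    by rewrite E lerDr ltW.
  have qt n : exists k, q <= k%:R * t n.
    have [k1 [_ h2]] := tr n; have [k2 h3] := hk' (psi n).
    exists (k2 * (k1 + 1))%N; apply: le_trans h3 _; rewrite natrM -mulrA.
    by apply: ler_wpM2l => //; rewrite E natrD mulrDl mul1r; lra.
  have qr n : exists k, q <= k%:R * r n.
    have [k1 [h2 _]] := tr n; have [k2 h3] := hk' (psi n).
    exists (k2 * (k1 + 1))%N; apply: le_trans h3 _; rewrite natrM -mulrA.
    by apply: ler_wpM2l => //; rewrite E natrD mulrDl mul1r; lra.
  have qst n : qs <= t n by apply: qmin; split.
  have qsr n : qs <= r n by apply: qmin; split.
  have hNp n : t n + r n <= N.+1%:R * qs by rewrite -E; exact: hN.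
  (* The weight remains non-infinitesimal on each summand, since the sum is at most N+1 times
     [qs]. *)
  have mm x : qs <= x -> 1 <= (m * N.+1)%:R * (w * x).
    move=> qx; apply: le_trans (hm' (psi 0%N)) _; rewrite natrM -mulrA.
    apply: ler_wpM2l => //; rewrite mulrCA ler_pM2l //; apply: le_trans (hN _) _.
    by apply: ler_wpM2l.
  apply: (stable_ext (fun n => esym (E n))); apply: stableD => //.
    apply: (IHN w M (m * N.+1)%N t) => //; first exact: mm.
    by move=> n; have := hNp n; have := qsr n; rewrite -natr1; lra.
  apply: (IHN w M (m * N.+1)%N r) => //; first exact: mm.
  by move=> n; have := hNp n; have := qst n; rewrite -natr1; lra.
move=> w M h w0 Sh nh bh hq.
case: (rebase w M h w0 Sh nh bh) => [//|[n0 [m [h1 h2]]]].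
apply: (stable_sub w0 nh (shift n0)).
have [lt|nlt] := pselect (ll (h n0) q).
  apply: (ok w M) => //.
  - by move=> n; exact: Sh.
  - by apply: nd_sub => //; exact: shift.
  - exact: bnd_sub.
  - move=> n l; have hn := SkN_gt0 (Sh n0).
    apply: le_lt_trans (lt (l * (M * m + 1))%N); rewrite natrM -mulrA.
    by apply: ler_wpM2l => //; exact: h2.
have [k0 hk0] := nllP nlt; have [k1 hk1] := hq n0.
have [k2 hk2] : exists k, h n0 <= k%:R * qs.
  exists (k1 * ms)%N; apply: le_trans hk1 _; rewrite natrM -mulrA; exact: ler_wpM2l.
apply: (inner ((M * m + 1) * k2)%N w M m) => //.
- by move=> n; exact: Sh.
- by apply: nd_sub => //; exact: shift.
- exact: bnd_sub.
- exact: h1.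
- by move=> n; exact: hq.
- by exists k0; rewrite /= addn0.
- move=> n; apply: le_trans (h2 n) _; rewrite natrM -mulrA; exact: ler_wpM2l.
Qed.

(** * Real numbers and the asymptotic relations *)

Lemma gintP m : surreal (gint m) /\ cl (gint m) = m%:~R.
Proof.
case: m => n /=; first by split; [exact: surreal_nat|rewrite cl_nat].
have sn := surreal_nat n.+1; split; first exact: surreal_neg.
by rewrite [LHS](clN sn) cl_nat NegzE mulrNz.
Qed.

Lemma gratP q : surreal (grat q) /\ cl (grat q) = ratr q.
Proof.
have [s1 e1] := gintP (numq q); have [s2 e2] := gintP (denq q).
by split; [exact: surreal_div|rewrite cl_div // e1 e2].
Qed.

Section Reals.
Variable R : realType.
Implicit Types r : R.

Lemma greal_opt s r a : Op s (greal r) a <->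
  exists2 q : rat, (if s then ratr q < r else r < ratr q) & a = grat q.
Proof.
case: s; split=> [[[q hq] ->]|[q hq ->]].
- by exists q.
- by exists (exist (fun q : rat => ratr q < r) q hq).
- by exists q.
- by exists (exist (fun q : rat => r < ratr q) q hq).
Qed.

Lemma surreal_real r : surreal (greal r).
Proof.
apply/surrealP; split=> [a b /greal_opt[q hq ->] /greal_opt[q' hq' ->]|s a /greal_opt[q _ ->]].
  have [s1 e1] := gratP q; have [s2 e2] := gratP q'; apply/cl_lt => //.
  by rewrite e1 e2 ltr_rat -(ltr_rat R); exact: lt_trans hq'.
by have [] := gratP q.
Qed.

Lemma cl_real_gt r (q : rat) : ratr q < r -> ratr q < cl (greal r).
Proof.
have [_ <-] := gratP q => h; apply: (@cl_opt true); first exact: surreal_real.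
by apply/greal_opt; exists q.
Qed.

Lemma cl_real_lt r (q : rat) : r < ratr q -> cl (greal r) < ratr q.
Proof.
have [_ <-] := gratP q => h; apply: (@cl_opt false); first exact: surreal_real.
by apply/greal_opt; exists q.
Qed.

Lemma gabsP x : surreal x -> surreal (gabs x) /\ cl (gabs x) = `|cl x|.
Proof.
move=> sx; have s0 := surreal_zero; rewrite /gabs; case: asboolP => h.
  by split=> //; rewrite ger0_norm // -cl0; apply/cl_le.
split; first exact: surreal_neg.
rewrite clN // ltr0_norm // -cl0; exact/cl_lt.
Qed.

Definition sim (y z : No) := forall m, m%:R * `|y - z| < `|y|.

Lemma gsim_sim f g : surreal f -> surreal g -> gsim f g -> sim (cl f) (cl g).
Proof.
move=> sf sg [h1 h2] m; rewrite ltNge; apply/negP => h; apply: h2; split=> //.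
have sfg := surreal_sub sf sg; have [sa ea] := gabsP sf; have [sb eb] := gabsP sfg.
have sn := surreal_nat m; have sm := surreal_mul sn sb.
by exists m; apply/cl_le => //; rewrite ea clM // cl_nat eb clB.
Qed.

Lemma rat_between r r' : r < r' -> exists q : rat, r < ratr q < r'.
Proof.
by move=> /rat_in_itvoo[q]; rewrite in_itv /= => h; exists q.
Qed.

Lemma archi_mul_gt (F : archiRealFieldType) (a b : F) : 0 < b ->
  exists2 m, (1 < m)%N & a < m%:R * b.
Proof.
move=> b0; exists (Num.bound (a / b)).+2 => //; rewrite -ltr_pdivrMr //.
have [h|h] := ltrP (a / b) 0; first by apply: lt_le_trans h _; rewrite ler0n.
apply: lt_le_trans (archi_boundP h) _; rewrite ler_nat; lia.
Qed.

Lemma rat_sep (p p' : rat) : p < p' -> exists2 m, (1 < m)%N &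
  8 * ratr p' < m%:R * (ratr p' - ratr p) :> No.
Proof.
rewrite -subr_gt0 => /(archi_mul_gt (8 * p'))[m m1 h]; exists m => //.
have := h; rewrite -(ltr_rat No) => {h} h.
have E1 : ratr (8 * p') = 8 * ratr p' :> No by rewrite rmorphM /= ratr_nat.
have E2 : ratr (m%:R * (p' - p)) = m%:R * (ratr p' - ratr p) :> No.
  by rewrite rmorphM rmorphB /= ratr_nat.
by rewrite -E1 -E2.
Qed.

Lemma ratio_lt_sep (m P P' y y' : No) : 1 < m -> 0 < P -> P < P' ->
  8 * P' < m * (P' - P) -> (m - 1) * y < m * P -> m * P' < (m + 1) * y' ->
  m * y' <= (m + 1) * y -> False.
Proof.
move=> m1 P0 PP hm b1 b2 b3; have mp : 0 < m by lra.
have c1 : (m - 1) * (m * (m * P')) < (m - 1) * (m * ((m + 1) * y')).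
  by rewrite ltr_pM2l ?ltr_pM2l //; lra.
have c2 : (m - 1) * (m + 1) * (m * y') <= (m - 1) * (m + 1) * ((m + 1) * y).
  by rewrite ler_pM2l // mulr_gt0; lra.
have c3 : (m + 1) * (m + 1) * ((m - 1) * y) < (m + 1) * (m + 1) * (m * P).
  by rewrite ltr_pM2l // mulr_gt0; lra.
have c4 : m * ((m - 1) * m * P') < m * ((m + 1) * (m + 1) * P) by lra.
rewrite ltr_pM2l // in c4.
have c5 : m * (8 * P') < m * (m * (P' - P)) by rewrite ltr_pM2l.
have c6 : m * P < m * P' by rewrite ltr_pM2l.
have c7 : 1 * P <= m * P by rewrite ler_pM2r // ltW.
suff : (0 : No) < 0 by rewrite ltxx.
by lra.
Qed.

Lemma ratio_gt_sep (m P P' y : No) : 1 < m -> 0 < P -> P < P' ->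
  8 * P' < m * (P' - P) -> m * P' < (m + 1) * y -> (m - 1) * y < m * P -> False.
Proof.
move=> m1 P0 PP hm b1 b2; have mp : 0 < m by lra.
have c1 : (m - 1) * (m * P') < (m - 1) * ((m + 1) * y) by rewrite ltr_pM2l //; lra.
have c2 : (m + 1) * ((m - 1) * y) < (m + 1) * (m * P) by rewrite ltr_pM2l //; lra.
have c3 : m * ((m - 1) * P') < m * ((m + 1) * P) by lra.
rewrite ltr_pM2l // in c3.
suff : (0 : No) < 0 by rewrite ltxx.
by lra.
Qed.

(** Distinct reals would be separated by two rationals, hence by a factor not infinitely close to 1,
    whereas y'/y = exp d with d infinitesimal. *)
Lemma sim_real_eq r r' (y y' d : No) : 0 < r -> 0 < r' -> 0 < y -> y <= y' ->
  0 <= d -> tv d -> y' = y * Exp d ->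
  sim y (cl (greal r)) -> sim y' (cl (greal r')) -> r = r'.
Proof.
move=> r0 r0' y0 yy d0 td Ey hy hy'.
have y0' : 0 < y' by apply: lt_le_trans yy.
have sep (a a' : R) : 0 < a -> a < a' -> exists p p' : rat, [/\ 0 < p, p < p',
    cl (greal a) < ratr p & ratr p' < cl (greal a')].
  move=> a0 aa; have [p /andP[h1 h2]] := rat_between aa.
  have [p' /andP[h3 h4]] := rat_between h2.
  exists p, p'; split.
  - by rewrite -(ltr_rat R) rmorph0; exact: lt_trans h1.
  - by rewrite -(ltr_rat R).
  - exact: cl_real_lt.
  - exact: cl_real_gt.
have simb z (x : R) m : 0 < z -> sim z (cl (greal x)) ->
    (m%:R * z < m%:R * cl (greal x) + z) /\ (m%:R * cl (greal x) < m%:R * z + z).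
  move=> z0 /(_ m); rewrite (gtr0_norm z0) -[m%:R in X in X -> _](@ger0_norm No) //.
  by rewrite -normrM ltr_norml mulrBr => /andP[]; split; lra.
have E4 : Exp d <= 1 + 2 * d.
  have d4 := td 4%N; have := @Exp_quad d; rewrite ger0_norm // => h.
  by have := h _; rewrite expr2; nra.
have sepP (a a' : R) : 0 < a -> a < a' -> exists m P P', [/\ [/\ 1 < m%:R :> No, 0 < P & P < P'],
    8 * P' < m%:R * (P' - P), m%:R * cl (greal a) < m%:R * P &
    m%:R * P' < m%:R * cl (greal a')].
  move=> a0 aa; have [p [p' [p0 pp h1 h2]]] := sep _ _ a0 aa.
  have [m m1 hm] := rat_sep pp; exists m, (ratr p), (ratr p').
  have m0 : 0 < m%:R :> No by rewrite ltr0n ltnW.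
  by split; [split; rewrite ?ltr1n ?ltr0q ?ltr_rat|exact: hm|rewrite ltr_pM2l|rewrite ltr_pM2l].
apply: contrapT => ne; have /orP[lt|lt] : (r < r') || (r' < r).
- by rewrite -neq_lt; apply/eqP.
- have [m [P [P' [[m1 P0 PP] hm h1 h2]]]] := sepP _ _ r0 lt.
  have [a1 _] := simb _ _ m y0 hy; have [_ a2] := simb _ _ m y0' hy'.
  apply: (ratio_lt_sep m1 P0 PP hm (y := y) (y' := y')); [lra|lra|].
  have dm := td (2 * m)%N; rewrite natrM in dm.
  have m0 : 0 < m%:R :> No by lra.
  have g1 : m%:R * y' <= m%:R * (y * (1 + 2 * d)) by rewrite ler_pM2l // Ey ler_pM2l.
  have g2 : y * (2 * m%:R * d) <= y * 1 by rewrite ler_pM2l.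
  by lra.
- have [m [P [P' [[m1 P0 PP] hm h1 h2]]]] := sepP _ _ r0' lt.
  have [_ a1] := simb _ _ m y0 hy; have [a2 _] := simb _ _ m y0' hy'.
  apply: (ratio_gt_sep m1 P0 PP hm (y := y')); last lra.
  have g1 : (m%:R + 1) * y <= (m%:R + 1) * y' by rewrite ler_pM2l //; lra.
  by lra.
Qed.

Lemma Sk_graph_SkN (f : {posnum R} -> {posnum R}) a : Sk_graph f a -> surreal a /\ SkN (cl a).
Proof.
elim=> {f a} [||f g a b _ [sa Ka] _ [sb Kb]|f g a b _ [sa Ka] _ [sb Kb]
  |f g a b _ [sa Ka] _ [sb Kb]].
- by split; [exact: surreal_one|exact: SkN_one].
- by split; [exact: surreal_omega|exact: SkN_omega].
- by split; [exact: surreal_add|rewrite clD //; exact: SkN_add].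
- by split; [exact: surreal_mul|rewrite clM //; exact: SkN_mul].
have [la _] := SkN_log_ge1 Ka; have [sl El] := glogP sa la.
have sbl := surreal_mul sb sl.
split; first exact: surreal_exp.
rewrite /gpow Exp_cl // clM //; have -> : cl (glog a) = Log (cl a).
  by apply: Exp_inj; rewrite El LogK.
exact: SkN_pow.
Qed.

(* A bounded injective sequence of such reals would come, along a subsequence,*)
(* from a nondecreasing sequence of Skolem surreals; with the weight c / h_0  *)
(* it is bounded, hence stable, and two consecutive reals coincide.           *)
Lemma no_bounded_sequence (c q : No) (a : nat -> No) (r : nat -> R) (B : R) :
  1 <= c -> SkN q -> (forall n, SkN (a n)) -> (forall n, 0 < r n <= B) -> injective r ->
  (forall n, sim (Exp (c * (Log (a n) - Log q))) (cl (greal (r n)))) -> False.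
Proof.
move=> c1 Sq Sa rB ir ha; have [phi iphi na] := SkN_subseq Sa.
pose b n := a (phi n); have Sb n : SkN (b n) by exact: Sa.
have b0 n := SkN_gt0 (Sb n); have c0 : 0 < c by lra.
pose y n := Exp (c * (Log (b n) - Log q)).
have y0 n : 0 < y n by exact: Exp_gt0.
have hy n : sim (y n) (cl (greal (r (phi n)))) by exact: ha.
have [N hN] : exists N : nat, B < N%:R.
  by have [N _] := archi_mul_gt B (@ltr01 R); rewrite mulr1; exists N.
have [k hk] : exists k : nat, 1 < k%:R * r (phi 0%N).
  have /andP[r0 _] := rB (phi 0%N).
  by have [k _] := archi_mul_gt 1 r0; exists k.
have yU n : y n < 2 * N%:R.
  have : cl (greal (r (phi n))) < ratr N%:R.
    by apply: cl_real_lt; rewrite ratr_nat; have /andP[_ h] := rB (phi n); exact: le_lt_trans hN.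
  rewrite ratr_nat; have := hy n 2%N; rewrite (gtr0_norm (y0 n)).
  by have := ler_norm (y n - cl (greal (r (phi n)))); lra.
have k0 : (0 < k)%N by case: (k) hk => //; rewrite mul0r ltr10.
have yL : 1 < 2 * k%:R * y 0%N.
  have k0K : 0 < k%:R :> No by rewrite ltr0n.
  have : ratr k%:R^-1 < cl (greal (r (phi 0%N))).
    apply: cl_real_gt; rewrite fmorphV /= ratr_nat -[ltLHS]mul1r ltr_pdivrMr ?ltr0n //.
    by rewrite mulrC.
  rewrite fmorphV /= ratr_nat -[_^-1]mul1r ltr_pdivrMr //.
  have := hy 0%N 2%N; rewrite (gtr0_norm (y0 0%N)) distrC.
  have h := ler_norm (cl (greal (r (phi 0%N))) - y 0%N) => h1 h2.
  have h3 : cl (greal (r (phi 0%N))) < 2 * y 0%N by move: (y0 0%N); lra.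
  have : cl (greal (r (phi 0%N))) * k%:R < 2 * y 0%N * k%:R by rewrite ltr_pM2r.
  by lra.
(* From y n < 2N and y 0 > 1/(2k), the ratio y n / y 0 is below 4Nk. *)
pose K := (4 * N * k)%N.
have nL i j : (i <= j)%N -> 0 <= Log (b j) - Log (b i).
  by move=> ij; rewrite subr_ge0 -Exp_le !SkN_LogK //; exact: na.
have yE i j : y j = y i * Exp (c * (Log (b j) - Log (b i))).
  by rewrite /y -ExpD; congr Exp; ring.
have cL n : c * (Log (b n) - Log (b 0%N)) <= K%:R.
  have h1 : y n <= K%:R * y 0%N.
    apply: ltW; apply: lt_trans (yU n) _; rewrite /K !natrM.
    have N0 : 0 < N%:R :> No.
      rewrite ltr0n; case: (N) hN => // hB; have /andP[r1 r2] := rB 0%N.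
      by have := lt_trans (lt_le_trans r1 r2) hB; rewrite ltxx.
    have : 2 * N%:R * 1 < 2 * N%:R * (2 * k%:R * y 0%N) by rewrite ltr_pM2l // mulr_gt0.
    by lra.
  have h2 : Exp (c * (Log (b n) - Log (b 0%N))) <= K%:R.
    by rewrite -(ler_pM2l (y0 0%N)) -yE mulrC.
  by have := Exp_ge1D (c * (Log (b n) - Log (b 0%N))); lra.
have [E hE] := Exp_nat_fin K.
(* The increment of c log b is, to first order, c / b 0 times the increment of b. *)
pose w := c / b 0%N; have w0 : 0 < w by exact: divr_gt0.
have bE i j : b j = b i * Exp (Log (b j) - Log (b i)).
  by rewrite ExpD ExpN !SkN_LogK // mulrC divfK // gt_eqF.
(* Here c >= 1 enters: the bound on c times a nonnegative logarithm bounds the logarithm itself. *)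
have LK n : Log (b n) - Log (b 0%N) <= K%:R.
  by apply: le_trans (cL n); rewrite ler_peMl // nL.
have bnd_b : bnd w (K * E) b.
  move=> n; pose d := Log (b n) - Log (b 0%N).
  have d0 : 0 <= d by exact: nL.
  have -> : w * (b n - b 0%N) = c * (Exp d - 1).
    by rewrite (bE 0%N n) /w -/d; field; rewrite gt_eqF.
  have e1 : Exp d <= E%:R by apply: le_trans hE; rewrite Exp_le; exact: LK.
  have e2 : Exp d - 1 <= d * E%:R.
    have h := Exp_ge1D (- d); rewrite ExpN in h.
    have {}h : (1 - d) * Exp d <= 1 by rewrite -ler_pdivlMr ?Exp_gt0 // mul1r.
    by have := ler_wpM2l d0 e1; lra.
  have g1 : c * (Exp d - 1) <= c * (d * E%:R) by rewrite ler_pM2l.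
  apply: le_trans g1 _; rewrite mulrA natrM; apply: ler_wpM2r => //; exact: cL.
have bq n : exists m, b n <= m%:R * b 0%N.
  exists E; rewrite (bE 0%N n) mulrC ler_pM2r //.
  by apply: le_trans hE; rewrite Exp_le; exact: LK.
have [M hM] := core_stable (Sb 0%N) w0 Sb na bnd_b bq.
have tM := hM M.+1 (leqnSn M).
pose d := c * (Log (b M.+1) - Log (b M)).
have d0 : 0 <= d by rewrite mulr_ge0 ?nL // ltW.
have td : tv d.
  apply: tv_le tM; rewrite /d /w -mulrA ler_pM2l //.
  have h : Log (b M.+1) - Log (b M) <= b M.+1 / b M - 1.
    have Eb : b M.+1 / b M = Exp (Log (b M.+1) - Log (b M)).
      by rewrite ExpD ExpN !SkN_LogK.
    by have := Exp_ge1D (Log (b M.+1) - Log (b M)); rewrite Eb; lra.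
  apply: le_trans h _; have -> : b M.+1 / b M - 1 = (b M)^-1 * (b M.+1 - b M).
    by field; rewrite gt_eqF.
  apply: ler_wpM2r; first by rewrite subr_ge0; exact: na.
  by rewrite lef_pV2 ?posrE //; exact: na.
have /ir E1 : r (phi M) = r (phi M.+1).
  have /andP[r1 _] := rB (phi M); have /andP[r2 _] := rB (phi M.+1).
  apply: (sim_real_eq (d := d) r1 r2 (y0 M) _ d0 td _ (hy M) (hy M.+1)); last exact: yE.
  rewrite (yE M M.+1) ler_peMr ?(ltW (y0 M)) //.
  by apply: le_trans (Exp_ge1D _); rewrite -/d; lra.
by have := iphi _ _ (ltnSn M); rewrite E1 ltnn.
Qed.

(** * Locally finite sets of reals *)

Lemma seq_min (s : seq R) : s != [::] -> exists2 m, m \in s & forall x, x \in s -> m <= x.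
Proof.
elim: s => // x s IH _; have [->|/IH[m ms hm]] := eqVneq s [::].
  by exists x; [rewrite mem_head|move=> y; rewrite inE => /eqP ->].
have [xm|mx] := leP x m.
  exists x; first exact: mem_head.
  by move=> y; rewrite inE => /orP[/eqP -> //|/hm]; exact: le_trans.
exists m; first by rewrite inE ms orbT.
by move=> y; rewrite inE => /orP[/eqP ->|/hm //]; exact: ltW.
Qed.

Lemma locally_finite_set (S : set R) :
  (forall B, finite_set (S `&` [set r | r <= B])) ->
  [/\ well_ordered_set S, limit_point S = set0 & embeds_in_omega S].
Proof.
move=> fin; have /choice[s hs] : forall B, exists s : seq R, S `&` [set r | r <= B] = [set` s].
  by move=> B; have /finite_seqP := fin B.
have hsP B x : x \in s B <-> S x /\ x <= B.
  by rewrite (_ : x \in s B <-> [set` s B] x) // -hs.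
split.
- move=> C CS [b Cb].
  have [|m ms hm] := @seq_min [seq x <- s b | `[< C x >]].
    apply/negP => /eqP E; have : b \in [seq x <- s b | `[< C x >]].
      by rewrite mem_filter; apply/andP; split; [exact/asboolP|apply/hsP; split=> //; exact: CS].
    by rewrite E.
  move: ms; rewrite mem_filter => /andP[/asboolP Cm /hsP[_ mb]].
  exists m => // x Cx; have [xb|bx] := leP x b; last by apply: le_trans mb (ltW bx).
  apply: hm; rewrite mem_filter; apply/andP; split; first exact/asboolP.
  by apply/hsP; split=> //; exact: CS.
(* Only finitely many elements lie below t + 1, so a small ball around t contains none except
   possibly t. *)
- apply/seteqP; split=> // t lt.
  have sep (u : seq R) : exists2 e, 0 < e & forall x, x \in u -> x != t -> e <= `|t - x|.
    elim: u => [|x u [e e0 he]]; first by exists 1.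
    have [->|xt] := eqVneq x t.
      by exists e => // y; rewrite inE => /orP[/eqP -> /eqP//|/he].
    exists (Num.min e `|t - x|).
      by rewrite lt_min e0 normr_gt0 subr_eq0 eq_sym.
    move=> y; rewrite inE => /orP[/eqP -> _|/he h /h].
      by rewrite ge_min lexx orbT.
    by apply: le_trans; rewrite ge_min lexx.
  have [e e0 he] := sep (s (t + 1)).
  have e1 : 0 < Num.min e 1 by rewrite lt_min e0 ltr01.
  have [y [yt Sy]] := lt _ (nbhsx_ballx t _ e1).
  rewrite -ball_normE /= lt_min => /andP[h1 h2].
  have : y \in s (t + 1).
    apply/hsP; split=> //; move: h2; rewrite ltr_norml => /andP[h _]; lra.
  by move/he => /(_ yt); rewrite leNgt h1.
(* The index counts the elements of [S] up to x. *)
- exists (fun x => size (undup (s x))) => x y Sx Sy xy.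
  have : {subset y :: undup (s x) <= undup (s y)}.
    move=> z; rewrite inE !mem_undup => /orP[/eqP ->|/hsP[Sz zx]]; apply/hsP => //.
    by split=> //; apply: le_trans zx (ltW xy).
  apply: uniq_leq_size; rewrite /= undup_uniq andbT mem_undup.
  by apply/negP => /hsP[_]; rewrite leNgt xy.
Qed.

End Reals.

Theorem mainTheorem1 (R : realType) (c : game) (hc : surreal c)
    (hc1 : gle gone c) (Q : {posnum R} -> {posnum R}) (hQ : Sk Q) :
  let S := [set r : R | 0 < r /\
    exists2 h : {posnum R} -> {posnum R}, Sk h &
      gsim (gpow (gdiv (Sk_surreal h) (Sk_surreal Q)) c) (greal r)] in
  [/\ well_ordered_set S, limit_point S = set0 & embeds_in_omega S].
Proof.
move=> S; apply: locally_finite_set => B.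
have [sQ SQ] := Sk_graph_SkN (Sk_surrealP hQ).
have c1 : 1 <= cl c by rewrite -cl1; apply/cl_le => //; exact: surreal_one.
(* An infinite part of [S] below [B] yields an injective sequence in it. *)
apply: contrapT => /infiniteP/pcard_leP[f].
have fS n : (S `&` [set r | r <= B]) (f n) by apply: (@funS _ _ _ _ f).
have inj_f : injective f.
  by move=> i j; apply: (@inj _ _ setT f); rewrite in_setT.
have /choice[h hh] : forall n, exists h : {posnum R} -> {posnum R}, Sk h /\
    gsim (gpow (gdiv (Sk_surreal h) (Sk_surreal Q)) c) (greal (f n)).
  by move=> n; have [[_ [h Sh sh]] _] := fS n; exists h.
pose a n := cl (Sk_surreal (h n)); pose q := cl (Sk_surreal Q).
have Sa n : surreal (Sk_surreal (h n)) /\ SkN (a n).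
  by have [Sh _] := hh n; exact: Sk_graph_SkN (Sk_surrealP Sh).
apply: (@no_bounded_sequence R (cl c) q a f B) => //.
- by move=> n; have [] := Sa n.
- by move=> n; have [[-> _] /= ->] := fS n.
- move=> n; have [sn Sn] := Sa n; have [_ /gsim_sim] := hh n.
  have sd := surreal_div sn sQ.
  have Ed : cl (gdiv (Sk_surreal (h n)) (Sk_surreal Q)) = Exp (Log (a n) - Log q).
    by rewrite cl_div // ExpD ExpN !SkN_LogK.
  (* The quotient h/Q need not be a Skolem surreal, but it is exp of a difference of logarithms, so
     [glog] returns a true logarithm. *)
  have [sl El] : surreal (glog (gdiv (Sk_surreal (h n)) (Sk_surreal Q))) /\
      Exp (cl (glog (gdiv (Sk_surreal (h n)) (Sk_surreal Q)))) = Exp (Log (a n) - Log q).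
    by rewrite -Ed; apply: glogP => //; rewrite Ed; eexists.
  have sp := surreal_mul hc sl.
  rewrite /gpow Exp_cl // clM // (Exp_inj El); apply.
    exact: surreal_exp.
  exact: surreal_real.
Qed.
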